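(* Let $X$ be a real-valued stochastic process on $\mathcal{X}$ with continuous marginal distributions, let $X_1,X_2,\ldots$ be independent copies of $X$, and let $s_1,\ldots,s_k\in\mathcal{X}$, $k\ge 2$, be distinct locations. Let $\eta$ be a simple max-stable process on $\mathcal{X}$ with the spectral (Poisson) representation given in the context. Assume that there are strictly increasing deterministic functions $h_1,\ldots,h_k$ such that the random vector $[h_1\{X(s_1)\},\ldots,h_k\{X(s_k)\}]$ belongs to the maximum domain of attraction of $\{\eta(s_1),\ldots,\eta(s_k)\}$. Then the sample hitting scenario $\pi_n$ of $X_1,\ldots,X_n$ at $s_1,\ldots,s_k$ converges weakly (in distribution, as random elements of the finite set of partitions of $\{1,\ldots,k\}$), as $n\to\infty$, to the extremal hitting scenario $\pi$ associated with $\eta$ at $s_1,\ldots,s_k$.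
   Context: $\mathcal{X}\subset\mathbb{R}^d$, $d\ge1$, is a compact set. Simple max-stable process: $\eta(s)=\max_{i\ge1}\zeta_iY_i(s)=\max_{\varphi\in\Phi}\varphi(s)$, $s\in\mathcal{X}$, where $\{\zeta_i\colon i\ge1\}$ are the points of a Poisson process on $(0,\infty)$ with intensity $\zeta^{-2}\,d\zeta$, the $Y_i$ are independent copies (independent of $\{\zeta_i\}$) of a non-negative stochastic process $Y$ on $\mathcal{X}$ with continuous sample paths, $\mathbb{E}\{Y(s)\}=1$ for all $s\in\mathcal{X}$ and $\mathbb{E}\{\sup_{s\in\mathcal{X}}Y(s)\}<\infty$; $\Phi=\{\varphi_i=\zeta_iY_i\colon i\ge1\}$ is the associated Poisson point process of non-negative continuous functions. Sample hitting scenario: let $M_n(s)=\max_{i=1,\ldots,n}X_i(s)$ and $C_i=\{j\in\{1,\ldots,k\}\colon M_n(s_j)=X_i(s_j)\}$, $i=1,\ldots,n$. Since $X$ has continuous marginals, almost surely the non-empty sets $C_i$ are disjoint, and $\pi_n=\{C_i\colon C_i\ne\emptyset\}$ is a random partition of $\{1,\ldots,k\}$. Extremal hitting scenario: $\pi$ is the random partition of $\{1,\ldots,k\}$ such that $j_1,j_2$ are in the same component of $\pi$ if and only if $\arg\max_{i\ge1}\varphi_i(s_{j_1})=\arg\max_{i\ge1}\varphi_i(s_{j_2})$ (the maximizers are almost surely unique). A random vector $V$ in $\mathbb{R}^k$ belongs to the maximum domain of attraction of a random vector $\eta$ if, for $V_1,V_2,\ldots$ independent copies of $V$, there exist $a_n\in(0,\infty)^k$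 and $b_n\in\mathbb{R}^k$ such that $(\max_{i=1,\ldots,n}V_i-b_n)/a_n\to\eta$ in distribution as $n\to\infty$, with all operations componentwise. *)

(* Defs.v *)
From HB Require Import structures.
From mathcomp Require Export all_boot all_order all_algebra.
From mathcomp Require Export all_classical all_reals all_analysis.
From mathcomp Require Export measurable_realfun.
Export numFieldNormedType.Exports.

Set Implicit Arguments.
Unset Strict Implicit.
Unset Printing Implicit Defensive.

Import Order.TTheory GRing.Theory Num.Theory.
Local Open Scope classical_set_scope.
Local Open Scope ring_scope.

Section random_families.

Definition sigma_family d' (E : measurableType d') (I T : Type)
    (X : I -> T -> E) : set (set T) :=
  <<s [set A | exists i, exists2 B, measurable B & A = X i @^-1` B] >>.

(* The law of a family X is its image on the path space I -> E, equipped
   with the product sigma-algebra, i.e. the one generated by the coordinate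
   maps (fun i p => p i); X1 and X2 may live on different spaces. *)
Definition same_law (R : realType) d' (E : measurableType d') (I : Type)
    d1 (T1 : measurableType d1) (P1 : probability T1 R) (X1 : I -> T1 -> E)
    d2 (T2 : measurableType d2) (P2 : probability T2 R) (X2 : I -> T2 -> E)
    : Prop :=
  forall A : set (I -> E), sigma_family (fun i (p : I -> E) => p i) A ->
    P1 [set t | A (X1 ^~ t)] = P2 [set t | A (X2 ^~ t)].

Definition independent_classes (R : realType) d (T : measurableType d)
    (P : probability T R) (J : eqType) (F : J -> set (set T)) : Prop :=
  forall (r : seq J) (A : J -> set T), uniq r ->
    (forall j, j \in r -> F j (A j)) ->
    P (\bigcap_(j in [set` r]) A j) = (\prod_(j <- r) P (A j))%E.

Definition independent_copies (R : realType) (I : Type)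
    d (T : measurableType d) (P : probability T R) (Xs : nat -> I -> T -> R)
    d0 (T0 : measurableType d0) (P0 : probability T0 R) (X : I -> T0 -> R)
    : Prop :=
  (forall n, same_law P (Xs n) P0 X) /\
  independent_classes P (fun n => sigma_family (Xs n)).

Definition cvg_in_law (R : realType) (E : topologicalType)
    d (T : measurableType d) (P : probability T R) (Z : nat -> T -> E)
    d' (T' : measurableType d') (P' : probability T' R) (Z' : T' -> E)
    : Prop :=
  forall f : E -> R, continuous f -> (exists M, forall x, `|f x| <= M) ->
    ('E_P[fun t => f (Z n t)] @[n --> \oo] --> 'E_P'[fun t => f (Z' t)])%E.

End random_families.

Section maxima.

(* The maximum of x 0, ..., x (n - 1); only meaningful for 0 < n. *)
Definition sample_max (R : realType) (I : Type) (x : nat -> I -> R) (n : nat)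
    (s : I) : R :=
  \big[Num.max/x 0%N s]_(i < n) x i s.

(* Quantifying over every realization of the copies (on any probability space)
   makes this a property of the laws of V and Z only. *)
Definition max_domain_of_attraction (R : realType) (k : nat)
    d0 (T0 : measurableType d0) (P0 : probability T0 R) (V : 'I_k -> T0 -> R)
    d' (T' : measurableType d') (P' : probability T' R) (Z : 'I_k -> T' -> R)
    : Prop :=
  forall d (T : measurableType d) (P : probability T R)
         (Vs : nat -> 'I_k -> {RV P >-> R}),
    independent_copies P Vs P0 V ->
    exists a b : nat -> 'I_k -> R,
      (forall n j, 0 < a n j) /\
      cvg_in_law P
        (fun n t => \row_j
           ((sample_max (fun i l => Vs i l t) n j - b n j) / a n j))
        P' (fun t => \row_j Z j t).

End maxima.

Section max_stable.

Definition point_count (R : realType) (T : Type) (zeta : nat -> T -> R)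
    (B : set R) (t : T) : \bar R :=
  (\sum_(0 <= i <oo) \d_(zeta i t) B)%E.

(* The points zeta i, i in nat, counted with multiplicity, form a Poisson
   process on D with intensity measure mu.  The Poisson probabilities are
   written out because [poisson_pmf] is constantly 1 at rate 0. *)
Definition poisson_process (R : realType) d (T : measurableType d)
    (P : probability T R) (D : set R) (mu : set R -> \bar R)
    (zeta : nat -> T -> R) : Prop :=
  [/\ forall i t, D (zeta i t),
      forall B, measurable B -> B `<=` D -> (mu B < +oo)%E ->
        forall n : nat, P [set t | point_count zeta B t = n%:R%:E] =
          (fine (mu B) ^+ n / n`!%:R * expR (- fine (mu B)))%:E,
      forall B, measurable B -> B `<=` D -> mu B = +oo%E ->
        P [set t | point_count zeta B t = +oo%E] = 1%E
    & forall m (B : 'I_m -> set R),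
        (forall j, measurable (B j) /\ B j `<=` D) -> trivIset setT B ->
        independent_classes P
          (fun j => sigma_family
             (fun _ : unit => point_count zeta (B j)))].

Definition inverse_square_intensity (R : realType) (B : set R) : \bar R :=
  (\int[lebesgue_measure]_(z in B) ((z ^+ 2)^-1)%:E)%E.

Definition spectral_process (R : realType) (S : topologicalType)
    d (T : measurableType d) (P : probability T R) (Y : S -> {RV P >-> R})
    : Prop :=
  [/\ forall s t, 0 <= Y s t,
      forall t, continuous (fun s => Y s t),
      forall s, ('E_P[Y s] = 1)%E
    & (\int[P]_t ereal_sup (range (fun s => (Y s t)%:E)) < +oo)%E].

Definition spectral_function (R : realType) (S T : Type)
    (zeta : nat -> T -> R) (Ys : nat -> S -> T -> R) (t : T) (i : nat) (s : S)
    : R :=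
  zeta i t * Ys i s t.

Definition simple_max_stable (R : realType) (S : topologicalType)
    dY (TY : measurableType dY) (PY : probability TY R) (Y : S -> {RV PY >-> R})
    d (T : measurableType d) (P : probability T R)
    (zeta : nat -> {RV P >-> R}) (Ys : nat -> S -> {RV P >-> R})
    (eta : S -> {RV P >-> R}) : Prop :=
  [/\ spectral_process Y,
      poisson_process P `]0, +oo[ (@inverse_square_intensity R) zeta,
      [/\ independent_copies P Ys PY Y,
          (* pathwise properties, not implied by equality in law *)
          forall i t, continuous (fun s => Ys i s t),
          forall i s t, 0 <= Ys i s t
        & independent_classes P (fun b : bool =>
            if b then sigma_family zeta
            else sigma_family (fun q : nat * S => Ys q.1 q.2))]
    & {ae P, forall t, forall s,
        let phi := spectral_function zeta Ys t in
        (exists i, eta s t = phi i s) /\ (forall i, phi i s <= eta s t)}].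

End max_stable.

Section hitting_scenarios.

(* A partition of 'I_k is represented by its set of blocks. *)
Notation scenario k := (discrete_topology {set {set 'I_k}}).

Definition hitting_set (R : realType) (I : Type) (k : nat) (loc : 'I_k -> I)
    (x : nat -> I -> R) (n : nat) (i : 'I_n) : {set 'I_k} :=
  [set j | sample_max x n (loc j) == x i (loc j)].

Definition sample_hitting_scenario (R : realType) (I : Type) (k : nat)
    (loc : 'I_k -> I) (x : nat -> I -> R) (n : nat) : scenario k :=
  [set C in [set hitting_set loc x i | i : 'I_n] | C != finset.set0].

(* The set of all maximizers; almost surely it is a singleton, in which case
   equality of these sets is equality of the maximizers. *)
Definition argmax (R : realType) (I : Type) (phi : nat -> I -> R) (s : I)
    : set nat :=
  [set i | forall i', phi i' s <= phi i s].

Definition extremal_hitting_scenario (R : realType) (I : Type) (k : nat)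
    (loc : 'I_k -> I) (phi : nat -> I -> R) : scenario k :=
  equivalence_partition
    (fun j1 j2 => `[< argmax phi (loc j1) = argmax phi (loc j2) >])
    [set: 'I_k].

End hitting_scenarios.

(* Main.v *)
(* Cut every coordinate axis of R^k into finitely many levels, the lowest one
   reaching up to a small positive number, so that R^k falls into finitely many
   cells.  If every coordinate is hit by some point above its lowest level and
   no two points share a level above the lowest one, the hitting scenario is a
   function of the set of nonlowest cells that contain a point.  It therefore
   suffices that the law of this set converges, and that the exceptional events
   are unlikely on a fine grid.

   By Moebius inversion the law of the set of occupied cells is determined by
   the probabilities that a union A of cells is empty.  For the Poisson process
   of spectral functions this is exp (- Lam A), where Lam is the exponent
   measure, and A contains two points with probability at most (Lam A) ^ 2.
   Both follow from the generating functions
   E (1 - c) ^ N(A) = exp (- c Lam A), proved first with the zeta_i rounded down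
   to a mesh, which only involves finitely many independent Poisson counts.
   For the sample, convergence of the maxima says that the n-th power of the
   distribution function converges, so n P(X in A) -> Lam A by Moebius inversion
   over the cells, and (1 - P(X in A)) ^ n -> exp (- Lam A). *)

Require Import Defs.
From mathcomp Require Import ring lra zify.

Set Implicit Arguments.
Unset Strict Implicit.
Unset Printing Implicit Defensive.

Import Order.TTheory GRing.Theory Num.Theory.
Local Open Scope classical_set_scope.
Local Open Scope ring_scope.

(** * Limits of powers and Moebius inversion *)

Section real_limits.
Variable R : realType.
Implicit Types (u p : nat -> R) (L : R).

(** The cell of lowest levels has infinite mass: all but finitely many Poisson points lie in it, and
    so does almost all of the rescaled sample. Rates, void probabilities and inversions are
    therefore stated for sets of cells that avoid [cell0], and lower sets, which contain it, enter
    only through their complements.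

    Generating functions are kept for every c in [0, 1], although c = 1 already gives the void
    probabilities. Their slope at c = 0 bounds the expected number of points, and the values at c =
    1 and c = 1/2 together bound the probability of two points. The bound on the expected number
    makes the limit over the Poisson points uniform in the mesh, so that it can be exchanged with
    the limit of fine meshes.

    Rounding goes strictly downwards because levels are increasing and left-continuous. Rounding
    then only lowers cells, so one summable family of events dominates the hits on all meshes, and
    each hit indicator is eventually exact. *)

Lemma ln_sandwich (x : R) : 0 < x -> x <= 1 -> 1 - x <= - ln x <= (1 - x) / x.
Proof.
move=> x0 x1; apply/andP; split.
  have := @le_ln1Dx R (x - 1); rewrite addrCA subrr addr0 => h.
  have := h _; rewrite ltrBrDl subrr => /(_ x0); lra.
have := @le_ln1Dx R (x^-1 - 1); rewrite addrCA subrr addr0 lnV ?posrE// => h.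
have -> : (1 - x) / x = x^-1 - 1 by rewrite mulrBl mul1r divff ?gt_eqF.
by apply: h; rewrite ltrBrDl subrr invr_gt0.
Qed.

Lemma cvg_invn : n%:R^-1 @[n --> \oo] --> (0 : R).
Proof.
apply/gtr0_cvgV0; last exact: cvgr_idn.
by near=> n; rewrite ltr0n; near: n; exact: nbhs_infty_gt.
Unshelve. all: by end_near. Qed.

(** [n (1 - u n)] and [- n ln (u n)] differ by a factor between 1 and [1 / u n], and [u n] tends to
    1 because [n (1 - u n)] converges. *)
Lemma cvg_pow_of_cvg_complement u L : (forall n, 0 <= u n <= 1) ->
  n%:R * (1 - u n) @[n --> \oo] --> L -> u n ^+ n @[n --> \oo] --> expR (- L).
Proof.
move=> u01 hL.
have hu : u n @[n --> \oo] --> (1 : R).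
  have h0 : n%:R^-1 * (n%:R * (1 - u n)) @[n --> \oo] --> 0 * L.
    by apply: cvgM => //; exact: cvg_invn.
  have h1 : 1 - n%:R^-1 * (n%:R * (1 - u n)) @[n --> \oo] --> 1 - 0 * L.
    by apply: cvgB => //; exact: cvg_cst.
  rewrite mul0r subr0 in h1; apply: cvg_trans h1; apply: near_eq_cvg.
  near=> n; rewrite mulrA mulVf ?mul1r ?subKr// pnatr_eq0 -lt0n.
  by near: n; exact: nbhs_infty_gt.
have hy : n%:R * (- ln (u n)) @[n --> \oo] --> L.
  apply: (@squeeze_cvgr _ _ _ _ (fun n => n%:R * (1 - u n)) (fun n => n%:R * (1 - u n) / u n)) => //.
    near=> n; have un0 : 0 < u n by near: n; exact: (cvgr_gt _ hu).
    have /andP[_ un1] := u01 n; have /andP[h1 h2] := ln_sandwich un0 un1.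
    by rewrite ler_wpM2l//= -mulrA ler_wpM2l.
  rewrite -[X in _ --> X]mulr1 -[X in _ * X]invr1.
  by apply: cvgM => //; apply: cvgV => //; rewrite oner_neq0.
have he : expR (- (n%:R * (- ln (u n)))) @[n --> \oo] --> expR (- L).
  by apply: continuous_cvg; [exact: continuous_expR|exact: cvgN].
apply: cvg_trans he; apply: near_eq_cvg.
near=> n; have un0 : 0 < u n by near: n; exact: (cvgr_gt _ hu).
by rewrite mulrN opprK expRM_natl lnK.
Unshelve. all: by end_near. Qed.

(** The same comparison read backwards. Here [u n] tends to 1 because its logarithm is that of
    [u n ^+ n], which converges, divided by [n]. *)
Lemma cvg_complement_of_cvg_pow u L : (forall n, 0 <= u n <= 1) ->
  u n ^+ n @[n --> \oo] --> expR (- L) -> n%:R * (1 - u n) @[n --> \oo] --> L.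
Proof.
move=> u01 hL.
have hy : - ln (u n ^+ n) @[n --> \oo] --> L.
  rewrite -[X in _ --> X]opprK -[X in - X]expRK; apply: cvgN.
  by apply: continuous_cvg => //; apply: continuous_ln; exact: expR_gt0.
have upos : \forall n \near \oo, 0 < u n.
  near=> n; have un0 : 0 < u n ^+ n.
    by near: n; apply: (cvgr_gt _ hL); exact: expR_gt0.
  have /andP[un _] := u01 n; rewrite lt_neqAle un andbT eq_sym.
  (* [0 ^+ n] vanishes except at [n = 0], which is excluded for large [n]. *)
  apply: contraTneq un0 => ->; rewrite expr0n; case: eqP; rewrite ?ltxx// => n0.
  suff : (0 < n)%N by rewrite n0.
  by near: n; exact: nbhs_infty_gt.
have lnp : \forall n \near \oo, - ln (u n ^+ n) = n%:R * - ln (u n).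
  by near=> n; rewrite lnXn ?mulrN ?mulr_natl//; near: n.
have hu : u n @[n --> \oo] --> (1 : R).
  have h1 : expR (- (n%:R^-1 * - ln (u n ^+ n))) @[n --> \oo] --> expR (- (0 * L)).
    apply: continuous_cvg; first exact: continuous_expR.
    by apply: cvgN; apply: cvgM => //; exact: cvg_invn.
  rewrite mul0r oppr0 expR0 in h1; apply: cvg_trans h1; apply: near_eq_cvg.
  near=> n; rewrite (near lnp n)// mulrA mulVf ?mul1r ?opprK ?lnK ?posrE//.
    by near: n.
  by rewrite pnatr_eq0 -lt0n; near: n; exact: nbhs_infty_gt.
apply: (@squeeze_cvgr _ _ _ _ (fun n => u n * (- ln (u n ^+ n))) (fun n => - ln (u n ^+ n))) => //; last first.
  by rewrite -[X in _ --> X]mul1r; exact: cvgM.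
near=> n; have un0 : 0 < u n by near: n.
rewrite (near lnp n)//.
have /andP[_ un1] := u01 n; have /andP[h1 h2] := ln_sandwich un0 un1.
rewrite [X in _ && X]ler_wpM2l// andbT mulrCA ler_wpM2l//.
by rewrite -ler_pdivlMl// mulrC.
Unshelve. all: by end_near. Qed.

Lemma cvg_sum (I : Type) (r : seq I) (P : pred I) (f : I -> nat -> R) (l : I -> R) :
  (forall i, P i -> f i n @[n --> \oo] --> l i) ->
  \sum_(i <- r | P i) f i n @[n --> \oo] --> \sum_(i <- r | P i) l i.
Proof. by move=> h; apply: cvg_big => //; exact: add_continuous. Qed.

(** Induction on [rank] stands in for the Moebius function: [w n d] is its lower sum minus the terms
    strictly below [d], whose limits are already known. *)
Lemma cvg_moebius (D : finType) (le : rel D) (rank : D -> nat)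
    (w : nat -> D -> R) (w' : D -> R) :
  reflexive le -> (forall e d, le e d -> e != d -> (rank e < rank d)%N) ->
  (forall d, \sum_(e | le e d) w n e @[n --> \oo] --> \sum_(e | le e d) w' e) ->
  forall d, w n d @[n --> \oo] --> w' d.
Proof.
move=> lexx lt_rank hw d.
have [m] := ubnP (rank d); elim: m d => // m IH d; rewrite ltnS => rdm.
have E (v : D -> R) : v d = \sum_(e | le e d) v e - \sum_(e | le e d && (e != d)) v e.
  by rewrite (bigD1 d)//= addrK.
rewrite E; under eq_fun do rewrite E.
apply: cvgB => //; apply: cvg_sum => e /andP[led ned].
by apply: IH; exact: leq_trans (lt_rank _ _ led ned) rdm.
Qed.

End real_limits.

(** * Cells of a grid and hitting scenarios *)

Section levels.
Variables (R : realType) (M : nat) (g : nat -> R).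
Hypothesis g_mono : forall l l', (l <= l' < M)%N -> g l <= g l'.

(** For increasing [g] this counts the thresholds strictly below [v]. Level sets are thus left-open
    and right-closed: upper bounds on levels become the events [v <= g l] of distribution functions,
    and [level] is left-continuous, which suits rounding down. *)
Definition level (v : R) : nat := find (fun l => v <= g l) (iota 0 M).

Lemma level_le (v : R) : (level v <= M)%N.
Proof. by rewrite -[X in (_ <= X)%N](size_iota 0) find_size. Qed.

Lemma level_gtn (l : nat) (v : R) : (l < M)%N -> (l < level v)%N = (g l < v).
Proof.
move=> lM; apply/idP/idP => [llv|glv].
  by have := before_find 0%N llv; rewrite nth_iota// add0n ltNge => ->.
rewrite ltnNge; apply/negP => lvl.
have lvM : (level v < M)%N by exact: leq_ltn_trans lM.
have := @nth_find _ 0%N (fun l => v <= g l) (iota 0 M).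
rewrite has_find size_iota lvM => /(_ isT); rewrite nth_iota// add0n.
by move=> /le_trans/(_ (g_mono (introT andP (conj lvl lM)))); rewrite leNgt glv.
Qed.

Lemma level_leq (v v' : R) : v <= v' -> (level v <= level v')%N.
Proof.
move=> vv'; rewrite leqNgt; apply/negP => h.
have h' := leq_trans h (level_le v).
by move: h; rewrite level_gtn// ltNge; apply/negP; rewrite negbK (le_trans vv')// leNgt -level_gtn// ltnn.
Qed.

Lemma level_ltn (v v' : R) : (level v < level v')%N -> v < v'.
Proof. by move=> h; rewrite ltNge; apply/negP => /level_leq; rewrite leqNgt h. Qed.

End levels.

Section cells.
Variables (R : realType) (k M : nat) (g : nat -> R).
Hypothesis g_mono : forall l l', (l <= l' < M)%N -> g l <= g l'.

Definition cellT : finType := {ffun 'I_k -> 'I_M.+1}.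

Definition cell (x : 'I_k -> R) : cellT := [ffun j => inord (level M g (x j))].

Definition cell0 : cellT := [ffun => ord0].

Lemma cellE x j : cell x j = level M g (x j) :> nat.
Proof. by rewrite ffunE inordK// ltnS level_le. Qed.

Definition slab (j : 'I_k) (l : nat) : {set cellT} := [set d : cellT | d j == l :> nat]%SET.

Definition upper (j : 'I_k) (l : nat) : {set cellT} := [set d : cellT | (l < d j)%N]%SET.

(** [cell0] is excluded because void probabilities are controlled only away from it. *)
Definition occupied (I : Type) (c : I -> cellT) : {set cellT} :=
  [set d : cellT | (d != cell0) && `[< exists i, c i = d >]]%SET.

Definition maximizers (I : Type) (x : I -> 'I_k -> R) (j : 'I_k) : set I :=
  [set i | forall i', x i' j <= x i j].

(** The cells of [A] that are highest in coordinate [j], kept as a set so that no default cell is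
    needed. For the occupied cells of separated points it is a singleton. *)
Definition top (A : {set cellT}) (j : 'I_k) : {set cellT} :=
  [set d : cellT in A | [forall e : cellT in A, (e j <= d j)%N]]%SET.

Definition separated (I : Type) (x : I -> 'I_k -> R) : Prop :=
  (forall j, exists i, (0 < cell (x i) j)%N) /\
  (forall j i i', (0 < cell (x i) j)%N -> cell (x i) j = cell (x i') j -> i = i').

(** Levels are at most [M], so even infinitely many points attain a highest level in coordinate [j].
    That level is positive, hence held by a single point, and a strictly higher level forces a
    strictly larger value. *)
Lemma separated_maximizer (I : Type) (x : I -> 'I_k -> R) (j : 'I_k) :
  separated x -> exists i, [/\ (0 < cell (x i) j)%N, maximizers x j = [set i]
    & top (occupied (fun i => cell (x i))) j = [set cell (x i)]%SET].
Proof.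
move=> [hpos hsep].
pose p := [pred m : nat | `[< exists i, cell (x i) j = m :> nat >]].
have [i0 i0pos] := hpos j.
have exp : exists m, p m by exists (cell (x i0) j); apply/asboolP; exists i0.
have ubp m : p m -> (m <= M)%N.
  by move=> /asboolP[i <-]; rewrite -ltnS.
have [m /asboolP[i im] mmax] := ex_maxnP exp ubp.
have le_i i' : (cell (x i') j <= cell (x i) j)%N.
  by rewrite im; apply: mmax; apply/asboolP; exists i'.
have ipos : (0 < cell (x i) j)%N by exact: leq_trans i0pos (le_i i0).
have uniq_i i' : cell (x i') j = cell (x i) j :> nat -> i' = i.
  by move=> /val_inj h; symmetry; exact: hsep (esym h).
have lt_i i' : i' <> i -> x i' j < x i j.
  move=> ne; apply: (level_ltn g_mono); rewrite -!cellE ltn_neqAle le_i andbT.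
  by apply/eqP => /uniq_i.
exists i; split => //.
- apply/seteqP; split => [i' /= h|_ -> i'].
    by apply: contrapT => /lt_i; rewrite ltNge h.
  by have [->//|ne] := pselect (i' = i); exact: ltW (lt_i _ ne).
- have occ i' : (0 < cell (x i') j)%N -> cell (x i') \in occupied (fun i => cell (x i)).
    move=> h; rewrite inE; apply/andP; split; last by apply/asboolP; exists i'.
    by apply: contraTneq h => ->; rewrite ffunE.
  apply/setP => d; rewrite !inE; apply/idP/eqP => [/andP[/andP[_ /asboolP[i' <-]]]|->].
    move=> /forall_inP/(_ _ (occ i ipos)) h.
    by rewrite (uniq_i i')//; apply/eqP; rewrite eqn_leq h le_i.
  have := occ i ipos; rewrite inE => -> /=; apply/forall_inP => e.
  by rewrite inE => /andP[_ /asboolP[i' <-]].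
Qed.

Lemma separated_top (I : Type) (x : I -> 'I_k -> R) (j1 j2 : 'I_k) :
  separated x -> (maximizers x j1 = maximizers x j2) <->
    (top (occupied (fun i => cell (x i))) j1 = top (occupied (fun i => cell (x i))) j2).
Proof.
move=> sx; have [i1 [p1 -> ->]] := separated_maximizer j1 sx.
have [i2 [p2 -> ->]] := separated_maximizer j2 sx; split => [|].
  by move=> /(congr1 (fun A => A i1))/= h; have -> : i1 = i2 by rewrite -h.
move=> /set1_inj e; have [_ /(_ j1 i1 i2 p1) ->//] := sx.
by rewrite e.
Qed.

Definition scenario_of_cells (A : {set cellT}) : {set {set 'I_k}} :=
  equivalence_partition (fun j1 j2 => top A j1 == top A j2) [set: 'I_k]%SET.

Definition argmax_partition (I : Type) (x : I -> 'I_k -> R) : {set {set 'I_k}} :=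
  equivalence_partition (fun j1 j2 => `[< maximizers x j1 = maximizers x j2 >]) [set: 'I_k]%SET.

Lemma scenario_of_cellsE (I : Type) (x : I -> 'I_k -> R) : separated x ->
  argmax_partition x = scenario_of_cells (occupied (fun i => cell (x i))).
Proof.
move=> sx; congr (equivalence_partition _ _).
apply/funext => j1; apply/funext => j2; apply/asboolP/eqP => h; exact/(separated_top j1 j2 sx).
Qed.

End cells.

(** * Sample scenarios from the order of the values *)

Section sample.
Variables (R : realType) (I : Type) (k : nat) (loc : 'I_k -> I).

Lemma sample_max_eq (x : nat -> I -> R) n (i : 'I_n) s :
  (sample_max x n s == x i s) = `[< forall i' : 'I_n, x i' s <= x i s >].
Proof.
apply/eqP/asboolP => [<- i'|h]; first exact: le_bigmax_cond.
apply/eqP; rewrite eq_le (le_bigmax _ (fun i : 'I_n => x i s))// andbT.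
apply: bigmax_le => [|i' _]; last exact: h.
have n0 : (0 < n)%N by exact: leq_ltn_trans (leq0n i) (ltn_ord i).
exact: (h (Ordinal n0)).
Qed.

(** A hitting scenario depends only on the order of the values at each location, so it can be read
    off any [y] with the same order. When maximizers are unique, the nonempty hitting sets are
    exactly the classes of coordinates with a common maximizer. *)
Lemma sample_hitting_scenarioE (x : nat -> I -> R) n (y : 'I_n -> 'I_k -> R) :
  (forall j (i i' : 'I_n), (x i (loc j) <= x i' (loc j)) = (y i j <= y i' j)) ->
  (forall j, exists i, maximizers y j = [set i]) ->
  sample_hitting_scenario loc x n = argmax_partition y.
Proof.
move=> xy ymax.
have hit (i : 'I_n) j : (j \in hitting_set loc x i) = `[< maximizers y j = [set i] >].
  rewrite inE sample_max_eq; apply/asboolP/asboolP => [h|h i']; last first.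
    by rewrite xy; have : [set i] i by []; rewrite -h; exact.
  have [i1 h1] := ymax j; rewrite h1; congr set1; symmetry.
  by have : maximizers y j i by [move=> i'; rewrite -xy]; rewrite h1.
apply/setP => C; rewrite inE; apply/andP/imsetP => [[/imsetP[i _ ->]]|[j _ ->]].
  move=> /set0Pn[j jC]; exists j => //; apply/setP => j'; rewrite hit !inE/=.
  move: jC; rewrite hit => /asboolP ->.
  by apply/asboolP/asboolP => ->.
have [i hi] := ymax j; split.
  apply/imsetP; exists i => //; apply/setP => j'; rewrite hit !inE/= hi.
  by apply/asboolP/asboolP => ->.
by apply/set0Pn; exists j; rewrite inE inE/=; exact/asboolP.
Qed.

End sample.

(** * Events and expectations *)

Section sigma_algebras.
Variables (T : Type) (F : set (set T)).
Hypothesis sF : sigma_algebra setT F.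

Lemma sigma_algebra_setC A : F A -> F (~` A).
Proof. by case: sF => _ h _ /h; rewrite setTD. Qed.

Lemma sigma_algebra_exists (Q : nat -> T -> Prop) :
  (forall n, F [set t | Q n t]) -> F [set t | exists n, Q n t].
Proof.
case: sF => _ _ h hQ; have := h _ hQ; congr (F _).
by apply/seteqP; split => t /= [n]; [move=> _; exists n|exists n].
Qed.

Lemma sigma_algebra_not (Q : T -> Prop) : F [set t | Q t] -> F [set t | ~ Q t].
Proof. exact: sigma_algebra_setC. Qed.

Lemma sigma_algebra_forall (Q : nat -> T -> Prop) :
  (forall n, F [set t | Q n t]) -> F [set t | forall n, Q n t].
Proof.
move=> hQ; have -> : [set t | forall n, Q n t] = ~` [set t | exists n, ~ Q n t].
  by apply/seteqP; split => t /=; [move=> h [n]; apply|move=> /forallNP h n; apply: contrapT].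
by apply: sigma_algebra_setC; apply: sigma_algebra_exists => n; exact: sigma_algebra_not.
Qed.

Lemma sigma_algebra_cst (p : Prop) : F [set t | p].
Proof.
have F0 : F set0 by case: sF.
have [hp|hp] := pselect p.
  have -> : [set t : T | p] = ~` set0 by rewrite setC0; apply/seteqP; split.
  exact: sigma_algebra_setC.
by have -> : [set t : T | p] = set0 by apply/seteqP; split.
Qed.

Lemma sigma_algebra_exists_fin (J : finType) (Q : J -> T -> Prop) :
  (forall j, F [set t | Q j t]) -> F [set t | exists j, Q j t].
Proof.
move=> hQ; have -> : [set t | exists j, Q j t] =
    [set t | exists n, match (insub n : option 'I_#|J|) with
                       | Some i => Q (enum_val i) t | None => False end].
  apply/seteqP; split => t /= [].
    by move=> j Qj; exists (enum_rank j); rewrite valK enum_rankK.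
  by move=> n; case: insubP => // i _ _ h; exists (enum_val i).
apply: sigma_algebra_exists => n; case: insub => [i|]; first exact: hQ.
exact: sigma_algebra_cst.
Qed.

Lemma sigma_algebra_forall_fin (J : finType) (Q : J -> T -> Prop) :
  (forall j, F [set t | Q j t]) -> F [set t | forall j, Q j t].
Proof.
move=> hQ; have -> : [set t | forall j, Q j t] = ~` [set t | exists j, ~ Q j t].
  by apply/seteqP; split => t /=; [move=> h [n]; apply|move=> /forallNP h n; apply: contrapT].
by apply: sigma_algebra_setC; apply: sigma_algebra_exists_fin => n; exact: sigma_algebra_not.
Qed.

Lemma sigma_algebra_and (Q Q' : T -> Prop) :
  F [set t | Q t] -> F [set t | Q' t] -> F [set t | Q t /\ Q' t].
Proof.
move=> h h'; have -> : [set t | Q t /\ Q' t] = [set t | forall b : bool, if b then Q t else Q' t].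
  apply/seteqP; split => t /=; first by case=> ? ? [].
  by move=> /[dup] /(_ true) ? /(_ false).
by apply: sigma_algebra_forall_fin => -[].
Qed.

(** Measurability of a discrete map with respect to an arbitrary sigma-algebra [F]: the whole
    [measurable] when a probability is taken, a [sigma_family] when independence is invoked. *)
Definition fibers_in (U : Type) (f : T -> U) := forall y, F [set t | f t = y].

Lemma fibers_in_pred (U : finType) (f : T -> U) (Q : U -> Prop) :
  fibers_in f -> F [set t | Q (f t)].
Proof.
move=> hf; have -> : [set t | Q (f t)] = [set t | exists y, f t = y /\ Q y].
  by apply/seteqP; split => t /=; [move=> h; exists (f t)|move=> [y [->]]].
apply: sigma_algebra_exists_fin => y; apply: sigma_algebra_and => //.
exact: sigma_algebra_cst.
Qed.

Lemma fibers_in_ffun (J : finType) (U : Type) (f : J -> T -> U) :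
  (forall j, fibers_in (f j)) -> fibers_in (fun t => [ffun j => f j t]).
Proof.
move=> hf y; have -> : [set t | [ffun j => f j t] = y] = [set t | forall j, f j t = y j].
  apply/seteqP; split => t /=; first by move=> <- j; rewrite ffunE.
  by move=> h; apply/ffunP => j; rewrite ffunE.
by apply: sigma_algebra_forall_fin => j; exact: hf.
Qed.

Lemma fibers_in_bool (Q : T -> Prop) : F [set t | Q t] -> fibers_in (fun t => `[< Q t >]).
Proof.
move=> h [].
  by move: h; congr (F _); apply/seteqP; split => t /= /asboolP.
move/sigma_algebra_not: h; congr (F _).
by apply/seteqP; split => t /= nQ; [exact: asboolF|move/negbT/asboolPn: nQ].
Qed.

End sigma_algebras.

Section level_events.
Variables (R : realType) (M : nat) (g : nat -> R).
Hypothesis g_mono : forall l l', (l <= l' < M)%N -> g l <= g l'.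
Variables (T : Type) (F : set (set T)).
Hypothesis sF : sigma_algebra setT F.

Lemma fibers_level (X : T -> R) : (forall B : set R, measurable B -> F (X @^-1` B)) ->
  fibers_in F (fun t => level M g (X t)).
Proof.
move=> h.
have gt l : F [set t | (l < level M g (X t))%N].
  have [lM|Ml] := ltnP l M.
    rewrite (_ : [set t | _] = X @^-1` `]g l, +oo[%classic); first exact: h.
    by apply/seteqP; split => t /=; rewrite level_gtn// in_itv/= andbT.
  rewrite (_ : [set t | _] = [set t | False]); first exact: sigma_algebra_cst.
  by apply/seteqP; split => t //=; rewrite ltnNge (leq_trans (level_le _ _ _)).
case=> [|l].
  have := sigma_algebra_not sF (gt 0%N); congr F; apply/seteqP; split => t /=; last by move=> ->.
  by move/negP; rewrite lt0n negbK => /eqP.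
have := sigma_algebra_and sF (gt l) (sigma_algebra_not sF (gt l.+1)).
congr F; apply/seteqP; split => t /=; last by move=> ->; rewrite ltnn.
by move=> [h1 /negP]; rewrite -leqNgt => h2; apply/eqP; rewrite eqn_leq h1 h2.
Qed.

Lemma fibers_cell k (X : 'I_k -> T -> R) :
  (forall j (B : set R), measurable B -> F (X j @^-1` B)) ->
  fibers_in F (fun t => cell M g (fun j => X j t)).
Proof.
move=> h; apply: fibers_in_ffun => // j y.
have := fibers_level (h j) y; congr F; apply/seteqP; split => t /=.
  by move=> ->; rewrite inord_val.
by move=> <-; rewrite inordK// ltnS level_le.
Qed.

End level_events.

Section sigma_families.
Context d' (E : measurableType d') (I T : Type).
Implicit Types X : I -> T -> E.

Lemma sigma_family_sigma_algebra X : sigma_algebra setT (sigma_family X).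
Proof. exact: smallest_sigma_algebra. Qed.

Lemma sigma_family_preimage X i (B : set E) : measurable B -> sigma_family X (X i @^-1` B).
Proof. by move=> mB; apply: sub_sigma_algebra; exists i, B. Qed.

Lemma sigma_family_min X (F : set (set T)) : sigma_algebra setT F ->
  (forall i (B : set E), measurable B -> F (X i @^-1` B)) -> sigma_family X `<=` F.
Proof. by move=> sF h; apply: smallest_sub => // _ [i [B mB ->]]; exact: h. Qed.

End sigma_families.

Lemma sigma_family_comp d' (E : measurableType d') (I T T' : Type) (X : I -> T -> E)
    (f : T' -> T) (A : set T) :
  sigma_family X A -> sigma_family (fun i t => X i (f t)) (f @^-1` A).
Proof.
have [h0 hC hU] := @sigma_family_sigma_algebra _ _ _ _ (fun i t => X i (f t)).
move: A; apply: (@sigma_family_min _ _ _ _ X (fun A => sigma_family (fun i t => X i (f t)) (f @^-1` A))).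
  by split => [//|A /hC|A /hU]; rewrite ?setTD.
by move=> i B mB; exact: sigma_family_preimage.
Qed.

Section probabilities.
Context d (T : measurableType d) (R : realType) (P : probability T R).
Implicit Types (A B : set T) (f : T -> R).

Definition Pr A : R := fine (P A).

Lemma PrE A : measurable A -> P A = (Pr A)%:E.
Proof. by move=> mA; rewrite fineK// fin_num_measure. Qed.

Lemma Pr_ge0 A : 0 <= Pr A.
Proof. by rewrite fine_ge0. Qed.

Lemma Pr_le A B : measurable A -> measurable B -> A `<=` B -> Pr A <= Pr B.
Proof. by move=> mA mB AB; rewrite -lee_fin -!PrE// le_measure// inE. Qed.

Lemma Pr_le1 A : measurable A -> Pr A <= 1.
Proof. by move=> mA; rewrite -lee_fin -PrE// probability_le1. Qed.

Lemma Pr_setC A : measurable A -> Pr (~` A) = 1 - Pr A.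
Proof. by move=> mA; rewrite {1}/Pr probability_setC// PrE. Qed.

Lemma Pr_setU A B : measurable A -> measurable B -> Pr (A `|` B) <= Pr A + Pr B.
Proof.
move=> mA mB; rewrite -lee_fin EFinD -!PrE//; last exact: measurableU.
exact: measureU2.
Qed.

Lemma Pr_exists (J : choiceType) (r : seq J) (A : J -> set T) : (forall j, measurable (A j)) ->
  Pr [set t | exists2 j, j \in r & A j t] <= \sum_(j <- r) Pr (A j).
Proof.
move=> mA.
have E : [set t | exists2 j, j \in r & A j t] = \big[setU/set0]_(j <- r) A j.
  by rewrite -bigcup_seq; apply/seteqP; split => t /= [j]; exists j.
have mU s : measurable (\big[setU/set0]_(j <- s) A j) by exact: bigsetU_measurable.
rewrite E; elim: r {E} => [|j r IH]; first by rewrite !big_nil /Pr measure0.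
by rewrite !big_cons (le_trans (Pr_setU _ _))// lerD2l.
Qed.

Lemma measurable_sigma_algebra : sigma_algebra setT (@measurable d T).
Proof.
split; first exact: measurable0.
- by move=> A mA; rewrite setTD; exact: measurableC.
- by move=> A mA; exact: bigcup_measurable.
Qed.

Definition bounded_rv f := measurable_fun setT f /\ exists M, forall t, `|f t| <= M.

Definition Ex f : R := Rintegral P setT f.

Lemma bounded_rv_integrable f : bounded_rv f -> P.-integrable setT (EFin \o f).
Proof.
move=> [mf [M fM]]; apply: measurable_bounded_integrable => //.
  by rewrite -ge0_fin_numE ?fin_num_measure.
by exists M; split; [exact: num_real|move=> x Mx t _ /=; exact: le_trans (fM t) (ltW Mx)].
Qed.

Lemma ExE f : bounded_rv f -> (\int[P]_t (f t)%:E = (Ex f)%:E)%E.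
Proof. by move=> /bounded_rv_integrable/integrable_fin_num h; rewrite fineK//; exact: h. Qed.

Lemma bounded_rv_cst c : bounded_rv (fun=> c).
Proof. by split; [exact: measurable_cst|exists `|c|]. Qed.

Lemma bounded_rvD f f' : bounded_rv f -> bounded_rv f' -> bounded_rv (fun t => f t + f' t).
Proof.
move=> [mf [M fM]] [mf' [M' fM']]; split; first exact: measurable_funD.
by exists (M + M') => t; rewrite (le_trans (ler_normD _ _))// lerD.
Qed.

Lemma bounded_rvM f f' : bounded_rv f -> bounded_rv f' -> bounded_rv (fun t => f t * f' t).
Proof.
move=> [mf [M fM]] [mf' [M' fM']]; split; first exact: measurable_funM.
by exists (M * M') => t; rewrite normrM ler_pM.
Qed.

Lemma bounded_rvZ c f : bounded_rv f -> bounded_rv (fun t => c * f t).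
Proof. by move=> bf; apply: bounded_rvM => //; exact: bounded_rv_cst. Qed.

Lemma bounded_rvN f : bounded_rv f -> bounded_rv (fun t => - f t).
Proof. by move=> /(bounded_rvZ (-1)); congr bounded_rv; apply/funext => t; rewrite mulN1r. Qed.

Lemma bounded_rvB f f' : bounded_rv f -> bounded_rv f' -> bounded_rv (fun t => f t - f' t).
Proof. by move=> bf /bounded_rvN; exact: bounded_rvD. Qed.

Lemma bounded_rv_sum (J : Type) (r : seq J) (Q : pred J) (F : J -> T -> R) :
  (forall j, Q j -> bounded_rv (F j)) -> bounded_rv (fun t => \sum_(j <- r | Q j) F j t).
Proof.
move=> h; elim: r => [|j r IH].
  have -> : (fun t => \sum_(j <- [::] | Q j) F j t) = (fun=> 0).
    by apply/funext => t; rewrite big_nil.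
  exact: bounded_rv_cst.
have -> : (fun t => \sum_(j <- j :: r | Q j) F j t) =
    (fun t => if Q j then F j t + \sum_(j <- r | Q j) F j t else \sum_(j <- r | Q j) F j t).
  by apply/funext => t; rewrite big_cons.
case: (boolP (Q j)) => // Qj; by apply: bounded_rvD => //; exact: h.
Qed.

Lemma bounded_rv_prod (J : Type) (r : seq J) (Q : pred J) (F : J -> T -> R) :
  (forall j, Q j -> bounded_rv (F j)) -> bounded_rv (fun t => \prod_(j <- r | Q j) F j t).
Proof.
move=> h; elim: r => [|j r IH].
  have -> : (fun t => \prod_(j <- [::] | Q j) F j t) = (fun=> 1).
    by apply/funext => t; rewrite big_nil.
  exact: bounded_rv_cst.
have -> : (fun t => \prod_(j <- j :: r | Q j) F j t) =
    (fun t => if Q j then F j t * \prod_(j <- r | Q j) F j t else \prod_(j <- r | Q j) F j t).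
  by apply/funext => t; rewrite big_cons.
case: (boolP (Q j)) => // Qj; by apply: bounded_rvM => //; exact: h.
Qed.

Lemma bounded_rv_indic (Q : T -> Prop) : measurable [set t | Q t] ->
  bounded_rv (fun t => (`[< Q t >])%:R).
Proof.
move=> mQ; have -> : (fun t => (`[< Q t >])%:R) = \1_[set t | Q t] :> (T -> R).
  by apply/funext => t; rewrite indicE.
split; first exact: measurable_indic.
by exists 1 => t; rewrite indicE; case: (_ \in _); rewrite ?normr1// normr0.
Qed.

Lemma Ex_indic (Q : T -> Prop) : measurable [set t | Q t] ->
  Ex (fun t => (`[< Q t >])%:R) = Pr [set t | Q t].
Proof.
move=> mQ; have -> : (fun t => (`[< Q t >])%:R) = \1_[set t | Q t] :> (T -> R).
  by apply/funext => t; rewrite indicE.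
by rewrite /Ex /Rintegral integral_indic// setIT.
Qed.

Lemma Ex_cst c : Ex (fun=> c) = c.
Proof. by rewrite /Ex /Rintegral integral_cst// [X in (_ * X)%E](@probability_setT _ _ _ P) mule1. Qed.

Lemma ExD f f' : bounded_rv f -> bounded_rv f' -> Ex (fun t => f t + f' t) = Ex f + Ex f'.
Proof. by move=> bf bf'; rewrite /Ex RintegralD//; exact: bounded_rv_integrable. Qed.

Lemma ExZ c f : bounded_rv f -> Ex (fun t => c * f t) = c * Ex f.
Proof. by move=> bf; rewrite /Ex RintegralZl//; exact: bounded_rv_integrable. Qed.

Lemma ExB f f' : bounded_rv f -> bounded_rv f' -> Ex (fun t => f t - f' t) = Ex f - Ex f'.
Proof. by move=> bf bf'; rewrite /Ex RintegralB//; exact: bounded_rv_integrable. Qed.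

Lemma Ex_sum (J : Type) (r : seq J) (Q : pred J) (F : J -> T -> R) :
  (forall j, Q j -> bounded_rv (F j)) ->
  Ex (fun t => \sum_(j <- r | Q j) F j t) = \sum_(j <- r | Q j) Ex (F j).
Proof.
move=> h; elim: r => [|j r IH].
  have -> : (fun t => \sum_(j <- [::] | Q j) F j t) = (fun=> 0).
    by apply/funext => t; rewrite big_nil.
  by rewrite big_nil Ex_cst.
have -> : (fun t => \sum_(j <- j :: r | Q j) F j t) =
    (fun t => if Q j then F j t + \sum_(j <- r | Q j) F j t else \sum_(j <- r | Q j) F j t).
  by apply/funext => t; rewrite big_cons.
rewrite big_cons; case: (boolP (Q j)) => // Qj; by rewrite ExD ?IH//; [exact: h|exact: bounded_rv_sum].
Qed.

Lemma Ex_le f f' : bounded_rv f -> bounded_rv f' -> (forall t, f t <= f' t) -> Ex f <= Ex f'.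
Proof. by move=> bf bf' h; apply: le_Rintegral => //; exact: bounded_rv_integrable. Qed.

Lemma bounded_convergence (F : nat -> T -> R) f (M : R) (N : set T) :
  P.-negligible N ->
  (forall m, measurable_fun setT (F m)) -> measurable_fun setT f ->
  (forall m t, `|F m t| <= M) ->
  (forall t, ~ N t -> F m t @[m --> \oo] --> f t) ->
  Ex (F m) @[m --> \oo] --> Ex f.
Proof.
move=> negN mF mf FM cvgF.
have bF m : bounded_rv (F m) by split=> //; exists M.
have [] := @dominated_convergence _ _ _ P setT measurableT (fun m => EFin \o F m)
  (EFin \o f) (cst M%:E).
- by move=> m; exact/measurable_EFinP.
- exact/measurable_EFinP.
- apply: negligibleS negN => t /= h; apply: contrapT => nN; apply: h => _.
  by apply/fine_cvgP; split; [exact: nearW|exact: cvgF].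
- exact: (bounded_rv_integrable (bounded_rv_cst M)).
- by apply: aeW => t m _ /=; rewrite lee_fin.
move=> intf _; have -> : (\int[P]_x (EFin \o f) x = (Ex f)%:E)%E.
  by rewrite fineK//; exact: integrable_fin_num intf.
by move=> /fine_cvgP[].
Qed.

Lemma fun_fibersE (U : finType) (g : T -> U) (F : U -> R) :
  (fun t => F (g t)) = (fun t => \sum_y F y * (`[< g t = y >])%:R).
Proof.
apply/funext => t; rewrite (bigD1 (g t))//= asboolT// mulr1 big1 ?addr0// => y ny.
by rewrite asboolF ?mulr0// => gy; rewrite gy eqxx in ny.
Qed.

Lemma Ex_indic_fibers (U : finType) (g : T -> U) (F : U -> R) : fibers_in measurable g ->
  Ex (fun t => F (g t)) = \sum_y F y * Pr [set t | g t = y].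
Proof.
move=> mg; rewrite fun_fibersE Ex_sum => [|y _]; last by apply: bounded_rvZ; exact: bounded_rv_indic.
by apply: eq_bigr => y _; rewrite ExZ ?Ex_indic//; exact: bounded_rv_indic.
Qed.

Lemma bounded_rv_fibers (U : finType) (g : T -> U) (F : U -> R) : fibers_in measurable g ->
  bounded_rv (fun t => F (g t)).
Proof.
move=> mg; rewrite fun_fibersE.
by apply: bounded_rv_sum => y _; apply: bounded_rvZ; exact: bounded_rv_indic.
Qed.

Lemma Pr_sum_fibers (U : finType) (g : T -> U) (Q : pred U) :
  fibers_in measurable g -> Pr [set t | Q (g t)] = \sum_(y | Q y) Pr [set t | g t = y].
Proof.
move=> mg; rewrite -Ex_indic; last first.
  exact: (fibers_in_pred measurable_sigma_algebra (fun y => Q y) mg).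
rewrite (Ex_indic_fibers (fun y => (`[< Q y >])%:R))// [RHS]big_mkcond.
by apply: eq_bigr => y _; rewrite asboolb; case: (Q y); rewrite ?mul1r ?mul0r.
Qed.

End probabilities.

(** * Products of independent integer-valued variables *)

Section discrete_independence.
Context d (T : measurableType d) (R : realType) (P : probability T R).

Lemma fibers_in_nat_comp (U : Type) (n : T -> nat) (phi : nat -> U) (Q : U -> Prop) :
  fibers_in measurable n -> measurable [set t | Q (phi (n t))].
Proof.
move=> mn; have -> : [set t | Q (phi (n t))] = [set t | exists a, n t = a /\ Q (phi a)].
  by apply/seteqP; split => t /=; [move=> h; exists (n t)|move=> [a [->]]].
apply: (sigma_algebra_exists (@measurable_sigma_algebra _ T)) => a.
apply: (sigma_algebra_and (@measurable_sigma_algebra _ T)); first exact: mn.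
exact: (sigma_algebra_cst (@measurable_sigma_algebra _ T)).
Qed.

Lemma bounded_rv_nat (n : T -> nat) (c : nat -> R) : fibers_in measurable n ->
  (forall a, 0 <= c a <= 1) -> bounded_rv (fun t => c (n t)).
Proof.
move=> mn c01; split; last first.
  by exists 1 => t; have /andP[? ?] := c01 (n t); rewrite ger0_norm.
by move=> _ B mB; rewrite setTI; exact: (fibers_in_nat_comp c B mn).
Qed.

Lemma truncE (n : T -> nat) (c : nat -> R) K t :
  \sum_(a < K) c a * (`[< n t = a >])%:R = (if (n t < K)%N then c (n t) else 0).
Proof.
rewrite -(big_mkord xpredT (fun a => c a * (`[< n t = a >])%:R)).
case: ltnP => [nK|Kn]; last first.
  rewrite big_nat big1// => a /andP[_ aK]; rewrite asboolF ?mulr0// => na.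
  by move: aK; rewrite -na ltnNge Kn.
rewrite (bigD1_seq (n t)) ?mem_index_iota ?iota_uniq//= asboolT// mulr1.
by rewrite big1 ?addr0// => a an; rewrite asboolF ?mulr0// => na; rewrite na eqxx in an.
Qed.

(** Restricting to [n t < K] turns the expectation into a finite sum over atoms. The weight [W]
    carries the remaining factors of a product. *)
Lemma cvg_Ex_trunc (n : T -> nat) (W : T -> R) (c : nat -> R) : fibers_in measurable n ->
  bounded_rv W -> (forall a, 0 <= c a <= 1) ->
  \sum_(a < K) c a * Ex P (fun t => (`[< n t = a >])%:R * W t) @[K --> \oo]
    --> Ex P (fun t => c (n t) * W t).
Proof.
move=> mn bW c01.
have bI a : bounded_rv (fun t => (`[< n t = a >])%:R * W t).
  by apply: bounded_rvM => //; apply: bounded_rv_indic; exact: mn.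
have E K : \sum_(a < K) c a * Ex P (fun t => (`[< n t = a >])%:R * W t) =
    Ex P (fun t => (if (n t < K)%N then c (n t) else 0) * W t).
  under eq_bigr do rewrite -ExZ//.
  rewrite -Ex_sum => [|a _]; last exact: bounded_rvZ.
  congr Ex; apply/funext => t; rewrite -truncE mulr_suml.
  by apply: eq_bigr => a _; rewrite mulrA.
under eq_fun do rewrite E.
have [mW [M WM]] := bW.
have M0 : 0 <= M by exact: le_trans (normr_ge0 _) (WM point).
apply: (@bounded_convergence _ _ _ _ _ _ M set0) => //.
- exact: negligible_set0.
- move=> K; have [] // : bounded_rv (fun t => (if (n t < K)%N then c (n t) else 0) * W t).
  apply: bounded_rvM => //; apply: (bounded_rv_nat (c := fun a => if (a < K)%N then c a else 0)) => // a.
  by case: ifP; rewrite ?lexx ?ler01.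
- by have [] // : bounded_rv (fun t => c (n t) * W t); apply: bounded_rvM => //; exact: bounded_rv_nat.
- move=> K t; rewrite normrM -[M]mul1r ler_pM//.
  by case: ifP; rewrite ?normr0 ?ler01//; have /andP[? ?] := c01 (n t); rewrite ger0_norm.
- move=> t _; apply: cvg_near_cst; near=> K; case: ifP => //.
  by move/negP; case; near: K; exact: nbhs_infty_gt.
Unshelve. all: by end_near. Qed.

(** A factorization known on the atoms [n = a] passes to [c (n t)] through the truncated sums. *)
Lemma Ex_mul_indep (n : T -> nat) (W : T -> R) (c : nat -> R) (K : R) : fibers_in measurable n ->
  bounded_rv W -> (forall a, 0 <= c a <= 1) ->
  (forall a, Ex P (fun t => (`[< n t = a >])%:R * W t) = Pr P [set t | n t = a] * K) ->
  Ex P (fun t => c (n t) * W t) = Ex P (fun t => c (n t)) * K.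
Proof.
move=> mn bW c01 hK.
have h1 := cvg_Ex_trunc mn bW c01.
have h2 := cvg_Ex_trunc mn (@bounded_rv_cst _ T R 1) c01.
have {}h2 : \sum_(a < N) c a * Ex P (fun t => (`[< n t = a >])%:R * W t) @[N --> \oo]
    --> Ex P (fun t => c (n t) * 1) * K.
  have h3 : (\sum_(a < N) c a * Ex P (fun t => (`[< n t = a >])%:R * 1)) * K @[N --> \oo]
      --> Ex P (fun t => c (n t) * 1) * K by apply: cvgM => //; exact: cvg_cst.
  apply: cvg_trans h3; apply: near_eq_cvg.
  apply: nearW => N; rewrite mulr_suml; apply: eq_bigr => a _.
  rewrite hK; have -> : (fun t => (`[< n t = a >])%:R * 1) = (fun t => (`[< n t = a >])%:R) :> (T -> R).
    by apply/funext => t; rewrite mulr1.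
  by rewrite Ex_indic ?mulrA//; exact: mn.
have := cvg_unique _ h1 h2; under [in X in _ = X * _]eq_fun do rewrite mulr1.
exact.
Qed.

(** The event [A] makes the induction on [J] work: it absorbs the atom [n j = a] of the variable
    just split off. In the application to the rounded process it fixes the rounded values of the
    [zeta i]. *)
Lemma Ex_prod_indep (I : eqType) (n : I -> T -> nat) (c : I -> nat -> R) (A : set T) (J : seq I) :
  (forall j, fibers_in measurable (n j)) -> (forall j a, 0 <= c j a <= 1) ->
  measurable A -> uniq J ->
  (forall (r : seq I) (a : I -> nat), uniq r -> {subset r <= J} ->
    Pr P (A `&` [set t | forall j, j \in r -> n j t = a j]) =
    Pr P A * \prod_(j <- r) Pr P [set t | n j t = a j]) ->
  Ex P (fun t => (`[< A t >])%:R * \prod_(j <- J) c j (n j t)) =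
  Pr P A * \prod_(j <- J) Ex P (fun t => c j (n j t)).
Proof.
move=> mn c01; elim: J A => [|j J IH] A mA.
  move=> _ _; rewrite big_nil mulr1 -[RHS]Ex_indic//; congr Ex.
  by apply/funext => t; rewrite big_nil mulr1.
move=> /= /andP[jJ uJ] ind; rewrite big_cons mulrCA.
have bW : bounded_rv (fun t => (`[< A t >])%:R * \prod_(j <- J) c j (n j t)).
  apply: bounded_rvM; first exact: bounded_rv_indic.
  by apply: bounded_rv_prod => i _; exact: bounded_rv_nat.
rewrite -(@Ex_mul_indep (n j) (fun t => (`[< A t >])%:R * \prod_(j <- J) c j (n j t)))//.
  by congr Ex; apply/funext => t; rewrite big_cons mulrCA.
move=> a; rewrite mulrA.
have mAa : measurable (A `&` [set t | n j t = a]) by apply: measurableI => //; exact: mn.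
have Aa : Pr P (A `&` [set t | n j t = a]) = Pr P [set t | n j t = a] * Pr P A.
  have := ind [:: j] (fun=> a) isT; rewrite big_seq1 [RHS]mulrC => <-; last first.
    by move=> i; rewrite !inE => ->.
  congr Pr; congr (_ `&` _); apply/seteqP; split => t /=; last by apply; rewrite inE.
  by move=> h i; rewrite inE => /eqP ->.
rewrite -Aa -IH//.
  congr Ex; apply/funext => t; rewrite mulrA; congr (_ * _).
  by rewrite -natrM mulnb; congr (_%:R); congr nat_of_bool; rewrite -asbool_and andC.
move=> r b ur rJ.
have jr : j \notin r by apply: contra jJ; exact: rJ.
(* Independence given [A] and [n j = a] is the independence hypothesis for [A] on the longer list
   [j :: r], with the value [a] prescribed at [j]. *)
have := ind (j :: r) (fun i => if i == j then a else b i).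
rewrite /= jr ur big_cons eqxx => /(_ isT) h.
have E : \prod_(i <- r) Pr P [set t | n i t = (if i == j then a else b i)] =
    \prod_(i <- r) Pr P [set t | n i t = b i].
  by apply: eq_big_seq => i ir; case: eqP => // ij; rewrite -ij ir in jr.
rewrite Aa -mulrA mulrCA -E -h; last by move=> i; rewrite !inE => /predU1P[->|/rJ ->]; rewrite ?eqxx ?orbT.
congr Pr; rewrite -setIA; congr (_ `&` _); apply/seteqP; split => t /=.
  move=> [na h1] i; rewrite inE; case: eqP => [-> _//|_ /= ir]; exact: h1.
move=> h1; split; first by have := h1 j; rewrite inE eqxx => ->.
move=> i ir; have := h1 i; rewrite inE ir orbT => /(_ isT) ->.
by case: eqP => // ij; rewrite -ij ir in jr.
Qed.

(** The truncated sums are partial sums of the exponential series at [r * lam], times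
    [expR (- lam)]. *)
Lemma Ex_pow_poisson (n : T -> nat) (lam r : R) : fibers_in measurable n -> 0 <= r <= 1 ->
  (forall a, Pr P [set t | n t = a] = lam ^+ a / a`!%:R * expR (- lam)) ->
  Ex P (fun t => r ^+ n t) = expR (- ((1 - r) * lam)).
Proof.
move=> mn r01 hn.
have c01 a : 0 <= r ^+ a <= 1.
  by have /andP[? ?] := r01; rewrite exprn_ge0//= exprn_ile1.
have h := cvg_Ex_trunc mn (@bounded_rv_cst _ T R 1) c01.
have -> : Ex P (fun t => r ^+ n t) = Ex P (fun t => r ^+ n t * 1).
  by congr Ex; apply/funext => t; rewrite mulr1.
have {}h : series (exp_coeff (r * lam)) N * expR (- lam) @[N --> \oo]
    --> Ex P (fun t => r ^+ n t * 1).
  apply: cvg_trans h; apply: near_eq_cvg; apply: nearW => N.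
  rewrite /series/= big_mkord mulr_suml; apply: eq_bigr => a _.
  have -> : (fun t => (`[< n t = a >])%:R * 1) = (fun t => (`[< n t = a >])%:R) :> (T -> R).
    by apply/funext => t; rewrite mulr1.
  by rewrite Ex_indic ?hn; [rewrite /exp_coeff/= exprMn !mulrA|exact: mn].
have h2 : series (exp_coeff (r * lam)) N * expR (- lam) @[N --> \oo] --> expR (r * lam) * expR (- lam).
  by apply: cvgM; [exact: is_cvg_series_exp_coeff|exact: cvg_cst].
by rewrite (cvg_unique _ h h2)// -expRD; congr expR; ring.
Qed.

End discrete_independence.

(** * Poisson processes *)

Section intensity.
Variable R : realType.

Lemma is_derive_opp_inv (x : R) : x != 0 -> is_derive x 1 (fun y : R => - y^-1) (x ^+ 2)^-1.
Proof.
move=> x0; apply: is_derive_eq.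
  by apply: is_deriveN; apply: is_deriveV => //; exact: is_derive_id.
by rewrite /= scaleNr opprK /GRing.scale/= mulr1.
Qed.

Lemma measurable_inverse_square (D : set R) : measurable D -> D `<=` `]0, +oo[ ->
  measurable_fun D (fun z : R => ((z ^+ 2)^-1)%:E).
Proof.
move=> mD D0; apply/measurable_EFinP; apply: subspace_continuous_measurable_fun => //.
apply: continuous_in_subspaceT => x /set_mem/D0/=; rewrite in_itv/= andbT => x0.
by apply: cvgV; [rewrite sqrf_eq0 gt_eqF|exact: exprn_continuous].
Qed.

Lemma intensity_itvy (a : R) : 0 < a ->
  inverse_square_intensity `]a, +oo[ = (a^-1)%:E.
Proof.
move=> a0; rewrite /inverse_square_intensity integral_itv_obnd_cbnd; last first.
  apply: measurable_inverse_square => // x; rewrite /= !in_itv/= !andbT.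
  exact: lt_trans.
have pos x : a <= x -> x != 0 by move=> ax; rewrite gt_eqF// (lt_le_trans a0).
have cF (x : R) : a <= x -> {for x, continuous (fun y : R => - y^-1)}.
  by move=> ax; apply: cvgN; apply: cvgV; [exact: pos|exact: cvg_id].
rewrite (@ge0_continuous_FTC2y _ _ (fun x => - x^-1) _ 0)//.
- by rewrite EFinN oppeK add0e.
- by move=> x ax; rewrite invr_ge0 sqr_ge0.
- have cf (x : R) : a <= x -> {for x, continuous (fun y : R => (y ^+ 2)^-1)}.
    move=> ax; apply: cvgV; first by rewrite sqrf_eq0 pos.
    exact: exprn_continuous.
  apply/continuous_within_itvcyP; split.
    by move=> x; rewrite in_itv/= andbT => ax; apply: cf; exact: ltW.
  by apply: cvg_at_right_filter; exact: cf.
- rewrite -oppr0; apply: cvgN; apply/gtr0_cvgV0; last exact: cvg_id.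
  by exists 0; split.
- by move=> x ax; have [|h _] := is_derive_opp_inv (x := x); first exact: pos (ltW ax).
- by apply: cvg_at_right_filter; exact: cF.
- move=> x; rewrite in_itv/= andbT => ax; rewrite derive1E.
  by have [|_ ->] := is_derive_opp_inv (x := x); first exact: pos (ltW ax).
Qed.

(** Difference of two half-lines of finite mass. *)
Lemma intensity_itv (a b : R) : 0 < a -> a < b ->
  inverse_square_intensity `]a, b] = (a^-1 - b^-1)%:E.
Proof.
move=> a0 ab; have b0 := lt_trans a0 ab.
have := intensity_itvy a0.
have -> : `]a, +oo[%classic = `]a, b] `|` `]b, +oo[ :> set R.
  apply/seteqP; split => x /=; rewrite !in_itv/= ?andbT.
    by move=> ->; case: (leP x b) => _; [left|right].
  by move=> [/andP[]//|]; exact: lt_trans.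
rewrite {1}/inverse_square_intensity ge0_integral_setU//; first last.
- apply/disj_setPS => x /= []; rewrite !in_itv/= andbT => /andP[_ xb].
  by rewrite ltNge xb.
- by move=> x _; rewrite lee_fin invr_ge0 sqr_ge0.
- apply: measurable_inverse_square; first exact: measurableU.
  move=> x /= []; rewrite !in_itv/= ?andbT; last exact: lt_trans.
  by move=> /andP[+ _]; exact: lt_trans.
rewrite -/(inverse_square_intensity _) -/(inverse_square_intensity `]b, +oo[) intensity_itvy//.
case: (inverse_square_intensity _) => [r| |]//.
by rewrite -EFinD => -[<-]; rewrite addrK.
Qed.

End intensity.

Lemma independent_classesP (R : realType) d (T : measurableType d) (P : probability T R)
    (J : eqType) (F : J -> set (set T)) (r : seq J) (A : J -> set T) :
  independent_classes P F -> uniq r -> (forall j, j \in r -> F j (A j)) ->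
  (forall j, measurable (A j)) ->
  Pr P [set t | forall j, j \in r -> A j t] = \prod_(j <- r) Pr P (A j).
Proof.
move=> ind ur FA mA; have := ind r A ur FA.
rewrite (_ : \bigcap_(j in [set` r]) A j = [set t | forall j, j \in r -> A j t])//.
rewrite /Pr => ->; elim: r {ur FA} => [|j r IH]; first by rewrite !big_nil.
by rewrite !big_cons fineM ?IH// ?fin_num_measure// (eq_bigr _ (fun j _ => PrE P (mA j))) prodEFin.
Qed.

Section counts.
Variable R : realType.

(* [0] codes an infinite count, [n.+1] the count [n]. *)
Definition count_code (x : \bar R) : nat :=
  if pselect (exists n, x = n%:R%:E) is left h then (projT1 (cid h)).+1 else 0%N.

Lemma count_codeS (x : \bar R) n : count_code x = n.+1 <-> x = n%:R%:E.
Proof.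
rewrite /count_code; case: pselect => [h|h].
  case: cid => m /= ->; split => [[->]//|[/eqP]].
  by rewrite eqr_nat => /eqP ->.
by split=> // xn; case: h; exists n.
Qed.

Lemma measurable_count_code a : measurable [set x | count_code x = a].
Proof.
have mS n : measurable [set x | count_code x = n.+1].
  rewrite (_ : [set x | count_code x = n.+1] = [set n%:R%:E]); first exact: emeasurable_set1.
  by apply/seteqP; split => x /= /count_codeS.
case: a => // .
have -> : [set x | count_code x = 0%N] = ~` \bigcup_n [set x | count_code x = n.+1].
  apply/seteqP; split => x /=; first by move=> h [n _ /=]; rewrite h.
  move=> h; case E : (count_code x) => [//|n]; case: h; by exists n.
by apply: measurableC; exact: bigcup_measurable.
Qed.

Context d (T : measurableType d) (P : probability T R).

Lemma measurable_point_count (zeta : nat -> T -> R) (B : set R) :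
  (forall i, measurable_fun setT (zeta i)) -> measurable B ->
  measurable_fun setT (point_count zeta B).
Proof.
move=> mz mB; apply: (ge0_emeasurable_sum (P := xpredT)) => // i _.
apply: (measurableT_comp (f := fun x : R => (\d_x B : \bar R))) => //.
exact: measurable_fun_dirac.
Qed.

(** The Poisson masses of the finite counts already add up to 1, so an infinite count has
    probability 0. The codes 0 and 1 both decode to 0 under [.-1], which is harmless because the
    code 0 is null. *)
Lemma count_code_poisson (N : T -> \bar R) (lam : R) :
  measurable_fun setT N ->
  (forall n : nat, P [set t | N t = n%:R%:E] = (lam ^+ n / n`!%:R * expR (- lam))%:E) ->
  [/\ fibers_in measurable (fun t => count_code (N t)),
      Pr P [set t | count_code (N t) = 0%N] = 0
    & forall r, 0 <= r <= 1 ->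
        Ex P (fun t => r ^+ (count_code (N t)).-1) = expR (- ((1 - r) * lam))].
Proof.
move=> mN hN.
have mf : fibers_in measurable (fun t => count_code (N t)).
  by move=> a; rewrite -[X in measurable X]setTI; exact: mN measurableT _ (measurable_count_code a).
have hS n : Pr P [set t | count_code (N t) = n.+1] = lam ^+ n / n`!%:R * expR (- lam).
  rewrite /Pr (_ : [set t | count_code (N t) = n.+1] = [set t | N t = n%:R%:E]) ?hN//.
  by apply/seteqP; split => t /= /count_codeS.
have h0 : Pr P [set t | count_code (N t) = 0%N] = 0.
  have c01 (a : nat) : 0 <= (1 : R) <= 1 by rewrite ler01 lexx.
  have h := cvg_Ex_trunc (P := P) mf (@bounded_rv_cst _ T R 1) c01.
  pose u K := \sum_(a < K) Pr P [set t | count_code (N t) = a].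
  have {}h : u K @[K --> \oo] --> (1 : R).
    rewrite mulr1 Ex_cst in h; apply: cvg_trans h; apply: near_eq_cvg; apply: nearW => K.
    apply: eq_bigr => a _; rewrite mul1r -Ex_indic; last exact: mf.
    by congr Ex; apply/funext => t; rewrite mulr1.
  have {}h : u K.+1 @[K --> \oo] --> (1 : R) by rewrite cvg_shiftS.
  have h2 : Pr P [set t | count_code (N t) = 0%N] + series (exp_coeff lam) K * expR (- lam) @[K --> \oo]
      --> Pr P [set t | count_code (N t) = 0%N] + expR lam * expR (- lam).
    apply: cvgD; first exact: cvg_cst.
    by apply: cvgM; [exact: is_cvg_series_exp_coeff|exact: cvg_cst].
  have {}h : Pr P [set t | count_code (N t) = 0%N] + series (exp_coeff lam) K * expR (- lam) @[K --> \oo] --> (1 : R).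
    apply: cvg_trans h; apply: near_eq_cvg; apply: nearW => K.
    rewrite /u big_ord_recl; congr (_ + _).
    rewrite /series/= big_mkord mulr_suml; apply: eq_bigr => a _.
    by rewrite hS.
  have : 1 = Pr P [set t | count_code (N t) = 0%N] + expR lam * expR (- lam).
    by apply: cvg_unique h h2.
  by rewrite -expRD subrr expR0 => /(congr1 (fun x => x - 1)); rewrite addrK subrr => <-.
split=> // r r01; apply: Ex_pow_poisson => //.
  by move=> a; exact: (fibers_in_nat_comp (T := T) predn (eq^~ a) mf).
case=> [|a]; last first.
  rewrite -hS; congr Pr; apply/seteqP; split => t /=; last by move=> ->.
  by case: (count_code _) => // n /= ->.
rewrite -hS; apply/eqP; rewrite eq_le; apply/andP; split.
  rewrite -[X in _ <= X]add0r -h0; apply: le_trans (Pr_setU P (mf _) (mf _)).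
  apply: Pr_le; [exact: (fibers_in_nat_comp (T := T) predn (eq^~ 0%N) mf)|exact: measurableU|].
  by move=> t /=; case: (count_code _) => [|[|]] //=; [left|right].
apply: Pr_le; [exact: mf|exact: (fibers_in_nat_comp (T := T) predn (eq^~ 0%N) mf)|].
by move=> t /= ->.
Qed.

End counts.

(** * Discretized spectral functions *)

(** Partial counts are integers that converge to an integer, hence they are eventually equal to
    it. *)
Lemma point_count_near (R : realType) (T : Type) (zeta : nat -> T -> R) (B : set R) t n :
  point_count zeta B t = n%:R%:E ->
  \forall N \near \oo, (\sum_(i < N) `[< B (zeta i t) >])%N = n.
Proof.
move=> h; pose S N := (\sum_(0 <= i < N) \d_(zeta i t) B : \bar R)%E.
have SE N : S N = ((\sum_(i < N) `[< B (zeta i t) >])%N)%:R%:E.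
  rewrite /S big_mkord natr_sum -sumEFin; apply: eq_bigr => i _.
  by rewrite diracE.
have /fine_cvgP[_ hS] : S N @[N --> \oo] --> (n%:R%:E : \bar R).
  by rewrite -h; apply: is_cvg_nneseries => i _ _; rewrite diracE lee_fin ler0n.
near=> N.
have : `|n%:R - fine (S N)| < 1.
  by near: N; have := @cvgr_dist_lt _ _ _ _ _ _ _ hS 1 ltr01; exact.
rewrite SE /=; set m := (\sum_(i < N) _)%N.
case: (ltngtP m n) => // mn.
  by rewrite ger0_norm ?subr_ge0 ?ler_nat 1?ltnW// -natrB 1?ltnW// (ltr_nat R _ 1) ltnS leqn0 subn_eq0 leqNgt mn.
by rewrite distrC ger0_norm ?subr_ge0 ?ler_nat 1?ltnW// -natrB 1?ltnW// (ltr_nat R _ 1) ltnS leqn0 subn_eq0 leqNgt mn.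
Unshelve. all: by end_near. Qed.

Section discretization.
Variables (R : realType) (s : R) (L : nat).
Hypothesis s0 : 0 < s.

(* [mesh_point (mesh_index z) < z]: rounding down strictly keeps the left-continuous
   function [level] eventually unchanged as the mesh is refined. *)
Definition mesh_point (l : nat) : R := l%:R * s.
Definition mesh_index (z : R) : nat := level L (fun l => mesh_point l.+1) z.
Definition bin (l : nat) : set R := [set z | 0 < z /\ mesh_index z = l].
(** The intensity of [bin l] for [0 < l <= L]. The last bin is a half-line, so nothing is subtracted
    there; bin 0 reaches down to 0 and has infinite intensity, so only bins [j.+1] are ever
    counted. *)
Definition bin_mass (l : nat) : R :=
  (mesh_point l)^-1 - (if l == L then 0 else (mesh_point l.+1)^-1).

Lemma mesh_point_lt l l' : (l < l')%N -> mesh_point l < mesh_point l'.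
Proof. by move=> ll'; rewrite /mesh_point ltr_pM2r// ltr_nat. Qed.

Lemma mesh_point_le l l' : (l <= l')%N -> mesh_point l <= mesh_point l'.
Proof. by move=> ll'; rewrite /mesh_point ler_pM2r// ler_nat. Qed.

Lemma mesh_mono : forall l l', (l <= l' < L)%N -> mesh_point l.+1 <= mesh_point l'.+1.
Proof. by move=> l l' /andP[ll' _]; exact: mesh_point_le. Qed.

Lemma mesh_index_le z : (mesh_index z <= L)%N.
Proof. exact: level_le. Qed.

Lemma mesh_index_gtn l z : (l < L)%N -> (l < mesh_index z)%N = (mesh_point l.+1 < z).
Proof. by move=> lL; rewrite /mesh_index (level_gtn mesh_mono). Qed.

Lemma binE l : (0 < l <= L)%N -> bin l = if l == L then `]mesh_point l, +oo[%classic
  else `]mesh_point l, mesh_point l.+1]%classic.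
Proof.
case: l => // l /= lL.
have pl : 0 < mesh_point l.+1 by rewrite mulr_gt0.
have E z : mesh_index z = l.+1 <-> (mesh_point l.+1 < z) /\ ~~ (l.+1 < mesh_index z)%N.
  rewrite -mesh_index_gtn// -leqNgt; split=> [->//|[h1 h2]].
  by apply/eqP; rewrite eqn_leq h1 h2.
case: eqVneq => [lL'|lnL].
  apply/seteqP; split => z /=; rewrite in_itv/= andbT; first by move=> [_ /E[]].
  move=> lz; split; first exact: lt_trans lz.
  by apply/E; split => //; rewrite -leqNgt lL' mesh_index_le.
have l1L : (l.+1 < L)%N by rewrite ltn_neqAle lnL.
apply/seteqP; split => z /=; rewrite in_itv/=.
  by move=> [_ /E[-> ]]; rewrite mesh_index_gtn// -leNgt.
move=> /andP[lz zl]; split; first exact: lt_trans lz.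
by apply/E; rewrite mesh_index_gtn// -leNgt.
Qed.

Lemma measurable_bin l : (0 < l <= L)%N -> measurable (bin l).
Proof. by move=> /binE ->; case: ifP. Qed.

Lemma intensity_bin l : (0 < l <= L)%N -> inverse_square_intensity (bin l) = (bin_mass l)%:E.
Proof.
move=> lL; have pl : 0 < mesh_point l by case/andP: lL => l0 _; rewrite mulr_gt0// ltr0n.
rewrite binE// /bin_mass; case: ifP => _; first by rewrite intensity_itvy ?subr0.
by rewrite intensity_itv// mesh_point_lt.
Qed.

Lemma bin_mass_ge0 l : (0 < l)%N -> 0 <= bin_mass l.
Proof.
move=> l0; have pl : 0 < mesh_point l by rewrite mulr_gt0// ltr0n.
rewrite /bin_mass; case: ifP => _; first by rewrite subr0 invr_ge0 ltW.
by rewrite subr_ge0 lef_pV2 ?posrE ?mesh_point_le// (lt_trans pl)// mesh_point_lt.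
Qed.

(** Writing the factor of a point as a product over bins allows the product over points to be
    exchanged for a product over bins of powers of counts. Points of bin 0 drop out because
    [r 0 = 1]. *)
Lemma prod_mesh_index (r : nat -> R) z : r 0%N = 1 -> 0 < z ->
  r (mesh_index z) = \prod_(j < L) r j.+1 ^+ `[< bin j.+1 z >].
Proof.
move=> r0 z0; case E : (mesh_index z) => [|l].
  by rewrite r0 big1// => j _; rewrite asboolF// => -[_]; rewrite E.
have lL : (l < L)%N by rewrite -E mesh_index_le.
rewrite (bigD1 (Ordinal lL))//= asboolT// expr1 big1 ?mulr1// => j jl.
rewrite asboolF// => -[_]; rewrite E => -[lj].
by move/negP: jl; apply; apply/eqP/val_inj.
Qed.

Context d (T : measurableType d) (P : probability T R) (zeta : nat -> {RV P >-> R}).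
Hypothesis hz : poisson_process P `]0, +oo[ (@inverse_square_intensity R) zeta.

Lemma zeta_gt0 i t : 0 < zeta i t.
Proof. by case: hz => /(_ i t)/= h _ _ _; move: h; rewrite in_itv/= andbT. Qed.

Lemma fibers_mesh_index i (F : set (set T)) : sigma_algebra setT F ->
  (forall B : set R, measurable B -> F (zeta i @^-1` B)) ->
  fibers_in F (fun t => mesh_index (zeta i t)).
Proof.
by move=> sF h; exact: (fibers_level mesh_mono).
Qed.

Let N (j : 'I_L) t := count_code (point_count zeta (bin j.+1) t).

(** After exchanging products, almost every realization is eventually the product of [r j.+1] raised
    to the count of [bin j.+1]. Disjoint bins have independent Poisson counts, so the expectation of
    this product is a product of Poisson generating functions. *)
Lemma cvg_thinned (r : nat -> R) : r 0%N = 1 -> (forall l, 0 <= r l <= 1) ->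
  Ex P (fun t => \prod_(i < n) r (mesh_index (zeta i t))) @[n --> \oo] -->
  expR (- \sum_(j < L) (1 - r j.+1) * bin_mass j.+1).
Proof.
move=> r0 r01.
have bL (j : 'I_L) : (0 < j.+1 <= L)%N by exact: ltn_ord.
have mB (j : 'I_L) : measurable (bin j.+1) by exact: measurable_bin.
have sB (j : 'I_L) : bin j.+1 `<=` `]0, +oo[ by move=> z [z0 _] /=; rewrite in_itv/= andbT.
have mpc (j : 'I_L) : measurable_fun setT (point_count zeta (bin j.+1)).
  by apply: measurable_point_count => // i; exact: measurable_funPT.
have [_ hpois _ hind] := hz.
have hN (j : 'I_L) := count_code_poisson (mpc j).
have {}hN (j : 'I_L) : [/\ fibers_in measurable (N j),
      Pr P [set t | N j t = 0%N] = 0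
    & forall r, 0 <= r <= 1 -> Ex P (fun t => r ^+ (N j t).-1) = expR (- ((1 - r) * bin_mass j.+1))].
  apply: hN => n; rewrite hpois ?intensity_bin ?ltry//.
have -> : expR (- \sum_(j < L) (1 - r j.+1) * bin_mass j.+1) =
    Ex P (fun t => \prod_(j < L) r j.+1 ^+ (N j t).-1).
  have PT : Pr P setT = 1 by rewrite /Pr probability_setT.
  transitivity (Pr P setT * \prod_(j <- index_enum 'I_L) Ex P (fun t => r j.+1 ^+ (N j t).-1)).
    rewrite PT mul1r -sumrN expR_sum; apply: eq_bigr => j _.
    by case: (hN j) => _ _ ->.
  rewrite -(@Ex_prod_indep _ _ _ P _ N (fun j n => r j.+1 ^+ n.-1) setT (index_enum 'I_L))//.
  - by congr Ex; apply/funext => t; rewrite asboolT// mul1r.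
  - by move=> j; case: (hN j).
  - by move=> j n; have /andP[? ?] := r01 j.+1; rewrite exprn_ge0//= exprn_ile1.
  - exact: index_enum_uniq.
  - move=> q a uq _; rewrite setTI PT mul1r; apply: (independent_classesP (A := fun j => [set t | N j t = a j])
      (hind _ (fun j : 'I_L => bin j.+1) _ _)) => //.
    + move=> i j _ _ [z [[_ zi] [_ zj]]]; apply/val_inj/eqP; rewrite -eqSS; apply/eqP.
      by rewrite -zi -zj.
    + move=> j _; apply: sub_sigma_algebra; exists tt, [set x | count_code x = a j] => //.
      exact: measurable_count_code.
    + by move=> j; case: (hN j).
apply: (@bounded_convergence _ _ _ P _ _ 1 [set t | exists j : 'I_L, N j t = 0%N]) => //.
- apply/negligibleP.
    by apply: (sigma_algebra_exists_fin (@measurable_sigma_algebra _ T)) => j; case: (hN j).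
  have mE : measurable [set t | exists j : 'I_L, N j t = 0%N].
    by apply: (sigma_algebra_exists_fin (@measurable_sigma_algebra _ T)) => j; case: (hN j).
  apply: (etrans (PrE P mE)); congr EFin; apply/eqP; rewrite eq_le Pr_ge0 andbT.
  have -> : [set t | exists j : 'I_L, N j t = 0%N] =
      [set t | exists2 j, j \in index_enum 'I_L & [set t | N j t = 0%N] t].
    by apply/seteqP; split => t /= [j h]; [exists j => //; rewrite mem_index_enum|exists j].
  apply: le_trans (Pr_exists P _ _) _; first by move=> j; case: (hN j).
  by rewrite big1// => j _; case: (hN j).
- move=> n; have [] // : bounded_rv (fun t => \prod_(i < n) r (mesh_index (zeta i t))).
  apply: bounded_rv_prod => i _; apply: bounded_rv_nat => //.
  apply: (fibers_mesh_index (@measurable_sigma_algebra _ T)) => B mB'.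
  by rewrite -[X in measurable X]setTI; exact: measurable_funP.
- have [] // : bounded_rv (fun t => \prod_(j < L) r j.+1 ^+ (N j t).-1).
  apply: bounded_rv_prod => j _; apply: (bounded_rv_nat (c := fun n => r j.+1 ^+ n.-1)).
    by case: (hN j).
  by move=> n; have /andP[? ?] := r01 j.+1; rewrite exprn_ge0//= exprn_ile1.
- move=> n t; rewrite ger0_norm; last by apply: prodr_ge0 => i _; case/andP: (r01 (mesh_index (zeta i t))).
  by apply: prodr_ile1 => i _; exact: r01.
(* Off the null event each of the bins considered holds finitely many points, so the product is
   constant once they have all appeared. *)
- move=> t /= hNt; apply: cvg_near_cst.
  have : \forall n \near \oo, forall j : 'I_L, (\sum_(i < n) `[< bin j.+1 (zeta i t) >])%N = (N j t).-1.
    apply: filter_forall => j.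
    have : N j t <> 0%N by move=> h; apply: hNt; exists j.
    rewrite /N; case E : (count_code _) => [//|n] _ /=.
    by apply: (@point_count_near _ _ (fun i => zeta i)); exact/count_codeS.
  apply: filterS => n hn.
  under eq_bigr => i _ do rewrite prod_mesh_index ?zeta_gt0//.
  rewrite exchange_big; apply: eq_bigr => j _ /=.
  by rewrite -hn expr_sum.
Qed.

End discretization.

Lemma sigma_family_comp_sub (R : realType) (I I' T : Type) (X : I -> T -> R) (loc : I' -> I)
    (h : I' -> R -> R) : (forall j, measurable_fun setT (h j)) ->
  sigma_family (fun j t => h j (X (loc j) t)) `<=` sigma_family X.
Proof.
move=> mh; apply: sigma_family_min; first exact: sigma_family_sigma_algebra.
move=> j B mB; apply: (@sigma_family_preimage _ _ _ _ X (loc j) (h j @^-1` B)).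
by rewrite -[X in measurable X]setTI; exact: mh.
Qed.

(** Laws are compared on path space, so the event [A] is pulled back along the path map induced by
    [loc] and [h]; independence passes to the smaller sigma-algebras. *)
Lemma independent_copies_comp (R : realType) (I I' : Type) d (T : measurableType d)
    (P : probability T R) (Xs : nat -> I -> T -> R) d0 (T0 : measurableType d0)
    (P0 : probability T0 R) (X : I -> T0 -> R) (loc : I' -> I) (h : I' -> R -> R) :
  (forall j, measurable_fun setT (h j)) -> independent_copies P Xs P0 X ->
  independent_copies P (fun n j t => h j (Xs n (loc j) t)) P0 (fun j t => h j (X (loc j) t)).
Proof.
move=> mh [law ind]; split => [n A sA|r A ur FA].
  have := law n ((fun (p : I -> R) (j : I') => h j (p (loc j))) @^-1` A); apply.
  apply: (@sigma_family_comp_sub _ _ _ _ (fun i (p : I -> R) => p i) loc h mh).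
  exact: (sigma_family_comp (f := fun (p : I -> R) (j : I') => h j (p (loc j))) sA).
apply: ind => // j /FA; exact: sigma_family_comp_sub.
Qed.

Lemma independent_copies_law (R : realType) (I : Type) d (T : measurableType d)
    (P : probability T R) (Xs : nat -> I -> T -> R) d0 (T0 : measurableType d0)
    (P0 : probability T0 R) (X : I -> T0 -> R) n (A : set (I -> R)) :
  independent_copies P Xs P0 X -> sigma_family (fun i (p : I -> R) => p i) A ->
  Pr P [set t | A (Xs n ^~ t)] = Pr P0 [set t | A (X ^~ t)].
Proof. by move=> [law _] sA; rewrite /Pr law. Qed.

Lemma mfun_preimage (R : realType) d (T : measurableType d) (P : probability T R)
    (X : {RV P >-> R}) (B : set R) : measurable B -> measurable (X @^-1` B).
Proof. by move=> mB; rewrite -[X in measurable X]setTI; exact: measurable_funPT. Qed.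

Lemma sigma_family_measurable (R : realType) (I : Type) d (T : measurableType d)
    (P : probability T R) (X : I -> {RV P >-> R}) : sigma_family X `<=` measurable.
Proof.
apply: sigma_family_min; first exact: measurable_sigma_algebra.
by move=> i B; exact: mfun_preimage.
Qed.

Lemma measurable_mull (R : realType) (a : R) (B : set R) : measurable B ->
  measurable ((fun x => a * x) @^-1` B).
Proof.
move=> mB; rewrite -[X in measurable X]setTI.
have m : measurable_fun setT (fun x : R => a * x).
  by apply: measurable_funM; [exact: measurable_cst|exact: measurable_id].
exact: m measurableT _ mB.
Qed.

(** * Generating functions of the rounded process *)

Section thinned.
Variables (R : realType) (k M : nat) (g : nat -> R).
Hypothesis g_mono : forall l l', (l <= l' < M)%N -> g l <= g l'.
Hypothesis g_gt0 : forall l, (l < M)%N -> 0 < g l.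
Context d (T : measurableType d) (P : probability T R).
Context dY (TY : measurableType dY) (PY : probability TY R).
Variables (Y : 'I_k -> {RV PY >-> R}) (zeta : nat -> {RV P >-> R})
  (Ys : nat -> 'I_k -> {RV P >-> R}).
Hypothesis hz : poisson_process P `]0, +oo[ (@inverse_square_intensity R) zeta.
Hypothesis hYs : independent_copies P Ys PY Y.
Hypothesis Y_ge0 : forall j t, 0 <= Y j t.
Hypothesis Ys_ge0 : forall i j t, 0 <= Ys i j t.
Hypothesis EY : forall j, ('E_PY[Y j] = 1)%E.
Hypothesis hind : independent_classes P (fun b : bool =>
  if b then sigma_family zeta else sigma_family (fun q : nat * 'I_k => Ys q.1 q.2)).

Notation cells := (cellT k M).
Notation scaled a y := (cell M g (fun j : 'I_k => a * y j)).
Implicit Types (S : {set cells}).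

Lemma level_nonpos v : v <= 0 -> level M g v = 0%N.
Proof.
move=> v0; apply/eqP; rewrite -leqn0 leqNgt; apply/negP => h.
have M0 : (0 < M)%N := leq_trans h (level_le _ _ _).
by move: h; rewrite level_gtn// ltNge (le_trans v0)// ltW// g_gt0.
Qed.

Lemma cell_scaled0 (y : 'I_k -> R) : scaled 0 y = cell0 k M.
Proof. by apply/ffunP => j; apply: val_inj; rewrite /= cellE ffunE mul0r level_nonpos. Qed.

Definition cell_prob (a : R) S := Pr PY [set t | scaled a (Y ^~ t) \in S].

(** For [S] avoiding [cell0], the mean number of points of the rounded process in [S]: a point whose
    [zeta] lies in [bin j.+1] is scaled by [mesh_point s j.+1]. *)
Definition disc_mass (s : R) (L : nat) S :=
  \sum_(j < L) cell_prob (mesh_point s j.+1) S * bin_mass s L j.+1.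

Definition disc_hit (s : R) (L : nat) S i t : bool :=
  scaled (mesh_point s (mesh_index s L (zeta i t))) ((Ys i)^~ t) \in S.

Definition hit S i t : bool := scaled (zeta i t) ((Ys i)^~ t) \in S.

Lemma fibers_scaled (F : set (set TY)) a : sigma_family Y `<=` F -> sigma_algebra setT F ->
  fibers_in F (fun t => scaled a (Y ^~ t)).
Proof.
move=> YF sF; apply: (fibers_cell g_mono sF) => j B mB; apply: YF.
exact: (@sigma_family_preimage _ _ _ _ (fun j => Y j) j ((fun x => a * x) @^-1` B) (measurable_mull a mB)).
Qed.

Lemma cell_prob_copy a S i : Pr P [set t | scaled a ((Ys i)^~ t) \in S] = cell_prob a S.
Proof.
rewrite (independent_copies_law (A := [set p : 'I_k -> R | scaled a p \in S]) i hYs)//.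
have sF := @sigma_family_sigma_algebra _ R 'I_k _ (fun j (p : 'I_k -> R) => p j).
apply: (fibers_in_pred sF (fun d => d \in S)).
apply: (fibers_cell g_mono sF) => j B mB.
exact: (sigma_family_preimage (X := fun j (p : 'I_k -> R) => p j) j (measurable_mull a mB)).
Qed.

Lemma cell_prob_ge0 a S : 0 <= cell_prob a S.
Proof. exact: Pr_ge0. Qed.

Lemma measurable_scaled a S : measurable [set t | scaled a (Y ^~ t) \in S].
Proof.
apply: (fibers_in_pred (@measurable_sigma_algebra _ TY) (fun d => d \in S)).
by apply: fibers_scaled; [exact: sigma_family_measurable|exact: measurable_sigma_algebra].
Qed.

Lemma cell_prob_le1 a S : cell_prob a S <= 1.
Proof. by apply: Pr_le1; exact: measurable_scaled. Qed.

Lemma cell_prob0 S : cell0 k M \notin S -> cell_prob 0 S = 0.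
Proof.
move=> S0; rewrite /cell_prob /Pr (_ : [set t | _] = set0) ?measure0//.
by apply/seteqP; split => t //=; rewrite cell_scaled0 (negbTE S0).
Qed.

Lemma cell_prob_sum a S : cell_prob a S = \sum_(d in S) cell_prob a [set d]%SET.
Proof.
rewrite /cell_prob Pr_sum_fibers.
  by apply: eq_bigr => e _; congr Pr; apply/seteqP; split => t /=; rewrite inE => /eqP.
by apply: fibers_scaled; [exact: sigma_family_measurable|exact: measurable_sigma_algebra].
Qed.

Lemma disc_mass_sum s L S : disc_mass s L S = \sum_(d in S) disc_mass s L [set d]%SET.
Proof.
rewrite /disc_mass exchange_big; apply: eq_bigr => j _ /=.
by rewrite cell_prob_sum mulr_suml.
Qed.

Lemma disc_mass_ge0 s L S : 0 < s -> 0 <= disc_mass s L S.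
Proof.
move=> s0; apply: sumr_ge0 => j _.
by rewrite mulr_ge0 ?cell_prob_ge0// bin_mass_ge0.
Qed.

Lemma fibers_scaled_copy (F : set (set T)) a i : sigma_algebra setT F ->
  (forall j (B : set R), measurable B -> F (Ys i j @^-1` B)) ->
  fibers_in F (fun t => scaled a ((Ys i)^~ t)).
Proof.
move=> sF h; apply: (fibers_cell g_mono sF) => j B mB.
exact: (h j ((fun x => a * x) @^-1` B) (measurable_mull a mB)).
Qed.

Lemma fibers_disc (F : set (set T)) a S i : sigma_algebra setT F ->
  (forall j (B : set R), measurable B -> F (Ys i j @^-1` B)) ->
  fibers_in F (fun t => nat_of_bool (scaled a ((Ys i)^~ t) \in S)).
Proof.
move=> sF h y.
exact: (fibers_in_pred sF (fun d => nat_of_bool (d \in S) = y) (fibers_scaled_copy a sF h)).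
Qed.

(** Two independences are combined: the family of all [zeta i] against that of all [Ys i], which
    splits off [A], and the copies [Ys i] among themselves. The scales [lam i] are deterministic
    here. *)
Lemma Pr_scaled_indep (lam : nat -> R) (A : set T) S (q : seq nat) (b : nat -> nat) :
  sigma_family zeta A -> uniq q ->
  let n i t := nat_of_bool (scaled (lam i) ((Ys i)^~ t) \in S) in
  Pr P (A `&` [set t | forall i, i \in q -> n i t = b i]) =
  Pr P A * \prod_(i <- q) Pr P [set t | n i t = b i].
Proof.
move=> sA uq n.
have mA : measurable A by exact: sigma_family_measurable sA.
have mn i : fibers_in measurable (n i).
  by apply: fibers_disc; [exact: measurable_sigma_algebra|move=> j; exact: mfun_preimage].
have sn i : fibers_in (sigma_family (Ys i)) (n i).
  apply: fibers_disc; first exact: sigma_family_sigma_algebra.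
  by move=> j B mB; exact: (@sigma_family_preimage _ _ _ _ (fun j => Ys i j : T -> R)).
pose F := sigma_family (fun q : nat * 'I_k => Ys q.1 q.2 : T -> R).
have sF : sigma_algebra setT F by exact: sigma_family_sigma_algebra.
pose C := [set t | forall i, i \in q -> n i t = b i].
have mem_C (G : set (set T)) : sigma_algebra setT G ->
    (forall i j (B : set R), measurable B -> G (Ys i j @^-1` B)) -> G C.
  move=> sG h; apply: (sigma_algebra_forall sG) => i.
  have [iq|niq] := boolP (i \in q).
    have := fibers_disc (lam i) S sG (h i) (b i); congr G; apply/seteqP; split => t /=; last exact.
    by move=> h' _.
  have := sigma_algebra_cst sG True; congr G; apply/seteqP; split => t //=.
have FC : F C.
  apply: mem_C => // i j B mB.
  exact: (@sigma_family_preimage _ _ _ _ (fun q : nat * 'I_k => Ys q.1 q.2 : T -> R) (i, j)).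
have mC : measurable C by apply: mem_C; [exact: measurable_sigma_algebra|move=> i j; exact: mfun_preimage].
rewrite -(independent_classesP hYs.2 uq (A := fun i => [set t | n i t = b i])); last 2 first.
- by move=> i _; exact: sn.
- by move=> i; exact: mn.
have := independent_classesP (r := [:: true; false]) (A := fun e => if e then A else C) hind isT.
rewrite !big_cons big_nil mulr1 => <-; last 2 first.
- by case.
- by case.
congr Pr; apply/seteqP; split => t /=; first by move=> [At Ct] [].
by move=> h; split; [exact: (h true)|exact: (h false)].
Qed.

(* The factor contributed to [(1 - c) ^ N] by one event. *)
Definition thin (c : R) (b : bool) : R := 1 - c * b%:R.

Lemma thin01 c b : 0 <= c <= 1 -> 0 <= thin c b <= 1.
Proof. by rewrite /thin; case: b; rewrite ?mulr1 ?mulr0 ?subr0 ?lexx ?ler01//; lra. Qed.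

(** Given the rounded values of [zeta], the hits are independent and each indicator averages to a
    [cell_prob]. *)
Lemma Ex_disc (s : R) (L : nat) S c n : 0 < s -> 0 <= c <= 1 ->
  Ex P (fun t => \prod_(i < n) thin c (disc_hit s L S i t)) =
  Ex P (fun t => \prod_(i < n) (1 - c * cell_prob (mesh_point s (mesh_index s L (zeta i t))) S)).
Proof.
move=> s0 c01.
pose idx i t := mesh_index s L (zeta i t).
(* The vector of mesh indices takes finitely many values, so conditioning on it is a finite sum. *)
pose gf t := [ffun i : 'I_n => inord (idx i t) : 'I_L.+1].
have sz (F : set (set T)) : sigma_family zeta `<=` F -> sigma_algebra setT F -> fibers_in F gf.
  move=> zF sF; apply: fibers_in_ffun => // i y.
  have := fibers_mesh_index L s0 (zeta := zeta) (i := i) sF.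
  move=> /(_ (fun B mB => zF _ (@sigma_family_preimage _ _ _ _ (fun i => zeta i : T -> R) i B mB)) y).
  congr F; apply/seteqP; split => t /=; first by move=> e; rewrite /idx e inord_val.
  by move=> <-; rewrite inordK// ltnS mesh_index_le.
have mg : fibers_in measurable gf by apply: sz; [exact: sigma_family_measurable|exact: measurable_sigma_algebra].
have split_g (f : T -> R) : bounded_rv f -> Ex P f = \sum_lam Ex P (fun t => (`[< gf t = lam >])%:R * f t).
  move=> bf; rewrite -Ex_sum; last by move=> lam _; apply: bounded_rvM => //; exact: bounded_rv_indic.
  congr Ex; apply/funext => t; rewrite (bigD1 (gf t))//= asboolT// mul1r big1 ?addr0// => y yg.
  by rewrite asboolF ?mul0r// => e; rewrite e eqxx in yg.
have lam_idx lam t (i : 'I_n) : gf t = lam -> lam i = idx i t :> nat.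
  by move=> <-; rewrite ffunE inordK// ltnS mesh_index_le.
have mdisc i a : fibers_in measurable (fun t => nat_of_bool (scaled a ((Ys i)^~ t) \in S)).
  by apply: fibers_disc; [exact: measurable_sigma_algebra|move=> j; exact: mfun_preimage].
have b1 : bounded_rv (fun t => \prod_(i < n) thin c (disc_hit s L S i t)).
  apply: bounded_rv_prod => i _.
  have := @bounded_rv_nat _ T R (fun t => nat_of_bool (disc_hit s L S i t))
    (fun a => thin c (a != 0%N)).
  rewrite (_ : (fun t => thin c (nat_of_bool _ != 0%N)) = (fun t => thin c (disc_hit s L S i t))); last first.
    by apply/funext => t; case: disc_hit.
  apply; last by move=> a; exact: thin01.
  move=> y; rewrite (_ : [set t | _] = [set t | exists l : 'I_L.+1, idx i t = l /\
     nat_of_bool (scaled (mesh_point s l) ((Ys i)^~ t) \in S) = y]); last first.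
    apply/seteqP; split => t /=; last by move=> [l [<-]].
    by move=> h; exists (inord (idx i t)); rewrite inordK// ltnS mesh_index_le.
  apply: (sigma_algebra_exists_fin (@measurable_sigma_algebra _ T)) => l.
  apply: (sigma_algebra_and (@measurable_sigma_algebra _ T)); last exact: mdisc.
  apply: (fibers_mesh_index L s0 (@measurable_sigma_algebra _ T)); exact: mfun_preimage.
have b2 : bounded_rv (fun t => \prod_(i < n) (1 - c * cell_prob (mesh_point s (idx i t)) S)).
  apply: bounded_rv_prod => i _.
  apply: (@bounded_rv_nat _ T R (idx i) (fun l => 1 - c * cell_prob (mesh_point s l) S)).
    apply: (fibers_mesh_index L s0 (@measurable_sigma_algebra _ T)); exact: mfun_preimage.
  move=> l; have := cell_prob_ge0 (mesh_point s l) S; have := cell_prob_le1 (mesh_point s l) S.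
  by move: c01; nra.
rewrite !split_g//; apply: eq_bigr => lam _.
(* The scales extended to all of [nat]; the value 0 beyond [n] never enters a product. *)
pose la (i : nat) : R := if insub i is Some i' then mesh_point s (lam (i' : 'I_n)) else 0.
have laE (i : 'I_n) : la i = mesh_point s (lam i) by rewrite /la valK.
transitivity (Pr P [set t | gf t = lam] * \prod_(i < n) (1 - c * cell_prob (la i) S)); last first.
  rewrite -Ex_indic// mulrC -ExZ; last exact: bounded_rv_indic.
  congr Ex; apply/funext => t; rewrite mulrC; case: asboolP => [e|_]; last by rewrite !mul0r.
  congr (_ * _); apply: eq_bigr => i _; by rewrite laE (lam_idx _ _ _ e).
pose nn (i : nat) t := nat_of_bool (scaled (la i) ((Ys i)^~ t) \in S).
have E i : Ex P (fun t => thin c (nn i t != 0%N)) = 1 - c * cell_prob (la i) S.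
  rewrite -(cell_prob_copy (la i) S i) -Ex_indic; last first.
    have := mdisc i (la i) 1%N; congr (measurable _); apply/seteqP; split => t /=.
      by case: (_ \in _).
    by move=> ->.
  rewrite /thin ExB; last 2 first.
  - exact: bounded_rv_cst.
  - apply: bounded_rvZ; apply: (@bounded_rv_nat _ T R (nn i) (fun a => (a != 0%N)%:R)).
      exact: mdisc.
    by move=> a; rewrite ler0n lern1; case: (a != 0%N).
  rewrite Ex_cst ExZ; last first.
    apply: (@bounded_rv_nat _ T R (nn i) (fun a => (a != 0%N)%:R)); first exact: mdisc.
    by move=> a; rewrite ler0n lern1; case: (a != 0%N).
  congr (_ - _ * Ex _ _); apply/funext => t; rewrite /nn asboolb.
  by case: (_ \in _).
under [in RHS]eq_bigr do rewrite -E.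
rewrite -(big_mkord xpredT (fun i => Ex P (fun t => thin c (nn i t != 0%N)))).
rewrite -(@Ex_prod_indep _ _ _ P _ nn (fun _ a => thin c (a != 0%N)) [set t | gf t = lam] (index_iota 0 n)).
- congr Ex; apply/funext => t; case: asboolP => [e|_]; last by rewrite !mul0r.
  rewrite !mul1r big_mkord; apply: eq_bigr => i _; congr thin.
  rewrite /nn laE (lam_idx _ _ _ e) /disc_hit /idx.
  by case: (_ \in _).
- by move=> j; exact: mdisc.
- by move=> _ a; exact: thin01.
- exact: mg.
- exact: iota_uniq.
- move=> q a uq _; apply: Pr_scaled_indep => //.
  by apply: sz => //; exact: sigma_family_sigma_algebra.
Qed.

(** The thinning limit with [r l = 1 - c * cell_prob (mesh_point s l) S]. Here [r 0 = 1] because the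
    scale 0 sends every path to [cell0], which is not in [S]. *)
Lemma cvg_Ex_disc (s : R) (L : nat) S c : 0 < s -> 0 <= c <= 1 -> cell0 k M \notin S ->
  Ex P (fun t => \prod_(i < n) thin c (disc_hit s L S i t)) @[n --> \oo] -->
  expR (- (c * disc_mass s L S)).
Proof.
move=> s0 c01 S0.
have h := @cvg_thinned R s L s0 _ T P zeta hz (fun l => 1 - c * cell_prob (mesh_point s l) S).
have -> : c * disc_mass s L S = \sum_(j < L) (1 - (1 - c * cell_prob (mesh_point s j.+1) S)) * bin_mass s L j.+1.
  by rewrite mulr_sumr; apply: eq_bigr => j _; rewrite subKr mulrA.
under eq_fun do rewrite Ex_disc//.
apply: h; first by rewrite /mesh_point mul0r cell_prob0// mulr0 subr0.
move=> l; have := cell_prob_ge0 (mesh_point s l) S; have := cell_prob_le1 (mesh_point s l) S.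
by move: c01; nra.
Qed.

End thinned.

(** * Intensity of exceedances for rounded scales *)

Section mesh_integral.
Variables (R : realType) (s : R) (L : nat).
Hypothesis s0 : 0 < s.

Lemma sum_bin_mass p : (p < L)%N ->
  \sum_(p <= i < L) bin_mass s L i.+1 = (mesh_point s p.+1)^-1.
Proof.
move=> pL; have [n Ln] : exists n, L = (p + n.+1)%N by exists (L - p.+1)%N; lia.
elim: n p pL Ln => [|n IH] p pL Ln.
  by rewrite big_ltn// big_geq ?addr0 /bin_mass; [rewrite ifT ?subr0//; apply/eqP; lia|lia].
rewrite big_ltn// IH; [|lia|lia].
by rewrite /bin_mass ifF ?subrK//; apply/eqP; lia.
Qed.

(** For [x >= 0], the intensity of the [z] whose rounding, multiplied by [y], exceeds [x]. Without
    rounding, and for [x > 0] and [y >= 0], it would be [y / x]. *)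
Definition mesh_integral (x y : R) : R :=
  \sum_(i < L) (x < mesh_point s i.+1 * y)%R%:R * bin_mass s L i.+1.

Lemma mesh_integral_ge0 x y : 0 <= mesh_integral x y.
Proof. by apply: sumr_ge0 => i _; rewrite mulr_ge0// bin_mass_ge0. Qed.

Lemma mesh_integralE x y p : 0 <= y -> (p < L)%N -> x < mesh_point s p.+1 * y ->
  (forall i, (i < p)%N -> mesh_point s i.+1 * y <= x) ->
  mesh_integral x y = (mesh_point s p.+1)^-1.
Proof.
move=> y0 pL xp px; rewrite /mesh_integral.
rewrite -(big_mkord xpredT (fun i => (x < mesh_point s i.+1 * y)%R%:R * bin_mass s L i.+1)).
rewrite (@big_cat_nat _ _ _ p)//=; last exact: ltnW.
rewrite big_nat big1 ?add0r => [|i /andP[_ /px]]; last by rewrite leNgt => /negbTE ->; rewrite mul0r.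
rewrite -sum_bin_mass// [LHS]big_nat [RHS]big_nat; apply: eq_bigr => i /andP[pi _].
by rewrite (lt_le_trans xp) ?mul1r// ler_wpM2r// mesh_point_le.
Qed.

Lemma mesh_integral0 x y : (forall i, (i < L)%N -> mesh_point s i.+1 * y <= x) ->
  mesh_integral x y = 0.
Proof.
move=> h; apply: big1 => i _; have := h i (ltn_ord i).
by rewrite leNgt => /negbTE ->; rewrite mul0r.
Qed.

Variant mesh_spec x y : Prop :=
| Mesh_first p of (p < L)%N & x < mesh_point s p.+1 * y &
    (forall i, (i < p)%N -> mesh_point s i.+1 * y <= x)
| Mesh_none of (forall i, (i < L)%N -> mesh_point s i.+1 * y <= x).

Lemma meshP x y : mesh_spec x y.
Proof.
have [h|h] := pselect (exists i, (i < L)%N && (x < mesh_point s i.+1 * y)); last first.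
  apply: Mesh_none => i iL; rewrite leNgt; apply/negP => xi; apply: h; exists i.
  by rewrite iL xi.
case: (ex_minnP h) => p /andP[pL xp] pmin; apply: (Mesh_first pL xp) => i ip.
rewrite leNgt; apply/negP => xi; have := pmin i; rewrite xi (ltn_trans ip pL) => /(_ isT).
by rewrite leqNgt ip.
Qed.

Lemma mesh_integral_le x y : 0 < x -> 0 <= y -> mesh_integral x y <= y / x.
Proof.
move=> x0 y0; have yx : 0 <= y / x by rewrite divr_ge0// ltW.
case: (meshP x y) => [p pL xp px|h]; last by rewrite mesh_integral0.
have pp : 0 < mesh_point s p.+1 by rewrite /mesh_point mulr_gt0.
by rewrite (mesh_integralE y0 pL xp px) ler_pdivlMr// ler_pdivrMl// ltW.
Qed.

(** The first mesh point above [x / y] exceeds it by at most the spacing [s], and the masses of the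
    bins from there on telescope to its inverse. *)
Lemma mesh_integral_ge x y : 0 < x -> 0 < y -> x / y < mesh_point s L ->
  (x / y + s)^-1 <= mesh_integral x y.
Proof.
move=> x0 y0 xyL; have xy0 : 0 < x / y by rewrite divr_gt0.
case: (meshP x y) => [p pL xp px|h]; last first.
  case: L xyL h => [|L'] xyL h; first by move: xyL; rewrite /mesh_point mul0r ltNge ltW.
  by have := h L' (ltnSn _); rewrite -ler_pdivlMr// leNgt xyL.
have pp : 0 < mesh_point s p.+1 by rewrite /mesh_point mulr_gt0.
rewrite (mesh_integralE (ltW y0) pL xp px) lef_pV2 ?posrE ?addr_gt0//.
rewrite /mesh_point -natr1 mulrDl mul1r lerD2r.
case: p px {pL xp pp} => [|p] px; first by rewrite mul0r ltW.
by rewrite ler_pdivlMr//; exact: px.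
Qed.

End mesh_integral.

Section mesh_limits.
Variable R : realType.

(** With spacing [1 / (m + 1)] and [(m + 1) ^ 2] steps the mesh reaches [m + 1]: it becomes fine and
    exhausts the half-line at the same time. *)
Definition mesh_size (m : nat) : R := m.+1%:R^-1.
Definition mesh_card (m : nat) : nat := (m.+1 * m.+1)%N.

Lemma mesh_size_gt0 m : 0 < mesh_size m.
Proof. by rewrite invr_gt0. Qed.

Lemma mesh_end m : mesh_point (mesh_size m) (mesh_card m) = m.+1%:R :> R.
Proof. by rewrite /mesh_point natrM mulfK// pnatr_eq0. Qed.

Lemma cvg_mesh_size : mesh_size m @[m --> \oo] --> (0 : R).
Proof. exact: cvg_harmonic. Qed.

Lemma mesh_end_gt (x : R) : \forall m \near \oo, x < mesh_point (mesh_size m) (mesh_card m).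
Proof.
near=> m; rewrite mesh_end; near: m.
by apply: filterS (nbhs_infty_gtr x) => m /lt_trans; apply; rewrite ltr_nat.
Unshelve. all: by end_near. Qed.

Lemma cvg_mesh_integral (x y : R) : 0 < x -> 0 <= y ->
  mesh_integral (mesh_size m) (mesh_card m) x y @[m --> \oo] --> y / x.
Proof.
move=> x0; rewrite le_eqVlt => /predU1P[<-|y0].
  rewrite mul0r; apply: cvg_near_cst; apply: nearW => m.
  by apply: mesh_integral0 => i _; rewrite mulr0 ltW.
apply: (@squeeze_cvgr _ _ _ _ (fun m => (x / y + mesh_size m)^-1) (fun=> y / x)).
- near=> m; rewrite mesh_integral_le ?mesh_size_gt0//; last exact: ltW.
  rewrite mesh_integral_ge ?mesh_size_gt0//; near: m; exact: mesh_end_gt.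
- have : (x / y + mesh_size m)^-1 @[m --> \oo] --> (x / y + 0)^-1.
    apply: cvgV; first by rewrite addr0 gt_eqF// divr_gt0.
    by apply: cvgD; [exact: cvg_cst|exact: cvg_mesh_size].
  by rewrite addr0 invf_div.
- exact: cvg_cst.
Unshelve. all: by end_near. Qed.

Lemma mesh_floor_le m (z : R) : 0 < z ->
  mesh_point (mesh_size m) (mesh_index (mesh_size m) (mesh_card m) z) <= z.
Proof.
move=> z0; case E : (mesh_index _ _ _) => [|l]; first by rewrite /mesh_point mul0r ltW.
have lL : (l < mesh_card m)%N by rewrite -E mesh_index_le.
by rewrite ltW// -(mesh_index_gtn (mesh_size_gt0 m) z lL) E.
Qed.

(** Below the last mesh point rounding loses at most the spacing, which is eventually smaller than
    [z - x]. *)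
Lemma mesh_floor_near (x z : R) : x < z ->
  \forall m \near \oo, x < mesh_point (mesh_size m) (mesh_index (mesh_size m) (mesh_card m) z).
Proof.
move=> xz; near=> m.
have zL : z < mesh_point (mesh_size m) (mesh_card m) by near: m; exact: mesh_end_gt.
have sm : mesh_size m < z - x.
  by near: m; apply: (cvgr_lt _ cvg_mesh_size); rewrite subr_gt0.
set l := mesh_index _ _ _.
have lL : (l < mesh_card m)%N.
  rewrite ltn_neqAle mesh_index_le andbT; apply/eqP => lE.
  have c0 : ((mesh_card m).-1 < mesh_card m)%N by rewrite /mesh_card; lia.
  have := mesh_index_gtn (mesh_size_gt0 m) z c0; rewrite -/l lE c0 prednK ?muln_gt0//.
  by rewrite ltNge (ltW zL).
have : ~~ (l < l)%N by rewrite ltnn.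
rewrite {2}/l mesh_index_gtn ?mesh_size_gt0// -leNgt /mesh_point -natr1 mulrDl mul1r => h.
by rewrite -/(mesh_point _ _) /mesh_point; lra.
Unshelve. all: by end_near. Qed.

Variables (M : nat) (g : nat -> R).
Hypothesis g_mono : forall l l', (l <= l' < M)%N -> g l <= g l'.
Hypothesis g_gt0 : forall l, (l < M)%N -> 0 < g l.

Lemma level_mesh_le m (y z : R) : 0 <= y -> 0 < z ->
  (level M g (mesh_point (mesh_size m) (mesh_index (mesh_size m) (mesh_card m) z) * y)
    <= level M g (z * y))%N.
Proof. by move=> y0 z0; apply: level_leq => //; rewrite ler_wpM2r// mesh_floor_le. Qed.

(** Rounding down cannot raise a level. It eventually does not lower it either, since reaching level
    [l.+1] is the strict inequality [g l < z * y], which survives a small decrease of [z]. *)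
Lemma level_mesh_near (y z : R) : 0 <= y -> 0 < z ->
  \forall m \near \oo,
    level M g (mesh_point (mesh_size m) (mesh_index (mesh_size m) (mesh_card m) z) * y) =
    level M g (z * y).
Proof.
move=> y0 z0; case E : (level M g (z * y)) => [|l].
  apply: nearW => m; apply/eqP; rewrite -leqn0 -E; exact: level_mesh_le.
have lM : (l < M)%N by rewrite -E level_le.
have glzy : g l < z * y by rewrite -(level_gtn g_mono _ lM) E.
have yp : 0 < y.
  rewrite lt_neqAle y0 andbT; apply/eqP => y00.
  by move: glzy; rewrite -y00 mulr0 ltNge ltW// g_gt0.
have : g l / y < z by rewrite ltr_pdivrMr.
move=> /mesh_floor_near; apply: filterS => m h.
apply/eqP; rewrite eqn_leq -{1}E level_mesh_le//= (level_gtn g_mono _ lM).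
by rewrite -ltr_pdivrMr.
Qed.

End mesh_limits.

(** * Generating functions of counts *)

Section thinned_counts.
Context (R : realType) d (T : measurableType d) (P : probability T R).
Implicit Types b : nat -> T -> bool.

Lemma bounded_rv_natb (b : T -> bool) : measurable [set t | b t] ->
  bounded_rv (fun t => (b t)%:R : R).
Proof.
move=> mb; rewrite (_ : (fun t => (b t)%:R) = (fun t => (`[< b t >])%:R)).
  exact: bounded_rv_indic.
by apply/funext => t; rewrite asboolb.
Qed.

Lemma Ex_natb (b : T -> bool) : measurable [set t | b t] ->
  Ex P (fun t => (b t)%:R) = Pr P [set t | b t].
Proof.
move=> mb; rewrite -Ex_indic//; congr Ex; apply/funext => t.
by rewrite asboolb.
Qed.

Lemma bounded_rv_thin c (b : T -> bool) : measurable [set t | b t] ->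
  bounded_rv (fun t => thin c (b t) : R).
Proof.
move=> mb; apply: bounded_rvB; first exact: bounded_rv_cst.
by apply: bounded_rvZ; exact: bounded_rv_natb.
Qed.

(* [E (1 - c) ^ N], with [N] the number of [i < n] such that [b i] occurs. *)
Definition gf b (c : R) n := Ex P (fun t => \prod_(i < n) thin c (b i t)).

Lemma bounded_rv_prod_thin c b n : (forall i, measurable [set t | b i t]) ->
  bounded_rv (fun t => \prod_(i < n) thin c (b i t) : R).
Proof. by move=> mb; apply: bounded_rv_prod => i _; exact: bounded_rv_thin. Qed.

Lemma prod_thin01 (c : R) (b : nat -> bool) n : 0 <= c <= 1 ->
  0 <= \prod_(i < n) thin c (b i) <= 1.
Proof.
move=> c01; apply/andP; split.
  by apply: prodr_ge0 => i _; case/andP: (thin01 (b i) c01).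
by apply: prodr_ile1 => i _; exact: thin01.
Qed.

Lemma gf_nonincreasing b c : (forall i, measurable [set t | b i t]) -> 0 <= c <= 1 ->
  {homo gf b c : n m / (n <= m)%N >-> m <= n}.
Proof.
move=> mb c01; apply/nonincreasing_seqP => n.
apply: Ex_le; [exact: bounded_rv_prod_thin|exact: bounded_rv_prod_thin|move=> t].
have /andP[p0 _] := prod_thin01 (b^~ t) n c01.
have /andP[t0 t1] := thin01 (b n t) c01.
by rewrite big_ord_recr/= ler_piMr.
Qed.

(** Each further event that occurs lowers the product by at most [c], because the product stays in
    [0, 1]. *)
Lemma prod_thin_ge (c : R) (b : nat -> bool) n n' : 0 <= c <= 1 -> (n <= n')%N ->
  \prod_(i < n) thin c (b i) - c * \sum_(n <= i < n') (b i)%:R <= \prod_(i < n') thin c (b i).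
Proof.
move=> c01 /subnK <-; elim: (n' - n)%N => [|m IH].
  by rewrite add0n big_geq// mulr0 subr0.
rewrite addSn big_nat_recr ?leq_addl//= [X in _ <= X]big_ord_recr/=.
have /andP[p0 p1] := prod_thin01 b (m + n) c01.
move: IH; rewrite /thin; set p := (\prod_(i < (m + n)%N) _) in p0 p1 *.
by case: (b (m + n)%N); rewrite /= ?mulr1 ?mulr0; move: c01 p0 p1; nra.
Qed.

(** A first-order expansion at [c = 0] for fixed [n]. The bound is crude in [n], but only the order
    [c ^ 2] of the error matters, as [c] tends to 0 first. *)
Lemma prod_thin_le (c : R) (b : nat -> bool) n : 0 <= c <= 1 ->
  \prod_(i < n) thin c (b i) <= 1 - c * \sum_(i < n) (b i)%:R + c ^+ 2 * n%:R ^+ 2.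
Proof.
move=> c01; elim: n => [|n IH]; first by rewrite !big_ord0 expr0n/=; lra.
rewrite !big_ord_recr/=; have := prod_thin_ge b c01 (leq0n n).
rewrite big_mkord big_ord0 -natr1; move: IH.
have qn : \sum_(i < n) (b i)%:R <= n%:R :> R.
  rewrite -[X in _ <= X%:R]card_ord -sum1_card natr_sum.
  by apply: ler_sum => i _; case: (b i).
have n0 : 0 <= n%:R :> R by [].
move: qn n0; set p := \prod_(i < n) _; set q := \sum_(i < n) _.
move: (n%:R : R) => x qx x0 IH pge.
have cq : c * q <= c * x by rewrite ler_wpM2l//; case/andP: c01.
have c2x : 0 <= c ^+ 2 * x by rewrite mulr_ge0// sqr_ge0.
rewrite /thin; case: (b n); rewrite /= ?mulr1 ?mulr0 ?subr0 ?addr0 ?mulr1.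
  have : c * (1 - c * x) <= c * p by rewrite ler_wpM2l//; [case/andP: c01|lra].
  have := sqr_ge0 c; nra.
have := sqr_ge0 c; nra.
Qed.

Lemma sum_Pr_Ex b (r : seq nat) : (forall i, measurable [set t | b i t]) ->
  \sum_(i <- r) Pr P [set t | b i t] = Ex P (fun t => \sum_(i <- r) (b i t)%:R).
Proof.
move=> mb; rewrite Ex_sum => [|i _]; last exact: bounded_rv_natb.
by apply: eq_bigr => i _; rewrite Ex_natb.
Qed.

Lemma gf_sub b c n n' : (forall i, measurable [set t | b i t]) -> 0 <= c <= 1 -> (n <= n')%N ->
  gf b c n - \sum_(n <= i < n') Pr P [set t | b i t] <= gf b c n'.
Proof.
move=> mb c01 nn'.
have bS : bounded_rv (fun t => \sum_(n <= i < n') (b i t)%:R : R).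
  by apply: bounded_rv_sum => i _; exact: bounded_rv_natb.
rewrite sum_Pr_Ex// -ExB//; last exact: bounded_rv_prod_thin.
apply: Ex_le; [apply: bounded_rvB => //; exact: bounded_rv_prod_thin|exact: bounded_rv_prod_thin|].
move=> t; apply: le_trans (prod_thin_ge (b^~ t) c01 nn').
rewrite lerD2l lerN2 -[X in _ <= X]mul1r.
by rewrite ler_wpM2r ?sumr_ge0//; case/andP: c01.
Qed.

Lemma gf_le b c n : (forall i, measurable [set t | b i t]) -> 0 <= c <= 1 ->
  gf b c n <= 1 - c * \sum_(i < n) Pr P [set t | b i t] + c ^+ 2 * n%:R ^+ 2.
Proof.
move=> mb c01.
have bS : bounded_rv (fun t => \sum_(i < n) (b i t)%:R : R).
  by apply: bounded_rv_sum => i _; exact: bounded_rv_natb.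
have bC : bounded_rv (fun t => 1 - c * \sum_(i < n) (b i t)%:R : R).
  by apply: bounded_rvB; [exact: bounded_rv_cst|exact: bounded_rvZ].
have -> : 1 - c * \sum_(i < n) Pr P [set t | b i t] + c ^+ 2 * n%:R ^+ 2 =
    Ex P (fun t => 1 - c * \sum_(i < n) (b i t)%:R + c ^+ 2 * n%:R ^+ 2).
  rewrite ExD//; last exact: bounded_rv_cst.
  rewrite ExB//; [|exact: bounded_rv_cst|exact: bounded_rvZ].
  rewrite !Ex_cst ExZ// -(big_mkord xpredT (fun i => Pr P [set t | b i t])) sum_Pr_Ex//.
  by congr (_ - _ * Ex _ _ + _); apply/funext => t; rewrite big_mkord.
apply: Ex_le; [exact: bounded_rv_prod_thin| |move=> t].
  by apply: bounded_rvD => //; exact: bounded_rv_cst.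
exact: (prod_thin_le (b^~ t)).
Qed.

Lemma gf_ge_of_cvg b c (lam C : R) n : (forall i, measurable [set t | b i t]) -> 0 <= c <= 1 ->
  gf b c n @[n --> \oo] --> expR (- (c * lam)) -> lam <= C -> expR (- (c * C)) <= gf b c n.
Proof.
move=> mb c01 h lamC.
have h2 := nonincreasing_cvgn_ge (gf_nonincreasing mb c01) (cvgP _ h) n.
rewrite (cvg_lim _ h)// in h2; apply: le_trans h2.
by rewrite ler_expR lerN2 ler_wpM2l//; case/andP: c01.
Qed.

Lemma cvg_gf_events (b : nat -> nat -> T -> bool) b' c n :
  (forall m i, measurable [set t | b m i t]) -> (forall i, measurable [set t | b' i t]) ->
  (forall i t, \forall m \near \oo, b m i t = b' i t) -> 0 <= c <= 1 ->
  gf (b m) c n @[m --> \oo] --> gf b' c n.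
Proof.
move=> mb mb' near_b c01.
apply: (@bounded_convergence _ _ _ P _ _ 1 set0).
- exact: negligible_set0.
- by move=> m; have [] := @bounded_rv_prod_thin c (b m) n (mb m).
- by have [] := @bounded_rv_prod_thin c b' n mb'.
- by move=> m t; have /andP[p0 p1] := prod_thin01 ((b m)^~ t) n c01; rewrite ger0_norm.
- move=> t _; apply: cvg_near_cst.
  have : \forall m \near \oo, forall i : 'I_n, b m i t = b' i t by apply: filter_forall => i; exact: near_b.
  by apply: filterS => m h; apply: eq_bigr => i _; rewrite h.
Qed.

(* The derivative at [c = 0] of the generating function. *)
Lemma sum_Pr_hits_le (b : nat -> nat -> T -> bool) b' (lam : nat -> R) (C : R) n :
  (forall m i, measurable [set t | b m i t]) -> (forall i, measurable [set t | b' i t]) ->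
  (forall i t, \forall m \near \oo, b m i t = b' i t) ->
  (forall m c, 0 <= c <= 1 -> gf (b m) c n @[n --> \oo] --> expR (- (c * lam m))) ->
  (forall m, lam m <= C) ->
  \sum_(i < n) Pr P [set t | b' i t] <= C.
Proof.
move=> mb mb' near_b cvg_b lamC.
set q := \sum_(i < n) _.
(* The lower bound [expR (- (c * C)) >= 1 - c * C] is compared with the quadratic upper bound
   [gf_le], and the result is divided by [c]. *)
have H (c : R) : 0 < c <= 1 -> q <= C + c * n%:R ^+ 2.
  move=> /andP[c0 c1]; have c01 : 0 <= c <= 1 by rewrite c1 ltW.
  have h1 : expR (- (c * C)) <= gf b' c n.
    have cv := @cvg_gf_events b b' _ n mb mb' near_b c01.
    apply: (@cvgr_to_ge _ _ _ _ _ _ _ cv); apply: nearW => m.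
    exact: (gf_ge_of_cvg n (mb m) c01 (cvg_b m c c01)).
  have h2 := gf_le n mb' c01.
  have h3 := expR_ge1Dx (- (c * C)).
  have : c * q <= c * (C + c * n%:R ^+ 2).
    rewrite -/q in h2; rewrite mulrDr mulrA -expr2; lra.
  by rewrite ler_pM2l.
apply/ler_addgt0Pr => e e0.
have N0 : 0 <= n%:R ^+ 2 :> R by rewrite sqr_ge0.
(* Chosen so that [c * n ^ 2 <= e]; the added 1 keeps the denominator positive when [n = 0]. *)
pose c := Num.min 1 (e / (n%:R ^+ 2 + 1)).
have c0 : 0 < c <= 1.
  by rewrite lt_min ltr01 divr_gt0 ?ltr_wpDl//= ge_min lexx.
apply: (le_trans (H c c0)); rewrite lerD2l.
have : c <= e / (n%:R ^+ 2 + 1) by rewrite ge_min lexx orbT.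
rewrite ler_pdivlMr ?ltr_wpDl//; apply: le_trans.
by case/andP: c0 => c0 _; rewrite ler_wpM2l ?lerDl// ltW.
Qed.

Lemma series_tail (p : nat -> R) (C : R) : (forall i, 0 <= p i) ->
  (forall n, \sum_(i < n) p i <= C) ->
  forall e, 0 < e -> \forall n \near \oo, forall n', (n <= n')%N -> \sum_(n <= i < n') p i <= e.
Proof.
move=> p0 pC e e0.
pose u n := \sum_(i < n) p i.
have und : {homo u : n m / (n <= m)%N >-> n <= m}.
  by apply/nondecreasing_seqP => n; rewrite /u big_ord_recr/= lerDl.
have cu : u n @[n --> \oo] --> limn u.
  by apply: nondecreasing_is_cvgn => //; exists C => _ [n _ <-]; exact: pC.
near=> n => n' nn'.
have -> : \sum_(n <= i < n') p i = u n' - u n.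
  rewrite /u -!(big_mkord xpredT p) (@big_cat_nat _ _ _ n 0 n')//=.
  by rewrite addrAC subrr add0r.
have h1 : u n' <= limn u by apply: nondecreasing_cvgn_le => //; exact: cvgP cu.
have : limn u - e < u n by near: n; apply: (cvgr_gt _ cu); rewrite ltrBlDr ltrDl.
lra.
Unshelve. all: by end_near. Qed.

(* Summability of the dominating events [u] makes the limits in [n] uniform in [m],
   so that they may be exchanged. *)
Lemma cvg_gf (b : nat -> nat -> T -> bool) b' u (lam : nat -> R) (C : R) :
  (forall m i, measurable [set t | b m i t]) -> (forall i, measurable [set t | b' i t]) ->
  (forall i, measurable [set t | u i t]) ->
  (forall m i t, b m i t -> u i t) -> (forall i t, b' i t -> u i t) ->
  (forall n, \sum_(i < n) Pr P [set t | u i t] <= C) ->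
  (forall i t, \forall m \near \oo, b m i t = b' i t) ->
  (forall m c, 0 <= c <= 1 -> gf (b m) c n @[n --> \oo] --> expR (- (c * lam m))) ->
  (forall m, lam m <= C) ->
  exists2 l, lam m @[m --> \oo] --> l &
    forall c, 0 <= c <= 1 -> gf b' c n @[n --> \oo] --> expR (- (c * l)).
Proof.
move=> mb mb' mu bu b'u uC near_b cvg_b lamC.
have tail := series_tail (p := fun i => Pr P [set t | u i t]) (fun i => Pr_ge0 P _) uC.
(* The distance of the [n]-th value to its limit is at most the tail of the series of the [u i],
   which does not depend on [m]. *)
have close c : 0 <= c <= 1 -> forall e, 0 < e ->
    \forall n \near \oo, forall m, `|gf (b m) c n - expR (- (c * lam m))| <= e.
  move=> c01 e e0; have := tail e e0; apply: filterS => n hn m.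
  have mono := gf_nonincreasing (mb m) c01.
  have cv := cvg_b m c c01.
  have h1 : expR (- (c * lam m)) <= gf (b m) c n.
    by have := nonincreasing_cvgn_ge mono (cvgP _ cv) n; rewrite (cvg_lim _ cv).
  rewrite ger0_norm ?subr_ge0// lerBlDr -lerBlDl.
  apply: (cvgr_to_ge cv); near=> n'.
  have nn' : (n <= n')%N by near: n'; exact: nbhs_infty_ge.
  apply: le_trans (gf_sub (mb m) c01 nn'); rewrite lerD2l lerN2.
  apply: le_trans (hn _ nn'); apply: ler_sum => i _.
  by apply: Pr_le => // t; exact: bu.
have one01 : 0 <= (1 : R) <= 1 by rewrite ler01 lexx.
have cv1 : gf b' 1 n @[n --> \oo] --> limn (gf b' 1).
  apply: nonincreasing_is_cvgn; first exact: gf_nonincreasing.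
  exists 0 => _ [n _ <-]; rewrite -(Ex_cst P 0).
  apply: Ex_le; [exact: bounded_rv_cst|exact: bounded_rv_prod_thin|move=> t].
  by case/andP: (prod_thin01 (b'^~ t) n one01).
have explam : expR (- lam m) @[m --> \oo] --> limn (gf b' 1).
  apply/cvgrPdist_le => e e0.
  have e3 : 0 < e / 3%:R by rewrite divr_gt0.
  have [n [hn1 hn2]] : exists n, (forall m, `|gf (b m) 1 n - expR (- (1 * lam m))| <= e / 3%:R)
      /\ `|limn (gf b' 1) - gf b' 1 n| <= e / 3%:R.
    have /filter_ex[n ?] : \forall n \near \oo, (forall m, `|gf (b m) 1 n - expR (- (1 * lam m))| <= e / 3%:R)
      /\ `|limn (gf b' 1) - gf b' 1 n| <= e / 3%:R.
      by apply: filterI; [exact: close|exact: (cvgrPdist_le _ _).1 cv1 _ e3].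
    by exists n.
  near=> m.
  have h3 : `|gf b' 1 n - gf (b m) 1 n| <= e / 3%:R.
    by near: m; apply: ((cvgrPdist_le _ _).1 (@cvg_gf_events b b' _ n mb mb' near_b one01) _ e3).
  have := hn1 m; rewrite mul1r => h1.
  have -> : limn (gf b' 1) - expR (- lam m) = (limn (gf b' 1) - gf b' 1 n) + (gf b' 1 n - gf (b m) 1 n)
    + (gf (b m) 1 n - expR (- lam m)) by ring.
  apply: le_trans (ler_normD _ _) _.
  have := ler_normD (limn (gf b' 1) - gf b' 1 n) (gf b' 1 n - gf (b m) 1 n); lra.
(* The common bound [C] keeps the limit away from 0, so that its logarithm gives the limit of
   [lam m]. *)
have vpos : 0 < limn (gf b' 1).
  apply: lt_le_trans (expR_gt0 (- C)) _; apply: (cvgr_to_ge explam).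
  by apply: nearW => m; rewrite ler_expR lerN2.
have caml : lam m @[m --> \oo] --> - ln (limn (gf b' 1)).
  have : - ln (expR (- lam m)) @[m --> \oo] --> - ln (limn (gf b' 1)).
    by apply: cvgN; apply: continuous_cvg => //; exact: continuous_ln.
  by apply: cvg_trans; apply: near_eq_cvg; apply: nearW => m; rewrite expRK opprK.
exists (- ln (limn (gf b' 1))) => // c c01.
apply/cvgrPdist_le => e e0; have := close c c01 e e0; apply: filterS => n hn.
rewrite distrC.
(* At fixed [n] the uniform estimate survives the limit in [m]. *)
have cv : `|gf (b m) c n - expR (- (c * lam m))| @[m --> \oo] -->
    `|gf b' c n - expR (- (c * - ln (limn (gf b' 1))))|.
  apply: cvg_norm; apply: cvgB; first exact: cvg_gf_events.
  apply: continuous_cvg; first exact: continuous_expR.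
  by apply: cvgN; apply: cvgM => //; exact: cvg_cst.
by apply: (cvgr_to_le cv); apply: nearW => m.
Unshelve. all: by end_near. Qed.

(** At [c = 1] the product of thinning factors is the indicator that none of the first [n] events
    occurs; continuity from above does the rest. *)
Lemma Pr_no_hit b (l : R) : (forall i, measurable [set t | b i t]) ->
  gf b 1 n @[n --> \oo] --> expR (- l) ->
  Pr P [set t | forall i, ~~ b i t] = expR (- l).
Proof.
move=> mb h.
pose A n := [set t | forall i : 'I_n, ~~ b i t].
have mA n : measurable (A n).
  apply: (sigma_algebra_forall_fin (@measurable_sigma_algebra _ T)) => i.
  have := sigma_algebra_not (@measurable_sigma_algebra _ T) (mb i).
  by congr (measurable _); apply/seteqP; split => t /= /negP.
have AE : \bigcap_n A n = [set t | forall i, ~~ b i t].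
  apply/seteqP; split => t /= h'; last by move=> n _ i; exact: h'.
  by move=> i; exact: (h' i.+1 I ord_max).
have gfE n : gf b 1 n = Pr P (A n).
  rewrite -(@Ex_indic _ _ _ P (A n)); last exact: mA.
  congr Ex; apply/funext => t; rewrite /thin.
  case: asboolP => [At|nA].
    by rewrite big1// => i _; rewrite (negbTE (At i)) mulr0 subr0.
  have [i bi] : exists i : 'I_n, b i t.
    by apply: contrapT => nE; apply: nA => i; apply/negP => bi; apply: nE; exists i.
  by rewrite (bigD1 i)//= bi mulr1 subrr mul0r.
have mAI : measurable (\bigcap_n A n) by exact: bigcap_measurable.
have := @nonincreasing_cvg_mu _ _ _ P A.
rewrite -ge0_fin_numE// fin_num_measure// => /(_ isT mA mAI).
have mono : {homo A : n m / (n <= m)%N >-> (m <= n)%O}.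
  move=> n m nm; apply/subsetPset => t Am i; exact: (Am (widen_ord nm i)).
move=> /(_ mono); rewrite AE => cv.
have : Pr P (A n) @[n --> \oo] --> Pr P [set t | forall i, ~~ b i t].
  have E : P [set t | forall i, ~~ b i t] = (Pr P [set t | forall i, ~~ b i t])%:E.
    by rewrite PrE// -AE.
  by move: cv => /=; rewrite E => /fine_cvgP[].
under eq_fun do rewrite -gfE.
by move=> h2; rewrite (cvg_unique _ h h2).
Qed.

Lemma measurable_pair_hit b n : (forall i, measurable [set t | b i t]) ->
  measurable [set t | exists i i' : 'I_n, [/\ i != i', b i t & b i' t]].
Proof.
move=> mb; have sM := @measurable_sigma_algebra _ T.
apply: (sigma_algebra_exists_fin sM) => i; apply: (sigma_algebra_exists_fin sM) => i'.
have := sigma_algebra_and sM (sigma_algebra_cst sM (i != i')) (sigma_algebra_and sM (mb i) (mb i')).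
by congr (measurable _); apply/seteqP; split => t /= [? [? ?]]; split.
Qed.

(* [(N >= 2) / 4 <= (1 + (N = 0)) / 2 - 2 ^ - N] for every natural number [N]. *)
Lemma Pr_pair_hit_le b n : (forall i, measurable [set t | b i t]) ->
  Pr P [set t | exists i i' : 'I_n, [/\ i != i', b i t & b i' t]] <=
  2%:R * (1 + gf b 1 n) - 4%:R * gf b 2%:R^-1 n.
Proof.
move=> mb; have mp := measurable_pair_hit n mb.
have b1 := bounded_rv_prod_thin 1 n mb; have b2 := bounded_rv_prod_thin 2%:R^-1 n mb.
have bc : bounded_rv (fun _ : T => 1 : R) by exact: bounded_rv_cst.
have -> : 2%:R * (1 + gf b 1 n) - 4%:R * gf b 2%:R^-1 n =
    Ex P (fun t => 2%:R * (1 + \prod_(i < n) thin 1 (b i t)) - 4%:R * \prod_(i < n) thin 2%:R^-1 (b i t)).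
  rewrite ExB; [|by apply: bounded_rvZ; exact: bounded_rvD|exact: bounded_rvZ].
  by rewrite !ExZ// ?ExD ?Ex_cst//; exact: bounded_rvD.
rewrite -Ex_indic//; apply: Ex_le; first exact: bounded_rv_indic.
  by apply: bounded_rvB; apply: bounded_rvZ => //; exact: bounded_rvD.
move=> t; have half01 : 0 <= (2%:R^-1 : R) <= 1 by lra.
case: asboolP => [[i [i' [ii' bi bi']]]|h].
  have i'i : i' != i by rewrite eq_sym.
  rewrite (bigD1 i)//= {1}/thin bi mulr1 subrr mul0r addr0 mulr1.
  rewrite [X in _ - _ * X](bigD1 i)//= [X in _ - _ * (_ * X)](bigD1 i')//= /thin bi bi' !mulr1.
  set p := \prod_(j < n | _) _.
  have : p <= 1 by apply: prodr_ile1 => j _; exact: (thin01 (b j t) half01).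
  lra.
have [[i bi]|h0] := pselect (exists i : 'I_n, b i t); last first.
  rewrite !big1/=; first (rewrite mulr0n; lra).
    by move=> i _; rewrite /thin; case: (boolP (b i t)) => [bi|]; rewrite ?mulr0 ?subr0//; case: h0; exists i.
  by move=> i _; rewrite /thin; case: (boolP (b i t)) => [bi|]; rewrite ?mulr0 ?subr0//; case: h0; exists i.
have nb j : j != i -> b j t = false.
  by move=> ji; apply/negbTE/negP => bj; apply: h; exists j, i.
rewrite (bigD1 i)//= {1}/thin bi mulr1 subrr mul0r addr0 mulr1.
rewrite (bigD1 i)//= /thin bi mulr1 big1; first lra.
by move=> j /nb ->; rewrite mulr0 subr0.
Qed.

Lemma Pr_pair_hit b (l : R) : 0 <= l -> (forall i, measurable [set t | b i t]) ->
  (forall c, 0 <= c <= 1 -> gf b c n @[n --> \oo] --> expR (- (c * l))) ->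
  Pr P [set t | exists i i', [/\ i != i', b i t & b i' t]] <= l ^+ 2.
Proof.
move=> l0 mb h.
pose A n := [set t | exists i i' : 'I_n, [/\ i != i', b i t & b i' t]].
have mA n : measurable (A n) by exact: measurable_pair_hit.
have AE : \bigcup_n A n = [set t | exists i i', [/\ i != i', b i t & b i' t]].
  apply/seteqP; split => t /=; first by move=> [n _ [i [i' [? ? ?]]]]; exists i, i'.
  move=> [i [i' [ii' bi bi']]].
  have li : (i < (maxn i i').+1)%N by rewrite ltnS leq_maxl.
  have li' : (i' < (maxn i i').+1)%N by rewrite ltnS leq_maxr.
  by exists (maxn i i').+1 => //; exists (Ordinal li), (Ordinal li').
have mAU : measurable (\bigcup_n A n) by exact: bigcup_measurable.
have mono : {homo A : n m / (n <= m)%N >-> (n <= m)%O}.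
  move=> n m nm; apply/subsetPset => t [i [i' [ii' bi bi']]].
  by exists (widen_ord nm i), (widen_ord nm i').
have := nondecreasing_cvg_mu (mu := P) mA mAU mono; rewrite AE => cv.
have {}cv : Pr P (A n) @[n --> \oo] --> Pr P [set t | exists i i', [/\ i != i', b i t & b i' t]].
  have E : P [set t | exists i i', [/\ i != i', b i t & b i' t]] =
      (Pr P [set t | exists i i', [/\ i != i', b i t & b i' t]])%:E by rewrite PrE// -AE.
  by move: cv => /=; rewrite E => /fine_cvgP[].
have one01 : 0 <= (1 : R) <= 1 by rewrite ler01 lexx.
have half01 : 0 <= (2%:R^-1 : R) <= 1 by lra.
have cvU : 2%:R * (1 + gf b 1 n) - 4%:R * gf b 2%:R^-1 n @[n --> \oo] -->
    2%:R * (1 + expR (- (1 * l))) - 4%:R * expR (- (2%:R^-1 * l)).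
  apply: cvgB; apply: cvgM; try exact: cvg_cst; last exact: h.
  by apply: cvgD; [exact: cvg_cst|exact: h].
apply: (@le_trans _ _ (2%:R * (1 + expR (- (1 * l))) - 4%:R * expR (- (2%:R^-1 * l)))).
  by apply: (ler_cvg_to cv cvU); apply: nearW => n; exact: Pr_pair_hit_le.
(* With [u = expR (- l / 2)] the bound becomes [2 * (1 - u) ^ 2], and [0 <= 1 - u <= l / 2]. *)
have -> : expR (- (1 * l)) = expR (- (2%:R^-1 * l)) ^+ 2.
  by rewrite expr2 -expRD; congr expR; lra.
have := expR_ge1Dx (- (2%:R^-1 * l)).
have : expR (- (2%:R^-1 * l)) <= 1 by rewrite -[X in _ <= X]expR0 ler_expR; lra.
set u := expR _; nra.
Qed.

End thinned_counts.

(** * The exponent measure *)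

Section exponent_measure.
Variables (R : realType) (k M : nat) (g : nat -> R).
Hypothesis M_gt0 : (0 < M)%N.
Hypothesis g_mono : forall l l', (l <= l' < M)%N -> g l <= g l'.
Hypothesis g_gt0 : forall l, (l < M)%N -> 0 < g l.
Context d (T : measurableType d) (P : probability T R).
Context dY (TY : measurableType dY) (PY : probability TY R).
Variables (Y : 'I_k -> {RV PY >-> R}) (zeta : nat -> {RV P >-> R})
  (Ys : nat -> 'I_k -> {RV P >-> R}).
Hypothesis hz : poisson_process P `]0, +oo[ (@inverse_square_intensity R) zeta.
Hypothesis hYs : independent_copies P Ys PY Y.
Hypothesis Y_ge0 : forall j t, 0 <= Y j t.
Hypothesis Ys_ge0 : forall i j t, 0 <= Ys i j t.
Hypothesis EY : forall j, ('E_PY[Y j] = 1)%E.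
Hypothesis hind : independent_classes P (fun b : bool =>
  if b then sigma_family zeta else sigma_family (fun q : nat * 'I_k => Ys q.1 q.2)).

Notation cells := (cellT k M).
Implicit Types (S : {set cells}).
Notation mass m S := (disc_mass g Y (mesh_size R m) (mesh_card m) S).
Notation disc m S := (disc_hit g zeta Ys (mesh_size R m) (mesh_card m) S).

Lemma zeta_pos i t : 0 < zeta i t.
Proof. exact: (zeta_gt0 hz). Qed.

Lemma measurable_hit S i : measurable [set t | hit g zeta Ys S i t].
Proof.
have sM := @measurable_sigma_algebra _ T.
apply: (fibers_in_pred sM (fun e => e \in S)); apply: (fibers_cell g_mono sM) => j B mB.
have m : measurable_fun setT (fun t => zeta i t * Ys i j t) by exact: measurable_funM.
by rewrite -[X in measurable X]setTI; exact: m.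
Qed.

Lemma measurable_disc_hit m S i : measurable [set t | disc m S i t].
Proof.
have sM := @measurable_sigma_algebra _ T.
apply: (fibers_in_pred sM (fun e => e \in S)); apply: (fibers_cell g_mono sM) => j B mB.
have mz : measurable_fun setT
    (fun t => mesh_point (mesh_size R m) (mesh_index (mesh_size R m) (mesh_card m) (zeta i t))).
  apply: (measurableT_comp (f := fun z : R => mesh_point (mesh_size R m)
    (mesh_index (mesh_size R m) (mesh_card m) z))) => //.
  apply: nondecreasing_measurable => // x y xy.
  apply: mesh_point_le; first exact: mesh_size_gt0.
  by apply: level_leq => //; exact: (mesh_mono (mesh_size_gt0 R m)).
have mm : measurable_fun setT (fun t => mesh_point (mesh_size R m)
    (mesh_index (mesh_size R m) (mesh_card m) (zeta i t)) * Ys i j t) by exact: measurable_funM.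
by rewrite -[X in measurable X]setTI; exact: mm.
Qed.

Lemma disc_hit_near S i t : \forall m \near \oo, disc m S i t = hit g zeta Ys S i t.
Proof.
have : \forall m \near \oo, forall j : 'I_k,
    level M g (mesh_point (mesh_size R m) (mesh_index (mesh_size R m) (mesh_card m) (zeta i t)) * Ys i j t)
    = level M g (zeta i t * Ys i j t).
  by apply: filter_forall => j; exact: (level_mesh_near g_mono g_gt0 (Ys_ge0 i j t) (zeta_pos i t)).
apply: filterS => m h; rewrite /disc_hit /hit.
by congr in_mem; apply/ffunP => j; apply: val_inj; rewrite /= !cellE.
Qed.

Lemma hit_neq0 S i t : cell0 k M \notin S -> hit g zeta Ys S i t ->
  hit g zeta Ys (~: [set cell0 k M])%SET i t.
Proof. by move=> S0; rewrite /hit !inE; apply: contraTneq => ->. Qed.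

(** Rounding only lowers levels, so a rounded path outside [cell0] comes from a path outside
    [cell0]. This provides the dominating event common to all meshes. *)
Lemma disc_hit_neq0 m S i t : cell0 k M \notin S -> disc m S i t ->
  hit g zeta Ys (~: [set cell0 k M])%SET i t.
Proof.
move=> S0; rewrite /hit /disc_hit !inE => h; apply/eqP => e0; move/negP: S0; apply.
move: h; congr (is_true (in_mem _ _)); apply/ffunP => j; apply: val_inj; rewrite /= cellE.
apply/eqP; rewrite [X in _ == X](_ : _ = 0%N) ?ffunE// -leqn0.
apply: leq_trans (level_mesh_le g_mono m (Ys_ge0 i j t) (zeta_pos i t)) _.
by rewrite -(@cellE _ _ M g (fun j => zeta i t * Ys i j t)) e0 ffunE.
Qed.

(** Taking the sum over bins inside the expectation yields an integrand that lies below
    [Y j t / g l] and converges to it, and [Y j] has mean 1. *)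
Lemma mass_upperE m j l : (l < M)%N ->
  mass m (upper M j l) = Ex PY (fun t => mesh_integral (mesh_size R m) (mesh_card m) (g l) (Y j t)).
Proof.
move=> lM; rewrite /disc_mass /mesh_integral.
have mE a : measurable [set t | g l < a * Y j t].
  have mm : measurable_fun setT (fun t => a * Y j t) by exact: measurable_funM.
  rewrite -[X in measurable X]setTI.
  rewrite (_ : [set t | _] = (fun t => a * Y j t) @^-1` `]g l, +oo[%classic); first exact: mm.
  by apply/seteqP; split => t /=; rewrite in_itv/= andbT.
have E a : cell_prob g Y a (upper M j l) = Pr PY [set t | g l < a * Y j t].
  by congr Pr; apply/seteqP; split => t /=; rewrite inE cellE (level_gtn g_mono).
pose F (i : 'I_(mesh_card m)) t : R :=
  (g l < mesh_point (mesh_size R m) i.+1 * Y j t)%R%:R * bin_mass (mesh_size R m) (mesh_card m) i.+1.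
have bF i : bounded_rv (F i).
  by apply: bounded_rvM; [exact: bounded_rv_natb|exact: bounded_rv_cst].
transitivity (Ex PY (fun t => \sum_(i < mesh_card m) F i t)); last by [].
rewrite Ex_sum//.
apply: eq_bigr => i _; rewrite E mulrC -Ex_natb// -ExZ; last exact: bounded_rv_natb.
by congr Ex; apply/funext => t; rewrite mulrC.
Qed.

Lemma integral_Y j (x : R) : 0 < x ->
  (\int[PY]_t ((Y j t / x)%:E) = (x^-1)%:E)%E /\ PY.-integrable setT (fun t => (Y j t / x)%:E).
Proof.
move=> x0; have EYj : (\int[PY]_t (Y j t)%:E = 1)%E by rewrite -expectation_def.
have mY : measurable_fun setT (fun t => (Y j t)%:E) by exact/measurable_EFinP.
have E : (\int[PY]_t ((Y j t / x)%:E) = (x^-1)%:E)%E.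
  under eq_integral do rewrite mulrC EFinM.
  rewrite ge0_integralZl_EFin//; first by rewrite EYj mule1.
  - by move=> t _; rewrite lee_fin.
  - by rewrite invr_ge0 ltW.
split=> //; apply/integrableP; split.
  by apply/measurable_EFinP; exact: measurable_funM.
rewrite (eq_integral (fun t => (Y j t / x)%:E)) ?E ?ltry// => t _.
by rewrite gee0_abs// lee_fin divr_ge0// ltW.
Qed.

Lemma mesh_integral_bounded m j l : (l < M)%N ->
  bounded_rv (fun t => mesh_integral (mesh_size R m) (mesh_card m) (g l) (Y j t)).
Proof.
move=> lM; apply: bounded_rv_sum => i _.
apply: bounded_rvM; last exact: bounded_rv_cst.
apply: bounded_rv_natb.
have mm : measurable_fun setT (fun t => mesh_point (mesh_size R m) i.+1 * Y j t) by exact: measurable_funM.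
rewrite -[X in measurable X]setTI.
rewrite (_ : [set t | _] = (fun t => mesh_point (mesh_size R m) i.+1 * Y j t) @^-1` `]g l, +oo[%classic); first exact: mm.
by apply/seteqP; split => t /=; rewrite in_itv/= andbT.
Qed.

Lemma mass_upper_le m j l : (l < M)%N -> mass m (upper M j l) <= (g l)^-1.
Proof.
move=> lM; have gl := g_gt0 lM.
have [E int] := integral_Y j gl.
rewrite mass_upperE// -lee_fin -E -ExE; last exact: mesh_integral_bounded.
apply: ge0_le_integral => //.
- by move=> t _; rewrite lee_fin mesh_integral_ge0// mesh_size_gt0.
- by apply/measurable_EFinP; case: (mesh_integral_bounded m j lM).
- by case/integrableP: int.
- by move=> t _; rewrite lee_fin mesh_integral_le// mesh_size_gt0.
Qed.

Lemma cvg_mass_upper j l : (l < M)%N -> mass m (upper M j l) @[m --> \oo] --> (g l)^-1.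
Proof.
move=> lM; have gl := g_gt0 lM; have [E int] := integral_Y j gl.
under eq_fun do rewrite mass_upperE//.
have [] := @dominated_convergence _ _ _ PY setT measurableT
  (fun m t => (mesh_integral (mesh_size R m) (mesh_card m) (g l) (Y j t))%:E)
  (fun t => (Y j t / g l)%:E) (fun t => (Y j t / g l)%:E).
- by move=> m; apply/measurable_EFinP; case: (mesh_integral_bounded m j lM).
- by case/integrableP: int.
- apply: aeW => t _; apply/fine_cvgP; split; first exact: nearW.
  exact: cvg_mesh_integral.
- exact: int.
- apply: aeW => t m _; rewrite lee_fin ger0_norm ?mesh_integral_le ?mesh_size_gt0//.
  by rewrite mesh_integral_ge0// mesh_size_gt0.
by move=> _ _; rewrite E => /fine_cvgP[].
Qed.

(** A cell other than [cell0] has a positive level in some coordinate, so the sets [upper M j 0]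
    cover [S]. The bound is uniform in [m]. *)
Lemma mass_le m S : cell0 k M \notin S -> mass m S <= \sum_(j < k) (g 0%N)^-1.
Proof.
move=> S0; rewrite disc_mass_sum//.
have w0 e : 0 <= mass m [set e]%SET by exact/disc_mass_ge0/mesh_size_gt0.
apply: (@le_trans _ _ (\sum_(j < k) \sum_(e in upper M j 0) mass m [set e]%SET)); last first.
  by apply: ler_sum => j _; rewrite -disc_mass_sum//; exact: mass_upper_le.
under [X in _ <= X]eq_bigr do rewrite big_mkcond.
rewrite [X in _ <= X]exchange_big [X in X <= _]big_mkcond; apply: ler_sum => e _ /=.
case: ifP => [eS|_]; last by apply: sumr_ge0 => j _; case: ifP.
have [j ej] : exists j, (0 < e j)%N.
  apply: contrapT => h; move/negP: S0; apply; rewrite (_ : cell0 k M = e)//.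
  apply/ffunP => j; apply: val_inj; rewrite ffunE/=; apply/eqP; rewrite eq_sym -leqn0 leqNgt.
  by apply/negP => ej; apply: h; exists j.
rewrite (bigD1 j)//= inE ej lerDl; apply: sumr_ge0 => i _; by case: ifP.
Qed.

Lemma exponent_measure : exists Lam : cells -> R,
  [/\ forall e, 0 <= Lam e,
      forall j l, (l < M)%N -> \sum_(e in upper M j l) Lam e = (g l)^-1,
      forall S, cell0 k M \notin S ->
        Pr P [set t | forall i, ~~ hit g zeta Ys S i t] = expR (- \sum_(e in S) Lam e)
    & forall S, cell0 k M \notin S ->
        Pr P [set t | exists i i', [/\ i != i', hit g zeta Ys S i t & hit g zeta Ys S i' t]]
          <= (\sum_(e in S) Lam e) ^+ 2].
Proof.
pose C := \sum_(j < k) (g 0%N)^-1.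
pose U := (~: [set cell0 k M])%SET.
have U0 : cell0 k M \notin U by rewrite !inE eqxx.
have gfm S (S0 : cell0 k M \notin S) m c : 0 <= c <= 1 ->
    gf P (disc m S) c n @[n --> \oo] --> expR (- (c * mass m S)).
  by move=> c01; apply: cvg_Ex_disc => //; exact: mesh_size_gt0.
have uC n : \sum_(i < n) Pr P [set t | hit g zeta Ys U i t] <= C.
  apply: (@sum_Pr_hits_le _ _ _ _ (fun m => disc m U) (hit g zeta Ys U) (fun m => mass m U)).
  - by move=> m i; exact: measurable_disc_hit.
  - by move=> i; exact: measurable_hit.
  - by move=> i t; exact: disc_hit_near.
  - by move=> m c; exact: gfm.
  - by move=> m; exact: mass_le.
have key S : cell0 k M \notin S -> exists2 l, mass m S @[m --> \oo] --> l &
    forall c, 0 <= c <= 1 -> gf P (hit g zeta Ys S) c n @[n --> \oo] --> expR (- (c * l)).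
  move=> S0; apply: (@cvg_gf _ _ _ _ (fun m => disc m S) _ (hit g zeta Ys U) _ C).
  - by move=> m i; exact: measurable_disc_hit.
  - by move=> i; exact: measurable_hit.
  - by move=> i; exact: measurable_hit.
  - by move=> m i t; exact: disc_hit_neq0.
  - by move=> i t; exact: hit_neq0.
  - exact: uC.
  - by move=> i t; exact: disc_hit_near.
  - by move=> m c; exact: gfm.
  - by move=> m; exact: mass_le.
(* The exponent measure is infinite on [cell0]; the value 0 there is a convention, since no void or
   pair statement concerns a set containing [cell0]. *)
pose Lam (e : cells) := if e == cell0 k M then 0 else limn (fun m => mass m [set e]%SET).
have cvgLam e : e != cell0 k M -> mass m [set e]%SET @[m --> \oo] --> Lam e.
  move=> e0; have [l hl _] : exists2 l, mass m [set e]%SET @[m --> \oo] --> l & forall c, 0 <= c <= 1 -> gf P (hit g zeta Ys [set e]%SET) c n @[n --> \oo] --> expR (- (c * l)).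
    by apply: key; rewrite inE eq_sym.
  by rewrite /Lam (negbTE e0) (cvg_lim _ hl).
have cvgS S : cell0 k M \notin S -> mass m S @[m --> \oo] --> \sum_(e in S) Lam e.
  move=> S0; under eq_fun do rewrite disc_mass_sum//.
  by apply: cvg_sum => e eS; apply: cvgLam; apply: contraNneq S0 => <-.
have gfS S : cell0 k M \notin S -> forall c, 0 <= c <= 1 ->
    gf P (hit g zeta Ys S) c n @[n --> \oo] --> expR (- (c * \sum_(e in S) Lam e)).
  by move=> S0 c c01; have [l hl] := key S S0; rewrite -(cvg_unique _ hl (cvgS S S0))//; exact.
have Lam0 e : 0 <= Lam e.
  have [->|e0] := eqVneq e (cell0 k M); first by rewrite /Lam eqxx.
  apply: (cvgr_to_ge (cvgLam e e0)); apply: nearW => m.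
  exact/disc_mass_ge0/mesh_size_gt0.
exists Lam; split => //.
- move=> j l lM; have S0 : cell0 k M \notin upper M j l by rewrite inE ffunE.
  exact: (cvg_unique _ (cvgS _ S0) (cvg_mass_upper j lM)).
- move=> S S0; apply: Pr_no_hit; first by move=> i; exact: measurable_hit.
  by have := gfS S S0 1; rewrite mul1r; apply; rewrite ler01 lexx.
- move=> S S0; apply: Pr_pair_hit; last exact: gfS.
    by apply: sumr_ge0 => e _.
  by move=> i; exact: measurable_hit.
Qed.

End exponent_measure.

(** * Maximum domain of attraction *)

Lemma expectation_Ex (R : realType) d (T : measurableType d) (P : probability T R) (f : T -> R) :
  bounded_rv f -> 'E_P[f]%E = (Ex P f)%:E.
Proof. by move=> bf; rewrite -ExE// unlock. Qed.

Lemma Pr_ae_eq (R : realType) d (T : measurableType d) (P : probability T R) (A B : set T) :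
  measurable A -> measurable B -> {ae P, forall t, A t <-> B t} -> Pr P A = Pr P B.
Proof.
move=> mA mB h; rewrite -(@Ex_indic _ _ _ P A mA) -(@Ex_indic _ _ _ P B mB) /Ex /Rintegral; congr fine.
apply: ae_eq_integral => //.
- by apply/measurable_EFinP; case: (@bounded_rv_indic _ T R A mA).
- by apply/measurable_EFinP; case: (@bounded_rv_indic _ T R B mB).
apply: filterS h => t h _; congr (_%:R%:E); congr nat_of_bool.
by apply/asboolP/asboolP; apply h.
Qed.

(** * From convergence in law to orthant probabilities *)

Section portmanteau.
Variable R : realType.

Definition ramp (e x : R) : R := Num.min 1 (Num.max 0 (1 + x / e)).

Lemma ramp01 e x : 0 <= ramp e x <= 1.
Proof. by rewrite /ramp ge_min lexx/= le_min ler01 le_max lexx. Qed.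

Lemma ramp1 e x : 0 < e -> 0 <= x -> ramp e x = 1.
Proof.
move=> e0 x0; rewrite /ramp; apply/min_idPl.
by rewrite le_max lerDl divr_ge0 ?orbT// ltW.
Qed.

Lemma ramp0 e x : 0 < e -> x <= - e -> ramp e x = 0.
Proof.
move=> e0 xe; rewrite /ramp (max_idPl _); first by apply/min_idPr.
by rewrite -lerBrDl sub0r ler_pdivrMr// mulN1r.
Qed.

Lemma continuous_ramp (E : topologicalType) (e : R) (f : E -> R) : continuous f ->
  continuous (fun w => ramp e (f w)).
Proof.
move=> cf w; apply: (@continuous_min R E (fun=> 1) (fun w => Num.max 0 (1 + f w / e))).
  exact: cvg_cst.
apply: (@continuous_max R E (fun=> 0) (fun w => 1 + f w / e)); first exact: cvg_cst.
apply: (@cvgD _ R^o); first exact: cvg_cst.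
by apply: cvgM; [exact: cf|exact: cvg_cst].
Qed.

Variables (k : nat) (J : pred 'I_k).
Implicit Types (u e : 'I_k -> R).

(** For positive [e], a continuous function between the indicators of the orthants at [u] and at
    [u + e]. Only the coordinates in [J] are constrained, because a cell coordinate at the top level
    has no upper threshold. *)
Definition orthant_ramp u e (w : 'rV[R]_k) : R := \prod_(j < k | J j) ramp (e j) (u j - w ord0 j).

Lemma continuous_orthant_ramp u e : continuous (orthant_ramp u e).
Proof.
have c (j : 'I_k) : continuous (fun w : 'rV[R]_k => ramp (e j) (u j - w ord0 j)).
  apply: continuous_ramp => w; apply: continuousB; first exact: cst_continuous.
  exact: coord_continuous.
rewrite /orthant_ramp; elim: (index_enum _) => [|j r IH].
  rewrite (_ : (fun w => _) = (fun=> 1)); first exact: cst_continuous.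
  by apply/funext => w; rewrite big_nil.
rewrite (_ : (fun w => _) = (fun w : 'rV[R]_k => (if J j then ramp (e j) (u j - w ord0 j) else 1) *
    \prod_(i <- r | J i) ramp (e i) (u i - w ord0 i))).
  move=> w; apply: continuousM; last exact: IH.
  by case: (J j); [exact: c|exact: cst_continuous].
by apply/funext => w; rewrite big_cons; case: (J j); rewrite ?mul1r.
Qed.

Lemma orthant_ramp01 u e w : 0 <= orthant_ramp u e w <= 1.
Proof.
apply/andP; split; first by apply: prodr_ge0 => j _; case/andP: (ramp01 (e j) (u j - w ord0 j)).
by apply: prodr_ile1 => j _; exact: ramp01.
Qed.

Lemma orthant_ramp1 u e (w : 'rV[R]_k) : (forall j, 0 < e j) -> (forall j, J j -> w ord0 j <= u j) ->
  orthant_ramp u e w = 1.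
Proof. by move=> e0 h; apply: big1 => j Jj; rewrite ramp1// subr_ge0 h. Qed.

Lemma orthant_ramp0 u e (w : 'rV[R]_k) j : (forall j, 0 < e j) -> J j -> u j + e j <= w ord0 j ->
  orthant_ramp u e w = 0.
Proof.
move=> e0 Jj h; rewrite /orthant_ramp (bigD1 j)//= ramp0 ?mul0r//.
by rewrite lerBlDr addrC -lerBlDr opprK.
Qed.

Context d (T : measurableType d) (P : probability T R) d' (T' : measurableType d') (P' : probability T' R).
Variables (W : nat -> T -> 'rV[R]_k) (Z : T' -> 'rV[R]_k).
Hypothesis mW : forall n j, measurable_fun setT (fun t => W n t ord0 j).
Hypothesis mZ : forall j, measurable_fun setT (fun t => Z t ord0 j).
Hypothesis hWZ : cvg_in_law P W P' Z.

Definition orthant u (w : 'rV[R]_k) : Prop := forall j, J j -> w ord0 j <= u j.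

Lemma measurable_orthant d1 (T1 : measurableType d1) (V : T1 -> 'rV[R]_k) u :
  (forall j, measurable_fun setT (fun t => V t ord0 j)) -> measurable [set t | orthant u (V t)].
Proof.
move=> mV; have sM := @measurable_sigma_algebra _ T1.
apply: (sigma_algebra_forall_fin sM) => j; case: (boolP (J j)) => Jj; last first.
  have := sigma_algebra_cst sM True; congr (measurable _).
  by apply/seteqP; split.
have := mV j measurableT _ (measurable_itv `]-oo, u j]); rewrite setTI.
congr (measurable _); apply/seteqP; split => t /=; rewrite in_itv/= => h; first by [].
exact: h.
Qed.

Lemma bounded_orthant_ramp d1 (T1 : measurableType d1) (V : T1 -> 'rV[R]_k) u e :
  (forall j, measurable_fun setT (fun t => V t ord0 j)) -> (forall j, 0 < e j) ->
  bounded_rv (fun t => orthant_ramp u e (V t)).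
Proof.
move=> mV e0; apply: bounded_rv_prod => j _; split; last first.
  by exists 1 => t; have /andP[? ?] := ramp01 (e j) (u j - V t ord0 j); rewrite ger0_norm.
have m : measurable_fun setT (fun t => u j - V t ord0 j).
  by apply: measurable_funB; [exact: measurable_cst|exact: mV].
apply: (measurableT_comp (f := ramp (e j))) => //.
apply: nondecreasing_measurable => // x y xy; rewrite /ramp.
have h : 1 + x / e j <= 1 + y / e j by rewrite lerD2l ler_wpM2r// invr_ge0 ltW.
by rewrite le_min !ge_min lexx/= ge_max !le_max lexx/= h !orbT.
Qed.

Lemma cvg_Ex_orthant_ramp u e : (forall j, 0 < e j) ->
  Ex P (fun t => orthant_ramp u e (W n t)) @[n --> \oo] --> Ex P' (fun t => orthant_ramp u e (Z t)).
Proof.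
move=> e0; have := hWZ (@continuous_orthant_ramp u e).
have bd : exists M, forall w, `|orthant_ramp u e w| <= M.
  by exists 1 => w; have /andP[? ?] := orthant_ramp01 u e w; rewrite ger0_norm.
move=> /(_ bd); rewrite expectation_Ex; last by apply: bounded_orthant_ramp.
rewrite (_ : (fun n => 'E_P[_]%E) = (fun n => (Ex P (fun t => orthant_ramp u e (W n t)))%:E)); last first.
  by apply/funext => n; rewrite expectation_Ex//; exact: bounded_orthant_ramp.
by move=> /fine_cvgP[].
Qed.

(** The orthant indicator is squeezed between the ramps at [u - e] and at [u]; under the limit law
    the two differ from it only when some coordinate in [J] lies within [e j] of [u j]. *)
Lemma cvg_orthant u :
  (forall j (c : R), J j -> 0 < c -> exists2 x : R, 0 < x &
     Pr P' [set t | u j - x < Z t ord0 j < u j + x] <= c) ->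
  Pr P [set t | orthant u (W n t)] @[n --> \oo] --> Pr P' [set t | orthant u (Z t)].
Proof.
move=> small; apply/cvgrPdist_le => c c0.
(* Half of [c] is shared among at most [k] coordinates, the other half is left for the convergence;
   [k.+1] avoids dividing by 0. *)
pose c' := c / (2%:R * k.+1%:R).
have c'0 : 0 < c' by rewrite divr_gt0// mulr_gt0.
have [e he] : exists e : 'I_k -> R, forall j, 0 < e j /\
    (J j -> Pr P' [set t | u j - e j < Z t ord0 j < u j + e j] <= c').
  have /choice[e he] : forall j : 'I_k, exists x : R, 0 < x /\
      (J j -> Pr P' [set t | u j - x < Z t ord0 j < u j + x] <= c').
    move=> j; case: (boolP (J j)) => Jj; last by exists 1; split.
    by have [e e0 h] := small j c' Jj c'0; exists e.
  by exists e.
have e0 j : 0 < e j by case: (he j).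
pose N := [set t | exists2 j, j \in enum J & [set t | u j - e j < Z t ord0 j < u j + e j] t].
have mD j : measurable [set t | u j - e j < Z t ord0 j < u j + e j].
  have := @mZ j measurableT _ (measurable_itv `]u j - e j, u j + e j[); rewrite setTI.
  by congr (measurable _); apply/seteqP; split => t /=; rewrite in_itv/=.
have mN : measurable N.
  have sM := @measurable_sigma_algebra _ T'.
  have := sigma_algebra_exists_fin sM (fun j => sigma_algebra_and sM (sigma_algebra_cst sM (j \in enum J)) (mD j)).
  by congr (measurable _); apply/seteqP; split => t /= [j]; [case=> ? ?|move=> ? ?]; exists j.
have PN : Pr P' N <= c / 2%:R.
  apply: le_trans (Pr_exists P' _ mD) _.
  apply: (@le_trans _ _ (\sum_(j <- enum J) c')).
    rewrite big_seq [X in _ <= X]big_seq; apply: ler_sum => j; rewrite mem_enum => Jj.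
    by case: (he j) => _; exact.
  rewrite big_const_seq count_predT iter_addr_0 -[X in X <= _]mulr_natl.
  have sk : (size (enum J))%:R <= k.+1%:R :> R.
    by rewrite ler_nat -cardE (leq_trans (max_card _))// card_ord.
  apply: (@le_trans _ _ (k.+1%:R * c')); first by apply: ler_wpM2r => //; exact: ltW.
  have k0 : k.+1%:R != 0 :> R by rewrite pnatr_eq0.
  by rewrite le_eqVlt; apply/orP; left; apply/eqP; rewrite /c'; field.
have mOZ := measurable_orthant u mZ.
have mOW n := measurable_orthant u (mW n).
pose u' j := u j - e j.
have up : Ex P' (fun t => orthant_ramp u e (Z t)) <= Pr P' [set t | orthant u (Z t)] + c / 2%:R.
  apply: (@le_trans _ _ (Pr P' ([set t | orthant u (Z t)] `|` N))); last first.
    by apply: le_trans (Pr_setU P' mOZ mN) _; rewrite lerD2l.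
  rewrite -(@Ex_indic _ _ _ P' ([set t | orthant u (Z t)] `|` N)); last exact: measurableU.
  apply: Ex_le; [exact: bounded_orthant_ramp|by apply: bounded_rv_indic; exact: measurableU|move=> t].
  have /andP[r0 r1] := orthant_ramp01 u e (Z t).
  case: asboolP => [_//|nU].
  have [j Jj uj] : exists2 j, J j & u j < Z t ord0 j.
    apply: contrapT => h; apply: nU; left => j Jj; rewrite leNgt; apply/negP => uj.
    by apply: h; exists j.
  rewrite (@orthant_ramp0 u e _ j)// leNgt; apply/negP => h; apply: nU; right.
  exists j; first by rewrite mem_enum.
  by rewrite /= h andbT (lt_trans _ uj)// ltrBlDr ltrDl.
have lo : Pr P' [set t | orthant u (Z t)] - c / 2%:R <= Ex P' (fun t => orthant_ramp u' e (Z t)).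
  rewrite lerBlDr; apply: (@le_trans _ _ (Ex P' (fun t => orthant_ramp u' e (Z t)) + Pr P' N)); last first.
    by rewrite lerD2l.
  rewrite -(Ex_indic P' mN) -(Ex_indic P' mOZ) -ExD; [|exact: bounded_orthant_ramp|exact: bounded_rv_indic].
  apply: Ex_le; [exact: bounded_rv_indic|by apply: bounded_rvD; [exact: bounded_orthant_ramp|exact: bounded_rv_indic]|move=> t].
  have /andP[r0 r1] := orthant_ramp01 u' e (Z t).
  case: (asboolP (orthant u (Z t))) => [Ot|nO]; last by rewrite addr_ge0.
  case: (asboolP (N t)) => [_|nN]; first by rewrite lerDr.
  rewrite orthant_ramp1// ?lerDl// => j Jj; rewrite leNgt; apply/negP => h; apply: nN.
  exists j; first by rewrite mem_enum.
  by rewrite /= h (le_lt_trans (Ot j Jj))// ltrDl.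
have hu := @cvg_Ex_orthant_ramp u e e0.
have hl := @cvg_Ex_orthant_ramp u' e e0.
have c2 : 0 < c / 2%:R by rewrite divr_gt0.
near=> n.
have h1 : Pr P [set t | orthant u (W n t)] <= Ex P (fun t => orthant_ramp u e (W n t)).
  rewrite -(Ex_indic P (mOW n)); apply: Ex_le; [exact: bounded_rv_indic|exact: bounded_orthant_ramp|move=> t].
  case: asboolP => [Ot|_]; last by case/andP: (orthant_ramp01 u e (W n t)).
  by rewrite orthant_ramp1.
have h2 : Ex P (fun t => orthant_ramp u' e (W n t)) <= Pr P [set t | orthant u (W n t)].
  rewrite -(Ex_indic P (mOW n)); apply: Ex_le; [exact: bounded_orthant_ramp|exact: bounded_rv_indic|move=> t].
  case: asboolP => [_|nO]; first by case/andP: (orthant_ramp01 u' e (W n t)).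
  have [j Jj uj] : exists2 j, J j & u j < W n t ord0 j.
    apply: contrapT => h; apply: nO => j Jj; rewrite leNgt; apply/negP => uj.
    by apply: h; exists j.
  by rewrite (@orthant_ramp0 u' e _ j)// /u' subrK ltW.
have h3 : `|Ex P' (fun t => orthant_ramp u e (Z t)) - Ex P (fun t => orthant_ramp u e (W n t))| <= c / 2%:R.
  by near: n; exact: ((cvgrPdist_le _ _).1 hu _ c2).
have h4 : `|Ex P' (fun t => orthant_ramp u' e (Z t)) - Ex P (fun t => orthant_ramp u' e (W n t))| <= c / 2%:R.
  by near: n; exact: ((cvgrPdist_le _ _).1 hl _ c2).
move: h3 h4; rewrite !ler_norml => /andP[h3 h3'] /andP[h4 h4'].
apply/andP; split; lra.
Unshelve. all: by end_near. Qed.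

End portmanteau.

(** Inclusions are the events that Moebius inversion on patterns requires; this turns them into void
    events of a set avoiding [cell0]. *)
Lemma occupied_subset (k M : nat) (I : Type) (c : I -> cellT k M) (A : {set cellT k M}) :
  (occupied c \subset A) <-> forall i, c i \notin (~: A :\ cell0 k M)%SET.
Proof.
split=> [/fintype.subsetP h i|h].
  rewrite !inE negb_and !negbK; have [//|ci] := eqVneq (c i) (cell0 k M).
  by apply: h; rewrite inE ci; apply/asboolP; exists i.
apply/fintype.subsetP => e; rewrite inE => /andP[e0 /asboolP[i ie]].
by have := h i; rewrite ie !inE e0/= negbK.
Qed.

Lemma cvg_pattern (R : realType) (D : finType) d (T : measurableType d) (P : probability T R)
    d' (T' : measurableType d') (P' : probability T' R) (A : nat -> T -> {set D}) (A' : T' -> {set D}) :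
  (forall n, fibers_in measurable (A n)) -> fibers_in measurable A' ->
  (forall B : {set D}, Pr P [set t | A n t \subset B] @[n --> \oo] --> Pr P' [set t | A' t \subset B]) ->
  forall Q : pred {set D}, Pr P [set t | Q (A n t)] @[n --> \oo] --> Pr P' [set t | Q (A' t)].
Proof.
move=> mA mA' h Q; rewrite Pr_sum_fibers//; under eq_fun do rewrite Pr_sum_fibers//.
apply: cvg_sum => B _; move: B.
apply: (@cvg_moebius R _ (fun B C : {set D} => B \subset C) (fun B : {set D} => #|B|)
  (fun n B => Pr P [set t | A n t = B]) (fun B => Pr P' [set t | A' t = B])).
- by move=> B; exact: fintype.subxx.
- by move=> B C BC nBC; apply: proper_card; rewrite finset.properEneq nBC.
- move=> B; rewrite -(Pr_sum_fibers P' (fun C : {set D} => C \subset B))//.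
  by under eq_fun do rewrite -(Pr_sum_fibers P (fun C : {set D} => C \subset B))//; exact: h.
Qed.

(** * Asymptotic rates of the sample in cells *)

Section sample_cells.
Variables (R : realType) (k M : nat) (g : nat -> R).
Hypothesis g_mono : forall l l', (l <= l' < M)%N -> g l <= g l'.
Context d (T : measurableType d) (P : probability T R).
Context d0 (T0 : measurableType d0) (P0 : probability T0 R).
Variables (V : 'I_k -> T0 -> R) (Vs : nat -> 'I_k -> {RV P >-> R}).
Hypothesis hVs : independent_copies P Vs P0 V.
Variables (a b : nat -> 'I_k -> R).

Notation cells := (cellT k M).
Implicit Types (S : {set cells}).

Definition sample_cell n i t : cells := cell M g (fun j => (Vs i j t - b n j) / a n j).

Lemma measurable_affine (x y : R) (B : set R) : measurable B ->
  measurable ((fun v : R => (v - x) / y) @^-1` B).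
Proof.
move=> mB; rewrite -[X in measurable X]setTI.
have m : measurable_fun setT (fun v : R => (v - x) / y).
  apply: measurable_funM; last exact: measurable_cst.
  by apply: measurable_funB; [exact: measurable_id|exact: measurable_cst].
exact: m measurableT _ mB.
Qed.

Lemma sample_cell_event (F : set (set T)) n i S : sigma_algebra setT F -> sigma_family (Vs i) `<=` F ->
  F [set t | sample_cell n i t \in S].
Proof.
move=> sF VF; apply: (fibers_in_pred sF (fun e => e \in S)).
apply: (fibers_cell g_mono sF) => j B mB; apply: VF.
exact: (@sigma_family_preimage _ _ _ _ (fun j => Vs i j : T -> R) j _ (measurable_affine (b n j) (a n j) mB)).
Qed.

Lemma measurable_sample_cell n i S : measurable [set t | sample_cell n i t \in S].
Proof. by apply: sample_cell_event; [exact: measurable_sigma_algebra|exact: sigma_family_measurable]. Qed.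

Definition cell_rate n S := Pr P [set t | sample_cell n 0 t \in S].

Lemma cell_rateE n i S : Pr P [set t | sample_cell n i t \in S] = cell_rate n S.
Proof.
pose A := [set p : 'I_k -> R | cell M g (fun j => (p j - b n j) / a n j) \in S].
have sA : sigma_family (fun j (p : 'I_k -> R) => p j) A.
  have sF := @sigma_family_sigma_algebra _ R 'I_k _ (fun j (p : 'I_k -> R) => p j).
  apply: (fibers_in_pred sF (fun e => e \in S)).
  apply: (fibers_cell g_mono sF) => j B mB.
  exact: (sigma_family_preimage (X := fun j (p : 'I_k -> R) => p j) j (measurable_affine (b n j) (a n j) mB)).
rewrite /cell_rate (independent_copies_law (A := A) i hVs sA).
by rewrite (independent_copies_law (A := A) 0%N hVs sA).
Qed.

Lemma cell_rate01 n S : 0 <= cell_rate n S <= 1.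
Proof. by rewrite Pr_ge0 Pr_le1//; exact: measurable_sample_cell. Qed.

Lemma Pr_sample_cells n S (r : seq nat) : uniq r ->
  Pr P [set t | forall i, i \in r -> sample_cell n i t \in S] = cell_rate n S ^+ size r.
Proof.
move=> ur; rewrite (independent_classesP (A := fun i => [set t | sample_cell n i t \in S]) hVs.2 ur).
- under eq_bigr do rewrite cell_rateE.
  by rewrite big_const_seq count_predT iter_mulr_1.
- by move=> i _; apply: sample_cell_event => //; exact: sigma_family_sigma_algebra.
- by move=> i; exact: measurable_sample_cell.
Qed.

Lemma Pr_all_sample_cells n S :
  Pr P [set t | forall i : 'I_n, sample_cell n i t \in S] = cell_rate n S ^+ n.
Proof.
rewrite -[X in _ ^+ X](size_iota 0 n) -Pr_sample_cells ?iota_uniq//; congr Pr.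
apply/seteqP; split => t /= h i; first by rewrite mem_iota add0n => ilt; exact: (h (Ordinal ilt)).
by apply: h; rewrite mem_iota add0n/=.
Qed.

Lemma cell_rateC n S : cell_rate n (~: S)%SET = 1 - cell_rate n S.
Proof.
rewrite -Pr_setC; last exact: measurable_sample_cell.
by congr Pr; apply/seteqP; split => t /=; rewrite inE => /negP.
Qed.

Lemma cell_rate_sum n S : cell_rate n S = \sum_(e in S) cell_rate n [set e]%SET.
Proof.
rewrite /cell_rate Pr_sum_fibers.
  by apply: eq_bigr => e _; congr Pr; apply/seteqP; split => t /=; rewrite inE => /eqP.
move=> e; have := measurable_sample_cell n 0 [set e]%SET; congr (measurable _).
by apply/seteqP; split => t /=; rewrite inE => /eqP.
Qed.

Variable Lam : cells -> R.

Definition cell_le (e f : cells) : bool := [forall j, (e j <= f j)%N].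

Hypothesis hmax : forall f, Pr P [set t | forall i : 'I_n, cell_le (sample_cell n i t) f] @[n --> \oo]
  --> expR (- \sum_(e | ~~ cell_le e f) Lam e).

(** All cells of the sample lie below [f] with probability the [n]-th power of that of a lower set,
    and [n] times one minus this base is the rate of the complement, which avoids [cell0]. *)
Lemma cvg_rate_not_le f : n%:R * \sum_(e | ~~ cell_le e f) cell_rate n [set e]%SET @[n --> \oo] -->
  \sum_(e | ~~ cell_le e f) Lam e.
Proof.
pose S := [set e | cell_le e f]%SET.
have E n : \sum_(e | ~~ cell_le e f) cell_rate n [set e]%SET = 1 - cell_rate n S.
  by rewrite -cell_rateC cell_rate_sum; apply: eq_bigl => e; rewrite !inE.
under eq_fun do rewrite E.
apply: cvg_complement_of_cvg_pow; first by move=> n; exact: cell_rate01.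
have := @hmax f; apply: cvg_trans; apply: near_eq_cvg; apply: nearW => n /=.
rewrite -Pr_all_sample_cells; congr Pr.
by apply/seteqP; split => t /= h i; have := h i; rewrite inE.
Qed.

Lemma cvg_rate_cell e : e != cell0 k M -> n%:R * cell_rate n [set e]%SET @[n --> \oo] --> Lam e.
Proof.
move=> e0.
(* Both functions vanish at [cell0] by convention, because [n] times its probability diverges. *)
pose w n (f : cells) := if f == cell0 k M then 0 else n%:R * cell_rate n [set f]%SET.
pose w' (f : cells) := if f == cell0 k M then 0 else Lam f.
have le0 f : cell_le (cell0 k M) f by apply/forallP => j; rewrite ffunE.
have le0E f : cell_le f (cell0 k M) = (f == cell0 k M).
  apply/forallP/eqP => [h|-> j //]; apply/ffunP => j; apply: val_inj; rewrite ffunE/=.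
  by apply/eqP; have := h j; rewrite ffunE leqn0.
(* A lower sum without [cell0] is the difference of two complements: the cells not below [cell0]
   minus those not below [f]. *)
have split_le (v : cells -> R) f : \sum_(e | cell_le e f) (if e == cell0 k M then 0 else v e) =
    \sum_(e | ~~ cell_le e (cell0 k M)) v e - \sum_(e | ~~ cell_le e f) v e.
  rewrite (bigID (fun e => cell_le e f) (fun e => ~~ cell_le e (cell0 k M)))/=.
  rewrite [X in _ = _ + X - _](_ : _ = \sum_(e | ~~ cell_le e f) v e); last first.
    apply: eq_bigl => e'; rewrite andbC le0E; case: (boolP (cell_le e' f)) => //= nle.
    by apply: contraNneq nle => ->.
  rewrite addrK [RHS]big_mkcond [LHS]big_mkcond; apply: eq_bigr => e' _.
  by rewrite le0E; case: (e' == _); case: (cell_le _ _).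
have := @cvg_moebius R cells cell_le (fun f => \sum_j (f j : nat))%N w w' _ _ _ e.
rewrite /w /w' (negbTE e0); apply.
- by move=> f; apply/forallP.
- move=> f1 f2 /forallP f12 n12.
  rewrite ltn_neqAle leq_sum ?andbT//; apply: contra n12 => /eqP E.
  apply/eqP/ffunP => j; apply: val_inj; apply/eqP; rewrite eqn_leq f12 /=.
  move: E; rewrite (bigD1 j)//= [RHS](bigD1 j)//= => E.
  have hs : (\sum_(i < k | i != j) f1 i <= \sum_(i < k | i != j) f2 i)%N by apply: leq_sum.
  by rewrite leqNgt; apply/negP => lt; have := leq_add lt hs; rewrite addSn E ltnn.
- move=> f; rewrite split_le.
  under eq_fun do rewrite split_le -!mulr_sumr.
  by apply: cvgB; exact: cvg_rate_not_le.
Qed.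

Lemma cvg_rate S : cell0 k M \notin S -> n%:R * cell_rate n S @[n --> \oo] --> \sum_(e in S) Lam e.
Proof.
move=> S0; under eq_fun do rewrite cell_rate_sum mulr_sumr.
by apply: cvg_sum => e eS; apply: cvg_rate_cell; apply: contraNneq S0 => <-.
Qed.

Lemma cvg_sample_void S : cell0 k M \notin S ->
  Pr P [set t | forall i : 'I_n, sample_cell n i t \notin S] @[n --> \oo] --> expR (- \sum_(e in S) Lam e).
Proof.
move=> S0.
have : cell_rate n (~: S)%SET ^+ n @[n --> \oo] --> expR (- \sum_(e in S) Lam e).
  apply: cvg_pow_of_cvg_complement; first by move=> n; exact: cell_rate01.
  by under eq_fun do rewrite cell_rateC subKr; exact: cvg_rate.
apply: cvg_trans; apply: near_eq_cvg; apply: nearW => n.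
rewrite -Pr_all_sample_cells; congr Pr.
by apply/seteqP; split => t /= h i; have := h i; rewrite inE.
Qed.

(** Union bound over [n ^ 2] ordered pairs; off the diagonal independence gives each the square of
    the cell probability. *)
Lemma Pr_sample_pair n S :
  Pr P [set t | exists i i' : 'I_n, [/\ i != i', sample_cell n i t \in S & sample_cell n i' t \in S]]
  <= (n%:R * cell_rate n S) ^+ 2.
Proof.
pose A (p : 'I_n * 'I_n) := [set t | p.1 != p.2 /\ (sample_cell n p.1 t \in S /\ sample_cell n p.2 t \in S)].
have sM := @measurable_sigma_algebra _ T.
have mA p : measurable (A p).
  apply: (sigma_algebra_and sM (sigma_algebra_cst sM _)).
  by apply: (sigma_algebra_and sM); exact: measurable_sample_cell.
rewrite (_ : [set t | _] = [set t | exists2 p, p \in enum {: 'I_n * 'I_n} & A p t]); last first.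
  apply/seteqP; split => t /=.
    by move=> [i [i' [? ? ?]]]; exists (i, i'); rewrite ?mem_enum.
  by move=> [[i i'] _ [? [? ?]]]; exists i, i'.
apply: le_trans (Pr_exists P _ mA) _.
apply: (@le_trans _ _ (\sum_(p <- enum {: 'I_n * 'I_n}) cell_rate n S ^+ 2)).
  apply: ler_sum => -[i i'] _.
  have [ii|ii] := eqVneq i i'.
    rewrite /Pr (_ : A (i, i') = set0) ?measure0 ?sqr_ge0//.
    by apply/seteqP; split => t //= [/eqP].
  have u2 : uniq [:: (i : nat); (i' : nat)] by rewrite /= inE andbT; exact: ii.
  rewrite -[X in _ ^+ X]/(size [:: (i : nat); (i' : nat)]) -Pr_sample_cells//.
  apply: Pr_le => //.
    have := mA (i, i'); congr (measurable _); apply/seteqP; split => t /=.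
      by move=> [_ [h1 h2]] j; rewrite !inE => /orP[] /eqP ->.
    by move=> h; split=> //; split; apply: h; rewrite !inE eqxx ?orbT.
  by move=> t [_ [h1 h2]] j; rewrite !inE => /orP[] /eqP ->.
rewrite big_const_seq count_predT iter_addr_0 -cardE card_prod card_ord.
by rewrite exprMn -natrX mulr_natl -mulnn.
Qed.

End sample_cells.

(** * Convergence of hitting scenarios *)

(* [1 / g] runs through equally spaced levels, so that every slab gets the same mass. *)
Lemma fine_grid (R : realType) (k : nat) (c : R) : 0 < c ->
  exists M, exists g : nat -> R,
  [/\ (0 < M)%N, forall l l', (l <= l' < M)%N -> g l <= g l', forall l, (l < M)%N -> 0 < g l
    & \sum_(j < k) (expR (- (g 0%N)^-1) +
        \sum_(l < M) ((g l)^-1 - (if (l.+1 < M)%N then (g l.+1)^-1 else 0)) ^+ 2) <= c].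
Proof.
move=> c0.
have [m mc] : exists m : nat, 2%:R * k%:R / c < m.+1%:R :> R.
  have /filter_ex[m h] := nbhs_infty_gtr (2%:R * k%:R / c).
  by exists m; apply: lt_trans h _; rewrite ltr_nat.
pose x : R := m.+1%:R.
have x0 : 0 < x by rewrite ltr0n.
(* [x ^ 3] levels of mass [x ^- 2] each start from the total mass [x]. Missing the lowest level then
   costs [expR (- x) <= x^-1], and the slabs cost [x ^ 3 * x ^- 4 = x^-1], so [2 * k / x <= c]
   suffices. *)
have [M ME] : exists M, M = (m.+1 ^ 3)%N by exists (m.+1 ^ 3)%N.
pose dl : R := (x ^+ 2)^-1.
have dl0 : 0 < dl by rewrite invr_gt0 exprn_gt0.
have M0 : (0 < M)%N by rewrite ME expn_gt0.
pose g l : R := ((M - l)%:R * dl)^-1.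
have gV l : (g l)^-1 = (M - l)%:R * dl by rewrite invrK.
exists M, g; split => //.
- move=> l l' /andP[ll' l'M].
  have h' : 0 < (M - l')%:R * dl by rewrite mulr_gt0// ltr0n subn_gt0.
  have h : (M - l')%:R * dl <= (M - l)%:R * dl by apply: ler_wpM2r; [exact: ltW|rewrite ler_nat leq_sub2l].
  by rewrite lef_pV2 ?posrE// (lt_le_trans h').
- by move=> l lM; rewrite invr_gt0 mulr_gt0// ltr0n subn_gt0.
have E (l : 'I_M) : ((g l)^-1 - (if (l.+1 < M)%N then (g l.+1)^-1 else 0)) ^+ 2 = dl ^+ 2.
  congr (_ ^+ 2); rewrite !gV; case: ltnP => lM.
    have e : (M - l - (M - l.+1) = 1)%N by lia.
    by rewrite -mulrBl -natrB ?leq_sub2l// e mul1r.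
  have e : (M - l = 1)%N by have := ltn_ord l; lia.
  by rewrite subr0 e mul1r.
under eq_bigr do under eq_bigr do rewrite E.
rewrite !sumr_const !card_ord gV subn0.
have Mx : M%:R = x ^+ 3 by rewrite ME natrX.
have -> : M%:R * dl = x by rewrite Mx /dl; field; rewrite gt_eqF.
have -> : dl ^+ 2 *+ M = x^-1 by rewrite -mulr_natl Mx /dl; field; rewrite gt_eqF.
have e1 : expR (- x) <= x^-1.
  rewrite expRN lef_pV2 ?posrE ?expR_gt0//.
  by apply: le_trans (expR_ge1Dx x); rewrite lerDr.
rewrite -mulr_natl.
apply: (@le_trans _ _ (k%:R * (x^-1 + x^-1))).
  by apply: ler_wpM2l => //; rewrite lerD2r.
rewrite -mulr2n -[x^-1 *+ 2]mulr_natl mulrA ler_pdivrMr// mulrC.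
move: mc; rewrite -/x ltr_pdivrMr// => /ltW; rewrite [c * x]mulrC.
exact.
Qed.

(** * Exceptional events of a grid *)

Section separation.
Variables (R : realType) (k M : nat) (g : nat -> R).

(** Failure of separation as a finite union over coordinates and levels, ready for the union bound.
    The index type is ['I_n] for the sample and [nat] for the Poisson process. *)
Definition unseparated (I : eqType) (c : I -> cellT k M) : Prop :=
  (exists j, forall i, c i \notin upper M j 0) \/
  (exists j, exists l : 'I_M, exists i i', [/\ i != i', c i \in slab M j l.+1 & c i' \in slab M j l.+1]).

Lemma separatedP (I : eqType) (x : I -> 'I_k -> R) :
  ~ unseparated (fun i => cell M g (x i)) -> separated M g x.
Proof.
move=> h; split=> [j|j i i' ipos ii'].
  apply: contrapT => hj; apply: h; left; exists j => i; rewrite inE.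
  by apply/negP => hi; apply: hj; exists i.
apply: contrapT => /eqP ne; apply: h; right; exists j.
case E : (nat_of_ord (cell M g (x i) j)) ipos => [//|l] _.
have lM : (l < M)%N by rewrite -ltnS -E ltn_ord.
by exists (Ordinal lM), i, i'; split; rewrite ?inE -?ii' ?E//=.
Qed.

Lemma sum_slab (Lam : cellT k M -> R) j (l : 'I_M) :
  (forall j l, (l < M)%N -> \sum_(e in upper M j l) Lam e = (g l)^-1) ->
  \sum_(e in slab M j l.+1) Lam e = (g l)^-1 - (if (l.+1 < M)%N then (g l.+1)^-1 else 0).
Proof.
move=> hup; rewrite -(hup j l (ltn_ord l)).
(* A slab is the difference of two consecutive upper sets; above the last threshold the second one
   is empty. *)
have -> : (if (l.+1 < M)%N then (g l.+1)^-1 else 0) = \sum_(e in upper M j l.+1) Lam e.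
  case: ltnP => [lM|Ml]; first by rewrite hup.
  rewrite big_pred0// => e; rewrite inE; apply/negbTE; rewrite -leqNgt.
  by apply: leq_trans Ml; rewrite -ltnS.
rewrite (bigID (mem (slab M j l.+1)) (mem (upper M j l)))/=.
rewrite [X in _ = _ + X - _](_ : _ = \sum_(e in upper M j l.+1) Lam e); last first.
  by apply: eq_bigl => e; rewrite !inE; lia.
rewrite addrK; apply: eq_bigl => e; rewrite !inE; lia.
Qed.

Lemma cell_leP (v : 'I_k -> R) (f : cellT k M) :
  (forall l l', (l <= l' < M)%N -> g l <= g l') ->
  cell_le (cell M g v) f <-> forall j, (f j < M)%N -> v j <= g (f j).
Proof.
move=> g_mono; split=> [/forallP h j fM|h]; last apply/forallP => j.
  by have := h j; rewrite cellE leqNgt (level_gtn g_mono)// -leNgt.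
rewrite cellE; case: (ltnP (f j) M) => fM; last exact: leq_trans (level_le _ _ _) fM.
by rewrite leqNgt (level_gtn g_mono)// -leNgt h.
Qed.

Context d (T : measurableType d) (P : probability T R).

Lemma Pr_unseparated (I : eqType) (c : T -> I -> cellT k M) :
  (forall j, measurable [set t | forall i, c t i \notin upper M j 0]) ->
  (forall j l, measurable [set t | exists i i', [/\ i != i', c t i \in slab M j l & c t i' \in slab M j l]]) ->
  measurable [set t | unseparated (c t)] /\
  Pr P [set t | unseparated (c t)] <=
    \sum_(j < k) (Pr P [set t | forall i, c t i \notin upper M j 0] +
      \sum_(l < M) Pr P [set t | exists i i', [/\ i != i', c t i \in slab M j l.+1 & c t i' \in slab M j l.+1]]).
Proof.
move=> mv mp; have sM := @measurable_sigma_algebra _ T.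
pose A1 := [set t | exists2 j, j \in index_enum 'I_k & [set t | forall i, c t i \notin upper M j 0] t].
pose B j (l : 'I_M) := [set t | exists i i', [/\ i != i', c t i \in slab M j l.+1 & c t i' \in slab M j l.+1]].
pose A2 := [set t | exists2 p, p \in index_enum ('I_k * 'I_M)%type & B p.1 p.2 t].
have mA1 : measurable A1.
  have := sigma_algebra_exists_fin sM mv; congr (measurable _); apply/seteqP.
  by split => t /= [j]; [exists j; rewrite ?mem_index_enum|move=> _ h; exists j].
have mA2 : measurable A2.
  have := sigma_algebra_exists_fin sM (fun p : 'I_k * 'I_M => mp p.1 p.2.+1); congr (measurable _).
  by apply/seteqP; split => t /= [p]; [exists p; rewrite ?mem_index_enum|move=> _ h; exists p].
have E : [set t | unseparated (c t)] = A1 `|` A2.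
  apply/seteqP; split => t /=.
    move=> [[j h]|[j [l h]]]; [left; exists j|right; exists (j, l)]; rewrite ?mem_index_enum//.
  by move=> [[j _ h]|[[j l] _ h]]; [left; exists j|right; exists j, l].
split; first by rewrite E; exact: measurableU.
rewrite E big_split/=; apply: le_trans (Pr_setU P mA1 mA2) _; apply: lerD.
  exact: Pr_exists.
apply: le_trans (Pr_exists P _ _) _; first by move=> p; exact: mp.
by rewrite pair_big/=.
Qed.

Lemma Pr_diff_le (A B N : set T) : measurable A -> measurable B -> measurable N ->
  (forall t, ~ N t -> (A t <-> B t)) -> `|Pr P A - Pr P B| <= Pr P N.
Proof.
move=> mA mB mN h; rewrite ler_norml; apply/andP; split.
  rewrite lerBrDl lerBlDr; apply: le_trans (Pr_setU P mA mN).
  apply: Pr_le => //; first exact: measurableU.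
  by move=> t Bt; have [Nt|nN] := pselect (N t); [right|left; apply/(h t nN)].
rewrite lerBlDl; apply: le_trans (Pr_setU P mB mN).
apply: Pr_le => //; first exact: measurableU.
by move=> t At; have [Nt|nN] := pselect (N t); [right|left; apply/(h t nN)].
Qed.

Lemma fibers_set (D : finType) (A : T -> {set D}) : (forall e, measurable [set t | e \in A t]) ->
  fibers_in measurable A.
Proof.
move=> mA B; have sM := @measurable_sigma_algebra _ T.
have : measurable [set t | forall e, (e \in A t) = (e \in B)].
  apply: (sigma_algebra_forall_fin sM) => e; case: (e \in B); first exact: mA.
  have := sigma_algebra_not sM (mA e); congr (measurable _).
  by apply/seteqP; split => t /= => [/negP/negbTE|->].
congr (measurable _); apply/seteqP; split => t /=; first by move=> h; apply/setP.
by move=> ->.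
Qed.

End separation.

Lemma independent_classes_sub (R : realType) d (T : measurableType d) (P : probability T R)
    (J : eqType) (F F' : J -> set (set T)) : (forall j, F' j `<=` F j) ->
  independent_classes P F -> independent_classes P F'.
Proof. by move=> sub h r A ur FA; apply: h => // j /FA; exact: sub. Qed.

Lemma measurable_le (R : realType) d (T : measurableType d) (f f' : T -> R) :
  measurable_fun setT f -> measurable_fun setT f' -> measurable [set t | f t <= f' t].
Proof.
move=> mf mf'; have m : measurable_fun setT (fun t => f t - f' t) by exact: measurable_funB.
have := m measurableT _ (measurable_itv `]-oo, 0]); rewrite setTI; congr (measurable _).
by apply/seteqP; split => t /=; rewrite in_itv/= subr_le0.
Qed.

(** * Distribution of the max-stable vector *)

Section max_stable_cells.
Context (R : realType) (S : topologicalType).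
Context dY (TY : measurableType dY) (PY : probability TY R) (Y : S -> {RV PY >-> R}).
Context d (T : measurableType d) (P : probability T R).
Variables (zeta : nat -> {RV P >-> R}) (Ys : nat -> S -> {RV P >-> R}) (eta : S -> {RV P >-> R}).
Hypothesis heta : simple_max_stable Y zeta Ys eta.
Variables (k : nat) (loc : 'I_k -> S).

Definition phi t i j : R := zeta i t * Ys i (loc j) t.

Lemma phi_exponent_measure (M : nat) (g : nat -> R) : (0 < M)%N ->
  (forall l l', (l <= l' < M)%N -> g l <= g l') -> (forall l, (l < M)%N -> 0 < g l) ->
  exists Lam : cellT k M -> R,
  [/\ forall e, 0 <= Lam e,
      forall j l, (l < M)%N -> \sum_(e in upper M j l) Lam e = (g l)^-1,
      forall A : {set cellT k M}, cell0 k M \notin A ->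
        Pr P [set t | forall i, cell M g (phi t i) \notin A] = expR (- \sum_(e in A) Lam e)
    & forall A : {set cellT k M}, cell0 k M \notin A ->
        Pr P [set t | exists i i', [/\ i != i', cell M g (phi t i) \in A & cell M g (phi t i') \in A]]
          <= (\sum_(e in A) Lam e) ^+ 2].
Proof.
move=> M0 g_mono g_pos; case: heta => -[Y0 _ EY _] hz [hYs _ Ys0 hind] _.
have mid (j : 'I_k) : measurable_fun setT (fun x : R => x) by exact: measurable_id.
apply: (@exponent_measure R k M g M0 g_mono g_pos _ T P _ TY PY (fun j => Y (loc j)) zeta
  (fun i j => Ys i (loc j))) => //.
  exact: (independent_copies_comp loc mid hYs).
apply: independent_classes_sub hind => -[]; first by [].
have := @sigma_family_comp_sub R (nat * S)%type (nat * 'I_k)%type T (fun q => Ys q.1 q.2 : T -> R)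
  (fun q => (q.1, loc q.2)) (fun=> id) (fun _ => @measurable_id _ R setT).
exact.
Qed.

Lemma eta_le_iff : {ae P, forall t, forall j x,
  eta (loc j) t <= x <-> forall i, phi t i j <= x}.
Proof.
case: heta => _ _ _; apply: filterS => t h j x; have [[i ei] le_eta] := h (loc j).
split=> [hx i'|hx]; first exact: le_trans (le_eta i') hx.
by rewrite ei; exact: hx.
Qed.

Lemma measurable_phi i j : measurable_fun setT (fun t => phi t i j).
Proof. exact: measurable_funM. Qed.

Lemma measurable_phi_le i j (x : R) : measurable [set t | phi t i j <= x].
Proof. by apply: measurable_le; [exact: measurable_phi|exact: measurable_cst]. Qed.

Lemma measurable_eta_le j (x : R) : measurable [set t | eta (loc j) t <= x].
Proof. by apply: measurable_le => //; exact: measurable_cst. Qed.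

(** The unit Frechet law, from a grid with the single threshold [x]: [eta] is at most [x] exactly
    when no point reaches the upper level, which has mass [x^-1]. *)
Lemma cdf_eta j (x : R) : 0 < x -> Pr P [set t | eta (loc j) t <= x] = expR (- x^-1).
Proof.
move=> x0; have sM := @measurable_sigma_algebra _ T.
have [Lam [_ hup hvoid _]] := @phi_exponent_measure 1 (fun=> x) isT (fun _ _ _ => lexx x) (fun _ _ => x0).
rewrite -(hup j 0%N isT) -hvoid; last by rewrite inE ffunE.
have E t : (forall i, cell 1 (fun=> x) (phi t i) \notin upper 1 j 0) <-> forall i, phi t i j <= x.
  by split=> h i; have := h i; rewrite inE cellE (@level_gtn _ 1 (fun=> x)) -?leNgt// => ? ? _; exact: lexx.
rewrite (_ : [set t | forall i, cell 1 _ _ \notin _] = [set t | forall i, phi t i j <= x]); last first.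
  by apply/seteqP; split => t /= /E.
apply: Pr_ae_eq; [exact: measurable_eta_le| |].
  by apply: (sigma_algebra_forall sM) => i; exact: measurable_phi_le.
by apply: filterS eta_le_iff => t h; exact: h.
Qed.

Lemma eta_small_interval j (x c : R) : 0 < x -> 0 < c ->
  exists2 e, 0 < e & Pr P [set t | x - e < eta (loc j) t < x + e] <= c.
Proof.
move=> x0 c0; pose G (y : R) := expR (- y^-1).
have cG : G y @[y --> x] --> G x.
  have cN : - y^-1 @[y --> x] --> - x^-1.
    by apply: cvgN; apply: cvgV; [rewrite gt_eqF|exact: cvg_id].
  exact: (cvg_comp _ _ cN (@continuous_expR R _)).
have c2 : 0 < c / 2%:R by rewrite divr_gt0.
have := (cvgrPdist_le _ _).1 cG _ c2.
move=> [r /= r0 hr].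
(* Halving makes [e] strictly smaller than both: the ends stay within the radius of continuity, and
   [x - e] stays positive. *)
pose e := Num.min r x / 2%:R.
have e0 : 0 < e by rewrite divr_gt0// lt_min r0 x0.
have er : e < r.
  rewrite /e ltr_pdivrMr//; apply: (@le_lt_trans _ _ r); first by rewrite ge_min lexx.
  by rewrite ltr_pMr// ltr1n.
have ex : e < x.
  rewrite /e ltr_pdivrMr//; apply: (@le_lt_trans _ _ x); first by rewrite ge_min lexx orbT.
  by rewrite ltr_pMr// ltr1n.
exists e => //.
have h1 : `|G x - G (x + e)| <= c / 2%:R.
  by apply: hr; rewrite /= opprD addrA subrr sub0r normrN ger0_norm// ltW.
have h2 : `|G x - G (x - e)| <= c / 2%:R.
  by apply: hr; rewrite /= opprB addrCA subrr addr0 ger0_norm// ltW.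
have m1 := measurable_eta_le j (x - e).
have m3 : measurable [set t | x - e < eta (loc j) t < x + e].
  have := measurable_funPT (eta (loc j)) measurableT _ (measurable_itv `]x - e, x + e[).
  by rewrite setTI; congr (measurable _); apply/seteqP; split => t /=; rewrite in_itv.
have le3 : Pr P [set t | x - e < eta (loc j) t < x + e] + Pr P [set t | eta (loc j) t <= x - e]
    <= Pr P [set t | eta (loc j) t <= x + e].
  rewrite -(Ex_indic P m3) -(Ex_indic P m1) -(Ex_indic P (measurable_eta_le j (x + e))) -ExD;
    [|exact: bounded_rv_indic|exact: bounded_rv_indic].
  apply: Ex_le; [by apply: bounded_rvD; exact: bounded_rv_indic|by apply: bounded_rv_indic; exact: measurable_eta_le|].
  move=> t; case: asboolP => [/andP[a1 a2]|_].
    by rewrite asboolF ?asboolT ?addr0//; [exact: ltW|apply/negP; rewrite -ltNge].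
  rewrite add0r; case: asboolP => [a1|_]; last by [].
  have xe : x - e <= x + e by rewrite lerD2l (@le_trans _ _ 0)// ?oppr_le0 ltW.
  by rewrite asboolT// (le_trans a1).
rewrite !cdf_eta ?subr_gt0 ?addr_gt0// in le3.
by move: h1 h2; rewrite /G !ler_norml => /andP[? ?] /andP[? ?]; lra.
Qed.

(** Almost surely the maximum lies in the orthant exactly when every point does, that is, when no
    point occupies a cell that is not below [f]. Coordinates with [f j = M] impose nothing on either
    side. *)
Lemma Pr_eta_orthant (M : nat) (g : nat -> R) (Lam : cellT k M -> R) (f : cellT k M) :
  (forall l l', (l <= l' < M)%N -> g l <= g l') ->
  (forall A : {set cellT k M}, cell0 k M \notin A ->
    Pr P [set t | forall i, cell M g (phi t i) \notin A] = expR (- \sum_(e in A) Lam e)) ->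
  Pr P [set t | orthant (fun j => (f j < M)%N) (fun j => g (f j)) (\row_j eta (loc j) t)] =
  expR (- \sum_(e | ~~ cell_le e f) Lam e).
Proof.
move=> g_mono hvoid; have sM := @measurable_sigma_algebra _ T.
pose A := [set e : cellT k M | ~~ cell_le e f]%SET.
have A0 : cell0 k M \notin A by rewrite inE negbK; apply/forallP => j; rewrite ffunE.
rewrite (eq_bigl (mem A)) => [|e]; last by rewrite !inE.
rewrite -hvoid//; apply: Pr_ae_eq.
- by apply: measurable_orthant => j; under eq_fun do rewrite mxE; exact: measurable_funPT.
- apply: (sigma_algebra_forall sM) => i.
  apply: (fibers_in_pred sM (fun e => e \notin A)); apply: (fibers_cell g_mono sM) => j B mB.
  by rewrite -[X in measurable X]setTI; exact: measurable_phi.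
apply: filterS eta_le_iff => t h; split.
  move=> ho i; rewrite inE negbK; apply/(cell_leP _ _ g_mono) => j fM.
  by have := ho j fM; rewrite mxE => hj; exact: ((h j _).1 hj i).
move=> hc j fM; rewrite mxE; apply: (h j _).2 => i.
by have := hc i; rewrite inE negbK => /(cell_leP _ _ g_mono); exact.
Qed.

End max_stable_cells.

Lemma sample_max_le (R : realType) (I : Type) (x : nat -> I -> R) n s (y : R) : (0 < n)%N ->
  (sample_max x n s <= y) <-> forall i : 'I_n, x i s <= y.
Proof.
move=> n0; split=> [h i|h].
  apply: le_trans h; exact: (le_bigmax _ (fun i : 'I_n => x i s)).
by apply: bigmax_le => [|i _]; [exact: (h (Ordinal n0))|exact: h].
Qed.

Lemma sample_max_measurable (R : realType) (I : Type) d (T : measurableType d)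
    (x : nat -> I -> T -> R) n s : (forall i, measurable_fun setT (x i s)) ->
  measurable_fun setT (fun t => sample_max (fun i l => x i l t) n s).
Proof.
move=> mx; rewrite /sample_max; elim: (index_enum _) => [|i r IH].
  by under eq_fun do rewrite big_nil; exact: mx.
under eq_fun do rewrite big_cons.
exact: measurable_maxr.
Qed.

Section sample_convergence.
Variables (R : realType) (k : nat).
Context d (T : measurableType d) (P : probability T R) (Vs : nat -> 'I_k -> {RV P >-> R}).
Variables (a b : nat -> 'I_k -> R).
Hypothesis a_gt0 : forall n j, 0 < a n j.

Lemma sample_orthant (M : nat) (g : nat -> R) n t (f : cellT k M) : (0 < n)%N ->
  (forall l l', (l <= l' < M)%N -> g l <= g l') ->
  (forall i : 'I_n, cell_le (sample_cell M g Vs a b n i t) f) <->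
  orthant (fun j => (f j < M)%N) (fun j => g (f j))
    (\row_j ((sample_max (fun i l => Vs i l t) n j - b n j) / a n j)).
Proof.
move=> n0 g_mono.
have E j : (sample_max (fun i l => Vs i l t) n j - b n j) / a n j <= g (f j) <->
    forall i : 'I_n, (Vs i j t - b n j) / a n j <= g (f j).
  have e v : ((v - b n j) / a n j <= g (f j)) = (v <= g (f j) * a n j + b n j).
    by rewrite ler_pdivrMr// lerBlDr.
  rewrite e sample_max_le//; split=> h i; have := h i; by rewrite e.
split=> [h j fM|h i].
  by rewrite mxE; apply/E => i; have /(cell_leP _ _ g_mono) := h i; exact.
by apply/(cell_leP _ _ g_mono) => j fM; have := h j fM; rewrite mxE => /E; exact.
Qed.

Context d' (T' : measurableType d') (P' : probability T' R) (Z : T' -> 'rV[R]_k).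
Hypothesis mZ : forall j, measurable_fun setT (fun t => Z t ord0 j).
Hypothesis small_Z : forall j (x c : R), 0 < x -> 0 < c ->
  exists2 e : R, 0 < e & Pr P' [set t | x - e < Z t ord0 j < x + e] <= c.
Hypothesis cvg_max : cvg_in_law P
  (fun n t => \row_j ((sample_max (fun i l => Vs i l t) n j - b n j) / a n j)) P' Z.

Lemma cvg_sample_orthant (M : nat) (g : nat -> R) (f : cellT k M) :
  (forall l l', (l <= l' < M)%N -> g l <= g l') -> (forall l, (l < M)%N -> 0 < g l) ->
  Pr P [set t | forall i : 'I_n, cell_le (sample_cell M g Vs a b n i t) f] @[n --> \oo] -->
  Pr P' [set t | orthant (fun j => (f j < M)%N) (fun j => g (f j)) (Z t)].
Proof.
move=> g_mono g_pos.
have h := @cvg_orthant R k (fun j => (f j < M)%N) _ T P _ T' P'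
  (fun n t => \row_j ((sample_max (fun i l => Vs i l t) n j - b n j) / a n j)) Z _ mZ cvg_max
  (fun j => g (f j)).
have {}h := h _ _; apply: cvg_trans (h _ _).
- apply: near_eq_cvg; near=> n.
  (* For [n = 0], [sample_max] is its default value [x 0], and the equivalence may fail. *)
  have n0 : (0 < n)%N by near: n; exact: nbhs_infty_gt.
  by congr Pr; apply/seteqP; split => t /= ?; apply/sample_orthant.
- move=> n j; under eq_fun do rewrite mxE.
  apply: measurable_funM; last exact: measurable_cst.
  apply: measurable_funB; last exact: measurable_cst.
  exact: (@sample_max_measurable _ _ _ _ (fun i l t => Vs i l t)).
- by move=> j c fM c0; apply: small_Z => //; exact: g_pos.
Unshelve. all: by end_near. Qed.

End sample_convergence.

(** * Measurability of scenarios and patterns *)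

Section hitting_scenario_events.
Variables (R : realType) (k : nat) (I : Type) (loc : 'I_k -> I).
Context d (T : measurableType d).

(** The partition is a function of the finite table recording which pairs of coordinates share their
    maximizers. *)
Lemma fibers_argmax_partition (J : Type) (x : T -> J -> 'I_k -> R) :
  (forall j1 j2, measurable [set t | maximizers (x t) j1 = maximizers (x t) j2]) ->
  fibers_in measurable (fun t => argmax_partition (x t)).
Proof.
move=> mx tau; have sM := @measurable_sigma_algebra _ T.
pose m t := [ffun p : 'I_k * 'I_k => `[< maximizers (x t) p.1 = maximizers (x t) p.2 >]].
pose Phi (m : {ffun 'I_k * 'I_k -> bool}) : {set {set 'I_k}} :=
  equivalence_partition (fun j1 j2 => m (j1, j2)) [set: 'I_k]%SET.
have E t : argmax_partition (x t) = Phi (m t).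
  congr (equivalence_partition _ _); apply/funext => j1; apply/funext => j2.
  by rewrite ffunE.
rewrite (_ : [set t | _] = [set t | Phi (m t) = tau]); last first.
  by apply/seteqP; split => t /=; rewrite E.
apply: (fibers_in_pred sM (fun m => Phi m = tau)).
by apply: (fibers_in_ffun sM) => p; apply: (fibers_in_bool sM); exact: mx.
Qed.

Lemma measurable_maximizers (x : T -> nat -> 'I_k -> R) j1 j2 :
  (forall i j, measurable_fun setT (fun t => x t i j)) ->
  measurable [set t | maximizers (x t) j1 = maximizers (x t) j2].
Proof.
move=> mx; have sM := @measurable_sigma_algebra _ T.
have mm i j : measurable [set t | maximizers (x t) j i].
  by apply: (sigma_algebra_forall sM) => i'; exact: measurable_le.
have : measurable [set t | forall i, maximizers (x t) j1 i <-> maximizers (x t) j2 i].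
  apply: (sigma_algebra_forall sM) => i.
  have imp j j' : measurable [set t | maximizers (x t) j i -> maximizers (x t) j' i].
    have := sigma_algebra_not sM (sigma_algebra_and sM (mm i j) (sigma_algebra_not sM (mm i j'))).
    congr (measurable _); apply/seteqP; split => t /= h.
      by move=> hj; apply: contrapT => nj; apply: h.
    by move=> [hj]; apply; exact: h.
  exact: (sigma_algebra_and sM (imp j1 j2) (imp j2 j1)).
congr (measurable _); apply/seteqP; split => t /=.
  by move=> h; apply/seteqP; split => i /h.
by move=> ->.
Qed.

Lemma fibers_sample_scenario (x : nat -> I -> T -> R) n :
  (forall i s, measurable_fun setT (x i s)) ->
  fibers_in measurable (fun t => sample_hitting_scenario loc (fun i s => x i s t) n : {set {set 'I_k}}).
Proof.
move=> mx tau; have sM := @measurable_sigma_algebra _ T.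
pose m t := [ffun p : 'I_n * 'I_k => `[< sample_max (fun i s => x i s t) n (loc p.2) = x p.1 (loc p.2) t >]].
pose Phi (m : {ffun 'I_n * 'I_k -> bool}) : {set {set 'I_k}} :=
  [set C in [set [set j | m (i, j)] | i : 'I_n] | C != finset.set0]%SET.
have E t : sample_hitting_scenario loc (fun i s => x i s t) n = Phi (m t).
  have h i : hitting_set loc (fun i s => x i s t) i = [set j | m t (i, j)]%SET.
    by apply/setP => j; rewrite !inE ffunE; apply/eqP/asboolP.
  by rewrite /sample_hitting_scenario /Phi (eq_imset _ h).
rewrite (_ : [set t | _] = [set t | Phi (m t) = tau]); last first.
  by apply/seteqP; split => t /=; rewrite E.
apply: (fibers_in_pred sM (fun m => Phi m = tau)).
apply: (fibers_in_ffun sM) => p; apply: (fibers_in_bool sM).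
have mS := @sample_max_measurable R I _ T x n (loc p.2) (fun i => mx i _).
have := sigma_algebra_and sM (measurable_le mS (mx p.1 (loc p.2))) (measurable_le (mx p.1 (loc p.2)) mS).
congr (measurable _); apply/seteqP; split => t /=.
  by move=> [h1 h2]; apply/eqP; rewrite eq_le h1 h2.
by move=> ->.
Qed.

Lemma fibers_occupied (M : nat) (J : Type) (c : T -> J -> cellT k M) :
  (forall e, measurable [set t | exists i, c t i = e]) ->
  fibers_in measurable (fun t => occupied (c t)).
Proof.
move=> mc; have sM := @measurable_sigma_algebra _ T; apply: fibers_set => e.
have := sigma_algebra_and sM (sigma_algebra_cst sM (e != cell0 k M)) (mc e).
congr (measurable _); apply/seteqP; split => t /=; rewrite inE.
  by move=> [-> h] /=; exact/asboolP.
by move=> /andP[e0 /asboolP].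
Qed.

End hitting_scenario_events.

(** * Comparison of the two scenarios *)

Section convergence.
Context (R : realType) (S : topologicalType).
Context d0 (T0 : measurableType d0) (P0 : probability T0 R) (X : S -> {RV P0 >-> R}).
Context d1 (T1 : measurableType d1) (P1 : probability T1 R) (Xs : nat -> S -> {RV P1 >-> R}).
Hypothesis hXs : independent_copies P1 Xs P0 X.
Context dY (TY : measurableType dY) (PY : probability TY R) (Y : S -> {RV PY >-> R}).
Context d2 (T2 : measurableType d2) (P2 : probability T2 R).
Variables (zeta : nat -> {RV P2 >-> R}) (Ys : nat -> S -> {RV P2 >-> R}) (eta : S -> {RV P2 >-> R}).
Hypothesis heta : simple_max_stable Y zeta Ys eta.
Variables (k : nat) (loc : 'I_k -> S) (h : 'I_k -> R -> R).
Hypothesis hh : forall j, {homo h j : x y / x < y}.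
Hypothesis hMDA : max_domain_of_attraction P0 (fun j t => h j (X (loc j) t))
  P2 (fun j => eta (loc j)).

Let pi1 n t : {set {set 'I_k}} := sample_hitting_scenario loc (fun i s => Xs i s t) n.
Let pi2 t : {set {set 'I_k}} := extremal_hitting_scenario loc (spectral_function zeta Ys t).

Let h_le j : {mono h j : x y / x <= y}.
Proof. exact: le_mono (hh j). Qed.

Lemma fibers_pi1 n : fibers_in measurable (pi1 n).
Proof. by apply: fibers_sample_scenario => i s; exact: measurable_funPT. Qed.

Lemma fibers_pi2 : fibers_in measurable pi2.
Proof.
apply: (@fibers_argmax_partition R k _ T2 nat (fun t => phi zeta Ys loc t)) => j1 j2.
by apply: measurable_maximizers => i j; exact: measurable_phi.
Qed.

Lemma cvg_Pr_scenario (tau : {set {set 'I_k}}) :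
  Pr P1 [set t | pi1 n t = tau] @[n --> \oo] --> Pr P2 [set t | pi2 t = tau].
Proof.
have mh j : measurable_fun setT (h j).
  by apply: nondecreasing_measurable => // x y; rewrite h_le.
(* The domain of attraction is stated for copies that are random variables, so the transformed
   sample is packaged as such. *)
have [Vs VsE] : exists Vs : nat -> 'I_k -> {RV P1 >-> R}, forall n j, Vs n j = (fun t => h j (Xs n (loc j) t)) :> (T1 -> R).
  have mV n j : measurable_fun setT (fun t => h j (Xs n (loc j) t)).
    exact: (measurableT_comp (mh j)).
  by exists (fun n j => mfun_Sub (mem_set (mV n j))).
have hVs : independent_copies P1 Vs P0 (fun j t => h j (X (loc j) t)).
  rewrite (_ : (fun n j => Vs n j : T1 -> R) = (fun n j t => h j (Xs n (loc j) t))).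
    exact: (independent_copies_comp loc mh hXs).
  by apply/funext => n; apply/funext => j; exact: VsE.
have [a [b [a0 cvmax]]] := hMDA hVs.
have sM1 := @measurable_sigma_algebra _ T1; have sM2 := @measurable_sigma_algebra _ T2.
apply/cvgrPdist_le => c c0.
(* One [c'] for the exceptional event of the Poisson process, two for that of the sample, one for
   the convergence of the cell patterns. *)
pose c' := c / 4%:R.
have c'0 : 0 < c' by rewrite divr_gt0.
have [M [g [M0 gm gp gc]]] := fine_grid k c'0.
have [Lam [Lam0 hup hvoid hpair]] := phi_exponent_measure heta loc M0 gm gp.
have slab0 j (l : nat) : cell0 k M \notin slab M j l.+1 by rewrite inE ffunE.
have upper0 j : cell0 k M \notin upper M j 0 by rewrite inE ffunE.
have hmax f : Pr P1 [set t | forall i : 'I_n, cell_le (sample_cell M g Vs a b n i t) f] @[n --> \oo] -->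
    expR (- \sum_(e | ~~ cell_le e f) Lam e).
  rewrite -(Pr_eta_orthant heta f gm hvoid).
  apply: cvg_sample_orthant => //.
  - by move=> j; under eq_fun do rewrite mxE; exact: measurable_funPT.
  - move=> j x e x0 e0; have [r r0 hr] := eta_small_interval heta loc j x0 e0; exists r => //.
    by move: hr; congr (Pr _ _ <= _); apply/seteqP; split => t /=; rewrite mxE.
pose cs n t (i : 'I_n) := sample_cell M g Vs a b n i t.
pose cp t i := cell M g (phi zeta Ys loc t i).
have mcs n i (A : {set cellT k M}) : measurable [set t | sample_cell M g Vs a b n i t \in A].
  exact: (measurable_sample_cell gm).
have mcp i (A : {set cellT k M}) : measurable [set t | cp t i \in A].
  apply: (fibers_in_pred sM2 (fun e => e \in A)); apply: (fibers_cell gm sM2) => j B mB.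
  rewrite -[X in measurable X]setTI.
  exact: (@measurable_phi R S _ T2 P2 zeta Ys k loc i j measurableT B mB).
have focc1 n : fibers_in measurable (fun t => occupied (cs n t)).
  apply: fibers_occupied => e; apply: (sigma_algebra_exists_fin sM1) => i.
  by have := mcs n i [set e]%SET; congr (measurable _); apply/seteqP; split => t /=; rewrite inE => /eqP.
have focc2 : fibers_in measurable (fun t => occupied (cp t)).
  apply: fibers_occupied => e; apply: (sigma_algebra_exists sM2) => i.
  by have := mcp i [set e]%SET; congr (measurable _); apply/seteqP; split => t /=; rewrite inE => /eqP.
pose Q (A : {set cellT k M}) := scenario_of_cells A == tau.
have cvQ : Pr P1 [set t | Q (occupied (cs n t))] @[n --> \oo] --> Pr P2 [set t | Q (occupied (cp t))].
  apply: cvg_pattern => // B.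
  pose A := (~: B :\ cell0 k M)%SET.
  have A0 : cell0 k M \notin A by rewrite !inE eqxx.
  have -> : Pr P2 [set t | occupied (cp t) \subset B] = expR (- \sum_(e in A) Lam e).
    rewrite -hvoid//; congr Pr; apply/seteqP; split => t /=.
      by move=> /occupied_subset.
    by move=> ?; apply/occupied_subset.
  have := cvg_sample_void gm hVs hmax A0; apply: cvg_trans; apply: near_eq_cvg.
  apply: nearW => n; congr Pr; apply/seteqP; split => t /=.
    by move=> ?; apply/occupied_subset.
  by move=> /occupied_subset.
have [mB2 PB2] : measurable [set t | unseparated (cp t)] /\ Pr P2 [set t | unseparated (cp t)] <= c'.
  have [] := @Pr_unseparated R k M _ T2 P2 _ cp.
  - move=> j; apply: (sigma_algebra_forall sM2) => i.
    have := sigma_algebra_not sM2 (mcp i (upper M j 0)); congr (measurable _).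
    by apply/seteqP; split => t /= /negP.
  - move=> j l; apply: (sigma_algebra_exists sM2) => i; apply: (sigma_algebra_exists sM2) => i'.
    have := sigma_algebra_and sM2 (sigma_algebra_cst sM2 (i != i')) (sigma_algebra_and sM2 (mcp i (slab M j l)) (mcp i' (slab M j l))).
    by congr (measurable _); apply/seteqP; split => t /=; [move=> [? []]|move=> []].
  move=> mB PB; split=> //; apply: le_trans PB _; apply: le_trans gc; apply: ler_sum => j _.
  apply: lerD; first by rewrite hvoid// hup.
  by apply: ler_sum => l _; rewrite -(@sum_slab R k M g Lam j l hup); exact: hpair.
(* This bound converges to the grid error, which is at most [c'], so it is eventually below
   [c' + c']. *)
pose u n := \sum_(j < k) (Pr P1 [set t | forall i, cs n t i \notin upper M j 0] +
  \sum_(l < M) (n%:R * cell_rate g Vs a b n (slab M j l.+1)) ^+ 2).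
have B1 n : measurable [set t | unseparated (cs n t)] /\ Pr P1 [set t | unseparated (cs n t)] <= u n.
  have [] := @Pr_unseparated R k M _ T1 P1 _ (cs n).
  - move=> j; apply: (sigma_algebra_forall_fin sM1) => i.
    have := sigma_algebra_not sM1 (mcs n i (upper M j 0)); congr (measurable _).
    by apply/seteqP; split => t /= /negP.
  - move=> j l; apply: (sigma_algebra_exists_fin sM1) => i; apply: (sigma_algebra_exists_fin sM1) => i'.
    have := sigma_algebra_and sM1 (sigma_algebra_cst sM1 (i != i')) (sigma_algebra_and sM1 (mcs n i (slab M j l)) (mcs n i' (slab M j l))).
    by congr (measurable _); apply/seteqP; split => t /=; [move=> [? []]|move=> []].
  move=> mB PB; split=> //; apply: le_trans PB _; apply: ler_sum => j _.
  by rewrite lerD2l; apply: ler_sum => l _; exact: (Pr_sample_pair gm hVs).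
have cvu : u n @[n --> \oo] --> \sum_(j < k) (expR (- (g 0%N)^-1) +
        \sum_(l < M) ((g l)^-1 - (if (l.+1 < M)%N then (g l.+1)^-1 else 0)) ^+ 2).
  apply: cvg_sum => j _; apply: cvgD.
    by rewrite -(hup j 0%N M0); exact: (cvg_sample_void gm hVs hmax (upper0 j)).
  apply: cvg_sum => l _; rewrite -(@sum_slab R k M g Lam j l hup).
  rewrite [X in _ --> X]expr2; under eq_fun do rewrite expr2.
  by apply: cvgM; exact: (cvg_rate gm hVs hmax (slab0 j l)).
near=> n.
have n0 : (0 < n)%N by near: n; exact: nbhs_infty_gt.
have un : u n < c' + c' by near: n; apply: (cvgr_lt _ cvu); apply: le_lt_trans gc _; rewrite ltrDl.
have hQ : `|Pr P2 [set t | Q (occupied (cp t))] - Pr P1 [set t | Q (occupied (cs n t))]| <= c'.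
  by near: n; exact: ((cvgrPdist_le _ _).1 cvQ _ c'0).
have [mB1 PB1] := B1 n.
have mQ1 : measurable [set t | Q (occupied (cs n t))].
  exact: (fibers_in_pred sM1 (fun A => Q A) (focc1 n)).
have mQ2 : measurable [set t | Q (occupied (cp t))].
  exact: (fibers_in_pred sM2 (fun A => Q A) focc2).
have d2' : `|Pr P2 [set t | pi2 t = tau] - Pr P2 [set t | Q (occupied (cp t))]| <= c'.
  apply: le_trans PB2; apply: Pr_diff_le => //; first exact: fibers_pi2.
  move=> t /separatedP sep.
  have e : pi2 t = scenario_of_cells (occupied (cp t)) by exact: (scenario_of_cellsE gm sep).
  by rewrite /= e /Q; split => /eqP.
have d1' : `|Pr P1 [set t | pi1 n t = tau] - Pr P1 [set t | Q (occupied (cs n t))]| <= c' + c'.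
  apply: (@le_trans _ _ (Pr P1 [set t | unseparated (cs n t)])); last exact: le_trans PB1 (ltW un).
  apply: Pr_diff_le => //; first exact: fibers_pi1.
  move=> t nB; pose y (i : 'I_n) j := (Vs i j t - b n j) / a n j.
  have sep : separated M g y by exact: separatedP.
  have e : pi1 n t = scenario_of_cells (occupied (cs n t)).
    (* The maps [h j], the shift and the division by [a n j > 0] preserve the order at each
       location, so the scenario of [Xs] is that of the normalized values [y]. *)
    rewrite -(scenario_of_cellsE gm sep); apply: sample_hitting_scenarioE.
      move=> j i i'; rewrite /y ler_pM2r ?invr_gt0// lerD2r !VsE.
      by rewrite h_le.
    by move=> j; have [i [_ hi _]] := separated_maximizer gm j sep; exists i.
  by rewrite /= e /Q; split => /eqP.
have -> : Pr P2 [set t | pi2 t = tau] - Pr P1 [set t | pi1 n t = tau] =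
    (Pr P2 [set t | pi2 t = tau] - Pr P2 [set t | Q (occupied (cp t))]) +
    (Pr P2 [set t | Q (occupied (cp t))] - Pr P1 [set t | Q (occupied (cs n t))]) -
    (Pr P1 [set t | pi1 n t = tau] - Pr P1 [set t | Q (occupied (cs n t))]) by ring.
have cE : c = c' + c' + (c' + c') by rewrite /c'; field.
rewrite cE; apply: le_trans (ler_normB _ _) _; apply: lerD => //.
by apply: le_trans (ler_normD _ _) _; apply: lerD.
Unshelve. all: by end_near. Qed.

(** The target is finite, so the expectation of any test function is a finite combination of the
    probabilities of single scenarios. *)
Lemma cvg_in_law_scenario : cvg_in_law (E := discrete_topology {set {set 'I_k}}) P1 pi1 P2 pi2.
Proof.
move=> f _ _; pose F (A : {set {set 'I_k}}) : R := f A.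
have E1 n : 'E_P1[fun t => f (pi1 n t)]%E = (\sum_A F A * Pr P1 [set t | pi1 n t = A])%:E.
  rewrite (@expectation_Ex _ _ _ P1 (fun t => F (pi1 n t))).
    by rewrite (Ex_indic_fibers P1 F (@fibers_pi1 n)).
  exact: (bounded_rv_fibers F (@fibers_pi1 n)).
have E2 : 'E_P2[fun t => f (pi2 t)]%E = (\sum_A F A * Pr P2 [set t | pi2 t = A])%:E.
  rewrite (@expectation_Ex _ _ _ P2 (fun t => F (pi2 t))).
    by rewrite (Ex_indic_fibers P2 F fibers_pi2).
  exact: (bounded_rv_fibers F fibers_pi2).
rewrite E2; under eq_fun do rewrite E1.
apply/fine_cvgP; split; first exact: nearW.
apply: cvg_sum => A _; apply: cvgM; [exact: cvg_cst|exact: cvg_Pr_scenario].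
Qed.

End convergence.

Theorem theorem1 (R : realType) (dim : nat) (hdim : (1 <= dim)%N)
    (calX : set 'rV[R]_dim) (hcalX : compact calX)
    (* the process X and its independent copies X_1, X_2, ... *)
    (d0 : measure_display) (T0 : measurableType d0) (P0 : probability T0 R)
    (X : calX -> {RV P0 >-> R})
    (hX : forall s : calX, continuous (cdf (X s)))
    (d1 : measure_display) (T1 : measurableType d1) (P1 : probability T1 R)
    (Xs : nat -> calX -> {RV P1 >-> R})
    (hXs : independent_copies P1 Xs P0 X)
    (* the simple max-stable process eta and its spectral representation *)
    (dY : measure_display) (TY : measurableType dY) (PY : probability TY R)
    (Y : calX -> {RV PY >-> R})
    (d2 : measure_display) (T2 : measurableType d2) (P2 : probability T2 R)
    (zeta : nat -> {RV P2 >-> R}) (Ys : nat -> calX -> {RV P2 >-> R})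
    (eta : calX -> {RV P2 >-> R})
    (heta : simple_max_stable Y zeta Ys eta)
    (* the locations s_1, ..., s_k *)
    (k : nat) (hk : (2 <= k)%N) (loc : 'I_k -> calX) (hloc : injective loc)
    (h : 'I_k -> R -> R) (hh : forall j, {homo h j : x y / x < y})
    (hMDA : max_domain_of_attraction P0 (fun j t => h j (X (loc j) t))
              P2 (fun j => eta (loc j))) :
  cvg_in_law P1
    (fun n t => sample_hitting_scenario loc (fun i s => Xs i s t) n)
    P2 (fun t => extremal_hitting_scenario loc (spectral_function zeta Ys t)).
Proof. exact: (cvg_in_law_scenario hXs heta hh hMDA). Qed.
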